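(* The deformation complex of the quotient map of operads $\mathsf{PreLie}\to\mathsf{Ass}$, sending the pre-Lie product $a_1\triangleleft a_2$ to the associative product $a_1\cdot a_2$, is acyclic; that is, $H_\bullet(\mathrm{Def}(\mathsf{PreLie}\to\mathsf{Ass}))=0$.
   Context: All vector spaces are over a field $\Bbbk$ of characteristic zero; chain complexes are homological (differential of degree $-1$); $s$ denotes suspension (degree $1$); the Koszul sign rule is used. $\mathsf{PreLie}$ is the operad of pre-Lie algebras: it is generated by one binary operation $a_1\triangleleft a_2$ (degree $0$, no symmetry) subject to $(a_1\triangleleft a_2)\triangleleft a_3-a_1\triangleleft(a_2\triangleleft a_3)=(a_1\triangleleft a_3)\triangleleft a_2-a_1\triangleleft(a_3\triangleleft a_2)$. $\mathsf{Ass}$ is the (symmetric) operad of non-unital associative algebras. Deformation complex: let $\mathcal{P}=\mathcal{T}(\mathcal{X})/(\mathcal{R})$ be a Koszul operad generated by $\mathcal{X}$ with quadratic relations $\mathcal{R}$, let $\mathcal{P}^{\text{¡}}$ be its Koszul dual cooperad (the quadratic cooperad cogenerated by $s\mathcal{X}$ with corelations $s^2\mathcal{R}$), and let $f\colon\mathcal{P}\to\mathcal{Q}$ be a map of operads (zero differentials). Put $$\mathrm{Hom}^{\mathbb{S}}(\mathcal{P}^{\text{¡}},\mathcal{Q})=\prod_{n\ge1}\mathrm{Hom}(\mathcal{P}^{\text{¡}}(n),\mathcal{Q}(n))^{\mathbb{S}_n}$$ (the arity one component, i.e. the counit of $\mathcal{P}^{\text{¡}}$, is not removed). The product $\phi\triangleleft\psi$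 is computed by applying the infinitesimal decomposition map of $\mathcal{P}^{\text{¡}}$ (sum of all decompositions into two-vertex trees), applying $\phi$ to the root vertex and $\psi$ to the upper vertex, and composing in $\mathcal{Q}$; the bracket is $[\phi,\psi]=\phi\triangleleft\psi-(-1)^{|\phi||\psi|}\psi\triangleleft\phi$. Let $\alpha$ be the degree $-1$ element given by the composite $\mathcal{P}^{\text{¡}}\to s\mathcal{X}\to\mathcal{X}\to\mathcal{Q}$ of the projection onto cogenerators, desuspension, and $f|_{\mathcal{X}}$; it is a Maurer–Cartan element. Then $\mathrm{Def}(f\colon\mathcal{P}\to\mathcal{Q})=(\mathrm{Hom}^{\mathbb{S}}(\mathcal{P}^{\text{¡}},\mathcal{Q}),[-,-],d_\alpha)$ with $d_\alpha=[\alpha,-]$. *)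

(* Defs.v *)
From HB Require Import structures.
From mathcomp Require Import all_boot all_order all_fingroup all_algebra.
From mathcomp Require Import zify boolp.

Set Implicit Arguments.
Unset Strict Implicit.
Unset Printing Implicit Defensive.

Import Order.TTheory GRing.Theory.
Local Open Scope ring_scope.

Section LinearAlgebra.
Variable k : fieldType.

Lemma vspan_exists (V : vectType k) (P : V -> Prop) :
  exists U : {vspace V},
    forall W : {vspace V}, (U <= W)%VS <-> (forall v, P v -> v \in W).
Proof.
suff H : forall n (U : {vspace V}), (\dim {:V} - \dim U <= n)%N ->
    (forall W : {vspace V}, (forall v, P v -> v \in W) -> (U <= W)%VS) ->
    exists U : {vspace V},
      forall W : {vspace V}, (U <= W)%VS <-> (forall v, P v -> v \in W).
  by apply: (H _ 0%VS (leqnn _)) => W _; exact: sub0v.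
elim=> [|n IHn] U hn hU.
  have {hn} UT : U = fullv.
    by apply/eqP; rewrite eqEdim subvf -subn_eq0 -leqn0.
  exists U => W; split=> [UW v _|]; last exact: hU.
  by apply: (subvP UW); rewrite UT memvf.
case: (pselect (exists2 v, P v & v \notin U)) => [[v Pv vU]|nP].
  apply: (IHn (U + <[v]>)%VS) => [|W hW].
    rewrite leq_subLR; rewrite leq_subLR addnS -addSn in hn.
    apply: leq_trans hn _; rewrite leq_add2r ltnNge.
    apply/negP => le_dim; case/negP: vU.
    have /eqP -> : U == (U + <[v]>)%VS by rewrite eqEdim addvSl.
    by apply: (subvP (addvSr U _)); exact: memv_line.
  by rewrite subv_add hU //= -memvE; exact: hW.
exists U => W; split=> [UW v Pv|]; last exact: hU.
apply: (subvP UW); apply/negPn/negP => vU; apply: nP; by exists v.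
Qed.

(* The linear span of an arbitrary (not necessarily decidable) family. *)
Definition vspan (V : vectType k) (P : V -> Prop) : {vspace V} :=
  projT1 (cid (vspan_exists P)).

Lemma vspanP (V : vectType k) (P : V -> Prop) (W : {vspace V}) :
  (vspan P <= W)%VS <-> (forall v, P v -> v \in W).
Proof. exact: (projT2 (cid (vspan_exists P))). Qed.

Lemma mem_vspan (V : vectType k) (P : V -> Prop) v : P v -> v \in vspan P.
Proof. by move: v; apply/vspanP; exact: subvv. Qed.

(* The quotient V / U, realised on a complement of U: projq is the linear
   surjection with kernel U, and vsval picks a representative. *)
Definition quotv (V : vectType k) (U : {vspace V}) : vectType k :=
  subvs_of (U^C)%VS.

Definition projq (V : vectType k) (U : {vspace V}) (v : V) : quotv U :=
  vsproj (U^C)%VS (daddv_pi (U^C)%VS U v).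

Lemma projq_is_linear (V : vectType k) (U : {vspace V}) : linear (@projq V U).
Proof. by move=> a u v; rewrite /projq !linearP. Qed.

HB.instance Definition _ (V : vectType k) (U : {vspace V}) :=
  GRing.isLinear.Build k V (quotv U) _ (@projq V U) (@projq_is_linear V U).

Lemma cap_compl (V : vectType k) (U : {vspace V}) : (U^C :&: U = 0)%VS.
Proof. by rewrite capvC capv_compl. Qed.

Lemma projqK (V : vectType k) (U : {vspace V}) (x : quotv U) :
  projq U (vsval x) = x.
Proof.
rewrite /projq daddv_pi_id ?cap_compl //; first exact: vsvalK.
exact: subvsP.
Qed.

Lemma projq_eq0 (V : vectType k) (U : {vspace V}) (v : V) :
  (projq U v == 0) = (v \in U).
Proof.
have vT : v \in (U^C + U)%VS by rewrite addvC addv_complf memvf.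
have E : daddv_pi (U^C)%VS U v + daddv_pi U (U^C)%VS v = v.
  by rewrite daddv_pi_add ?cap_compl.
apply/eqP/idP => [|vU].
  move/(congr1 vsval); rewrite /projq vsprojK ?memv_pi // linear0 => pv0.
  by rewrite -E pv0 add0r memv_pi.
rewrite /projq.
have E2 : daddv_pi U (U^C)%VS v = v by rewrite daddv_pi_id ?capv_compl.
have -> : daddv_pi (U^C)%VS U v = 0.
  by apply: (addIr v); rewrite add0r -{2}E2.
by rewrite linear0.
Qed.

Lemma projqP (V : vectType k) (U : {vspace V}) (u v : V) :
  projq U u = projq U v <-> u - v \in U.
Proof.
rewrite -projq_eq0 linearB subr_eq0; exact: (rwP eqP).
Qed.

Lemma projq_repr (V : vectType k) (U : {vspace V}) (v : V) :
  vsval (projq U v) - v \in U.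
Proof. by apply/projqP; rewrite projqK. Qed.

End LinearAlgebra.

(* The label in a partial composite x o_i y, with y of arity n, of the input
   of x labelled l != i; the inputs of y are labelled i, ..., i + n - 1. *)
Definition shift (i n l : nat) : nat := if (l < i)%N then l else (l + n).-1.

Section Operads.
Variable k : fieldType.

(* Symmetric operads concentrated in degree 0, with finite dimensional
   components, defined by partial compositions. Inputs are labelled
   0, ..., n - 1. The action is a left one, by relabelling: the input of x
   labelled l is labelled s l in act s x (so x.s = act s^-1 x). Arities are
   related by equations rather than computed, to avoid casts. *)
Record operad := Operad {
  component :> nat -> vectType k;
  act : forall n, 'S_n -> component n -> component n;
  one : component 1;
  comp : forall m n p, (m + n = p.+1)%N -> 'I_m ->
    component m -> component n -> component p;
  act_linear : forall n (s : 'S_n), linear (act s);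
  act1 : forall n (x : component n), act 1%g x = x;
  actM : forall n (s t : 'S_n) (x : component n),
    act (s * t)%g x = act t (act s x);
  comp_linearl : forall m n p (e : (m + n = p.+1)%N) (i : 'I_m)
    (y : component n), linear ((comp e i)^~ y);
  comp_linearr : forall m n p (e : (m + n = p.+1)%N) (i : 'I_m)
    (x : component m), linear (comp e i x);
  comp_onel : forall n (e : (1 + n = n.+1)%N) (x : component n),
    comp e ord0 one x = x;
  comp_oner : forall n (e : (n + 1 = n.+1)%N) (i : 'I_n) (x : component n),
    comp e i x one = x;
  comp_seq : forall m n q p p' r
    (e1 : (m + n = p.+1)%N) (e2 : (p + q = r.+1)%N)
    (e3 : (n + q = p'.+1)%N) (e4 : (m + p' = r.+1)%N)
    (i : 'I_m) (j : 'I_n) (l : 'I_p) x y z,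
    l = (i + j)%N :> nat ->
    comp e2 l (comp e1 i x y) z = comp e4 i x (comp e3 j y z);
  comp_par : forall m n q p p' r
    (e1 : (m + n = p.+1)%N) (e2 : (p + q = r.+1)%N)
    (e3 : (m + q = p'.+1)%N) (e4 : (p' + n = r.+1)%N)
    (i j : 'I_m) (i' : 'I_p') (j' : 'I_p) x y z,
    (i < j)%N -> i' = i :> nat -> j' = shift i n j :> nat ->
    comp e2 j' (comp e1 i x y) z = comp e4 i' (comp e3 j x z) y;
  comp_act : forall m n p (e : (m + n = p.+1)%N) (i : 'I_m)
    (s : 'S_m) (t : 'S_n) (r : 'S_p) x y,
    (forall (l : 'I_m) (u : 'I_p), l != i -> u = shift i n l :> nat ->
      r u = shift (s i) n (s l) :> nat) ->
    (forall (l : 'I_n) (u : 'I_p), u = (i + l)%N :> nat ->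
      r u = (s i + t l)%N :> nat) ->
    comp e (s i) (act s x) (act t y) = act r (comp e i x y) }.

Record operad_morphism (P Q : operad) := OperadMorphism {
  morph : forall n, P n -> Q n;
  morph_linear : forall n, linear (@morph n);
  morph_act : forall n (s : 'S_n) (x : P n), morph (act s x) = act s (morph x);
  morph_one : morph (one P) = one Q;
  morph_comp : forall m n p (e : (m + n = p.+1)%N) (i : 'I_m)
    (x : P m) (y : P n),
    morph (comp e i x y) = comp e i (morph x) (morph y) }.

Record ideal (O : operad) := Ideal {
  ideal_space :> forall n, {vspace (O n)};
  ideal_act : forall n (s : 'S_n) (x : O n),
    x \in ideal_space n -> act s x \in ideal_space n;
  ideal_compl : forall m n p (e : (m + n = p.+1)%N) (i : 'I_m)
    (x : O m) (y : O n),
    x \in ideal_space m -> comp e i x y \in ideal_space p;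
  ideal_compr : forall m n p (e : (m + n = p.+1)%N) (i : 'I_m)
    (x : O m) (y : O n),
    y \in ideal_space n -> comp e i x y \in ideal_space p }.

Section GeneratedIdeal.
Variables (O : operad) (a : nat) (R : {vspace (O a)}).

Definition ideal_gen_space n : {vspace (O n)} :=
  vspan (fun x => forall I : ideal O, (R <= I a)%VS -> x \in I n).

Lemma ideal_gen_spaceP n (x : O n) :
  x \in ideal_gen_space n <-> forall I : ideal O, (R <= I a)%VS -> x \in I n.
Proof.
split=> [xI I RI|]; last exact: mem_vspan.
by apply: (subvP _ _ xI); apply/vspanP => v; apply.
Qed.

Fact ideal_gen_act n (s : 'S_n) (x : O n) :
  x \in ideal_gen_space n -> act s x \in ideal_gen_space n.
Proof.
by move/ideal_gen_spaceP=> xI; apply/ideal_gen_spaceP => I RI;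
  apply: ideal_act; apply: xI.
Qed.

Fact ideal_gen_compl m n p (e : (m + n = p.+1)%N) (i : 'I_m)
    (x : O m) (y : O n) :
  x \in ideal_gen_space m -> comp e i x y \in ideal_gen_space p.
Proof.
by move/ideal_gen_spaceP=> xI; apply/ideal_gen_spaceP => I RI;
  apply: ideal_compl; apply: xI.
Qed.

Fact ideal_gen_compr m n p (e : (m + n = p.+1)%N) (i : 'I_m)
    (x : O m) (y : O n) :
  y \in ideal_gen_space n -> comp e i x y \in ideal_gen_space p.
Proof.
by move/ideal_gen_spaceP=> xI; apply/ideal_gen_spaceP => I RI;
  apply: ideal_compr; apply: xI.
Qed.

Definition ideal_gen : ideal O :=
  Ideal ideal_gen_act ideal_gen_compl ideal_gen_compr.

Lemma ideal_gen_sub : (R <= ideal_gen a)%VS.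
Proof.
apply/subvP => x xR; apply/ideal_gen_spaceP => I RI; exact: (subvP RI).
Qed.

Lemma ideal_gen_min (I : ideal O) :
  (R <= I a)%VS -> forall n, (ideal_gen n <= I n)%VS.
Proof. by move=> RI n; apply/subvP => x /ideal_gen_spaceP; apply. Qed.

End GeneratedIdeal.

Section QuotientOperad.
Variables (O : operad) (I : ideal O).

Let C n := quotv (I n).
Let q n : O n -> C n := @projq k (O n) (I n).
Let rep n (x : C n) : O n := vsval x.

Definition quot_act n (s : 'S_n) (x : C n) : C n := q (act s (rep x)).
Definition quot_comp m n p (e : (m + n = p.+1)%N) (i : 'I_m)
  (x : C m) (y : C n) : C p := q (comp e i (rep x) (rep y)).

Let qK n (x : C n) : q (rep x) = x. Proof. exact: projqK. Qed.
Let q_lin n : linear (@q n). Proof. exact: projq_is_linear. Qed.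

Let act_sub n (s : 'S_n) (x y : O n) : act s (x - y) = act s x - act s y.
Proof. by rewrite addrC -scaleN1r act_linear scaleN1r addrC. Qed.

Let comp_subl m n p (e : (m + n = p.+1)%N) (i : 'I_m) (x x' : O m) (y : O n) :
  comp e i (x - x') y = comp e i x y - comp e i x' y.
Proof.
by rewrite addrC -scaleN1r (comp_linearl e i y (-1) x' x) /= scaleN1r addrC.
Qed.

Let comp_subr m n p (e : (m + n = p.+1)%N) (i : 'I_m) (x : O m) (y y' : O n) :
  comp e i x (y - y') = comp e i x y - comp e i x y'.
Proof. by rewrite addrC -scaleN1r comp_linearr scaleN1r addrC. Qed.

Lemma quot_actE n (s : 'S_n) (x : O n) : quot_act s (q x) = q (act s x).
Proof. by apply/projqP; rewrite -act_sub; apply/ideal_act/projq_repr. Qed.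

Lemma quot_compE m n p (e : (m + n = p.+1)%N) (i : 'I_m) (x : O m) (y : O n) :
  quot_comp e i (q x) (q y) = q (comp e i x y).
Proof.
have -> : quot_comp e i (q x) (q y) = q (comp e i x (rep (q y))).
  by apply/projqP; rewrite -comp_subl; apply/ideal_compl/projq_repr.
by apply/projqP; rewrite -comp_subr; apply/ideal_compr/projq_repr.
Qed.

Fact quot_act_linear n (s : 'S_n) : linear (@quot_act n s).
Proof.
move=> a x y; rewrite -(qK x) -(qK y) -q_lin !quot_actE.
by rewrite act_linear q_lin.
Qed.

Fact quot_act1 n (x : C n) : quot_act 1%g x = x.
Proof. by rewrite -(qK x) quot_actE act1. Qed.

Fact quot_actM n (s t : 'S_n) (x : C n) :
  quot_act (s * t)%g x = quot_act t (quot_act s x).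
Proof. by rewrite -(qK x) !quot_actE actM. Qed.

Fact quot_comp_linearl m n p (e : (m + n = p.+1)%N) (i : 'I_m) (y : C n) :
  linear ((quot_comp e i)^~ y).
Proof.
move=> a x x'; rewrite -(qK x) -(qK x') -(qK y) -q_lin !quot_compE.
by rewrite -q_lin; congr q; apply: (comp_linearl e i (rep y)).
Qed.

Fact quot_comp_linearr m n p (e : (m + n = p.+1)%N) (i : 'I_m) (x : C m) :
  linear (quot_comp e i x).
Proof.
move=> a y y'; rewrite -(qK x) -(qK y) -(qK y') -q_lin !quot_compE.
by rewrite -q_lin comp_linearr.
Qed.

Fact quot_comp_onel n (e : (1 + n = n.+1)%N) (x : C n) :
  quot_comp e ord0 (q (one O)) x = x.
Proof. by rewrite -(qK x) quot_compE comp_onel. Qed.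

Fact quot_comp_oner n (e : (n + 1 = n.+1)%N) (i : 'I_n) (x : C n) :
  quot_comp e i x (q (one O)) = x.
Proof. by rewrite -(qK x) quot_compE comp_oner. Qed.

Fact quot_comp_seq m n r p p' t
    (e1 : (m + n = p.+1)%N) (e2 : (p + r = t.+1)%N)
    (e3 : (n + r = p'.+1)%N) (e4 : (m + p' = t.+1)%N)
    (i : 'I_m) (j : 'I_n) (l : 'I_p) (x : C m) (y : C n) (z : C r) :
  l = (i + j)%N :> nat ->
  quot_comp e2 l (quot_comp e1 i x y) z = quot_comp e4 i x (quot_comp e3 j y z).
Proof.
move=> h; rewrite -(qK x) -(qK y) -(qK z) !quot_compE.
by congr q; apply: comp_seq.
Qed.

Fact quot_comp_par m n r p p' t
    (e1 : (m + n = p.+1)%N) (e2 : (p + r = t.+1)%N)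
    (e3 : (m + r = p'.+1)%N) (e4 : (p' + n = t.+1)%N)
    (i j : 'I_m) (i' : 'I_p') (j' : 'I_p) (x : C m) (y : C n) (z : C r) :
  (i < j)%N -> i' = i :> nat -> j' = shift i n j :> nat ->
  quot_comp e2 j' (quot_comp e1 i x y) z =
  quot_comp e4 i' (quot_comp e3 j x z) y.
Proof.
move=> h1 h2 h3; rewrite -(qK x) -(qK y) -(qK z) !quot_compE.
by congr q; apply: comp_par.
Qed.

Fact quot_comp_act m n p (e : (m + n = p.+1)%N) (i : 'I_m)
    (s : 'S_m) (t : 'S_n) (r : 'S_p) (x : C m) (y : C n) :
  (forall (l : 'I_m) (u : 'I_p), l != i -> u = shift i n l :> nat ->
    r u = shift (s i) n (s l) :> nat) ->
  (forall (l : 'I_n) (u : 'I_p), u = (i + l)%N :> nat ->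
    r u = (s i + t l)%N :> nat) ->
  quot_comp e (s i) (quot_act s x) (quot_act t y) =
  quot_act r (quot_comp e i x y).
Proof.
move=> h1 h2; rewrite -(qK x) -(qK y) !(quot_compE, quot_actE).
by congr q; apply: comp_act.
Qed.

Definition quotient_operad : operad :=
  Operad quot_act_linear quot_act1 quot_actM quot_comp_linearl
    quot_comp_linearr quot_comp_onel quot_comp_oner quot_comp_seq
    quot_comp_par quot_comp_act.

Definition quotient_proj : operad_morphism O quotient_operad :=
  @OperadMorphism O quotient_operad q q_lin
    (fun n s x => esym (quot_actE s x)) (erefl _)
    (fun m n p e i x y => esym (quot_compE e i x y)).

End QuotientOperad.

Section InducedMorphism.
Variables (O : operad) (I J : ideal O).
Hypothesis IJ : forall n, (I n <= J n)%VS.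

Definition induced n (x : quotient_operad I n) : quotient_operad J n :=
  morph (quotient_proj J) (vsval x).

Lemma inducedE n (x : O n) :
  induced (morph (quotient_proj I) x) = morph (quotient_proj J) x.
Proof.
by apply/projqP; apply: (subvP (IJ n)); apply: projq_repr.
Qed.

Let projK n (x : quotient_operad I n) : morph (quotient_proj I) (vsval x) = x.
Proof. exact: projqK. Qed.

Fact induced_linear n : linear (@induced n).
Proof. by move=> a x y; rewrite /induced linearP morph_linear. Qed.

Fact induced_act n (s : 'S_n) (x : quotient_operad I n) :
  induced (act s x) = act s (induced x).
Proof. by rewrite -(projK x) -morph_act !inducedE morph_act. Qed.

Fact induced_one : induced (one (quotient_operad I)) = one (quotient_operad J).
Proof. exact: inducedE. Qed.

Fact induced_comp m n p (e : (m + n = p.+1)%N) (i : 'I_m)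
    (x : quotient_operad I m) (y : quotient_operad I n) :
  induced (comp e i x y) = comp e i (induced x) (induced y).
Proof. by rewrite -(projK x) -(projK y) -morph_comp !inducedE morph_comp. Qed.

Definition induced_morphism :
    operad_morphism (quotient_operad I) (quotient_operad J) :=
  OperadMorphism induced_linear induced_act induced_one induced_comp.

End InducedMorphism.

End Operads.

(* Planar binary trees with leaves labelled by natural numbers, that is,
   non-associative monomials in one binary operation. *)
Inductive btree := Leaf of nat | Node of btree & btree.

Fixpoint btree_encode (t : btree) : GenTree.tree nat :=
  match t with
  | Leaf l => GenTree.Leaf l
  | Node u v => GenTree.Node 0 [:: btree_encode u; btree_encode v]
  end.

Fixpoint btree_decode (t : GenTree.tree nat) : btree :=
  match t with
  | GenTree.Leaf l => Leaf l
  | GenTree.Node _ [:: u; v] => Node (btree_decode u) (btree_decode v)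
  | _ => Leaf 0
  end.

Lemma btree_encodeK : cancel btree_encode btree_decode.
Proof. by elim=> //= u -> v ->. Qed.

HB.instance Definition _ := Countable.copy btree (can_type btree_encodeK).

Fixpoint leaves (t : btree) : seq nat :=
  if t is Node u v then leaves u ++ leaves v else
  if t is Leaf l then [:: l] else [::].

Fixpoint subst (f : nat -> btree) (t : btree) : btree :=
  match t with
  | Leaf l => f l
  | Node u v => Node (subst f u) (subst f v)
  end.

Definition relabel (f : nat -> nat) : btree -> btree := subst (Leaf \o f).

(* Grafting the root of t on the leaf of s labelled i. *)
Definition graft (i : nat) (s t : btree) : btree :=
  subst (fun l => if l == i then relabel (addn i) t
                  else Leaf (shift i (size (leaves t)) l)) s.

Definition multilinear (n : nat) (t : btree) : bool :=
  perm_eq (leaves t) (iota 0 n).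

Definition monomial (n : nat) := {t : btree | multilinear n t}.

Fixpoint bounded_trees (n h : nat) : seq btree :=
  if h is h'.+1 then
    map Leaf (iota 0 n) ++
    [seq Node u v | u <- bounded_trees n h', v <- bounded_trees n h']
  else [::].

Lemma size_leaves_gt0 t : (0 < size (leaves t))%N.
Proof. by elim: t => //= u hu v _; rewrite size_cat ltn_addr. Qed.

Lemma mem_bounded_trees n h t :
  (size (leaves t) <= h)%N -> all (fun l => l < n)%N (leaves t) ->
  t \in bounded_trees n h.
Proof.
elim: h t => [|h IHh] t; first by rewrite leqNgt size_leaves_gt0.
case: t => [l|u v] /=.
  by rewrite andbT => _ ln; rewrite mem_cat map_f // mem_iota.
rewrite size_cat all_cat => hs /andP[hu hv]; rewrite mem_cat; apply/orP; right.
have u0 := size_leaves_gt0 u; have v0 := size_leaves_gt0 v.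
apply: allpairs_f; apply: IHh => //; rewrite -ltnS; apply: leq_trans hs.
  by rewrite -[X in (X < _)%N]addn0 ltn_add2l.
by rewrite -[X in (X < _)%N]add0n ltn_add2r.
Qed.

Definition monomial_enum n : seq (monomial n) :=
  undup (pmap insub (bounded_trees n n)).

Lemma monomial_enumP n : Finite.axiom (monomial_enum n).
Proof.
apply: Finite.uniq_enumP => [|u]; first exact: undup_uniq.
rewrite mem_undup; have Mu : multilinear n (val u) := valP u.
rewrite mem_pmap_sub mem_bounded_trees //.
  by rewrite (perm_size Mu) size_iota.
by rewrite (perm_all _ Mu); apply/allP => l; rewrite mem_iota.
Qed.

HB.instance Definition _ n := SubChoice.on (monomial n).
HB.instance Definition _ n := Countable.on (monomial n).
HB.instance Definition _ n := isFinite.Build (monomial n) (@monomial_enumP n).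

(* A permutation of 'I_n as a function on labels. *)
Definition permn n (s : 'S_n) (l : nat) : nat :=
  if insub l is Some j then nat_of_ord (s j) else l.

Lemma permnE n (s : 'S_n) (j : 'I_n) : permn s j = s j.
Proof. by rewrite /permn valK. Qed.

Lemma subst_subst f g t : subst f (subst g t) = subst (subst f \o g) t.
Proof. by elim: t => //= u -> v ->. Qed.

Lemma eq_subst f g t :
  (forall l : nat, l \in leaves t -> f l = g l) -> subst f t = subst g t.
Proof.
elim: t => /= [l|u hu v hv] h; first by apply: h; rewrite mem_head.
by rewrite hu ?hv // => l hl; apply: h; rewrite mem_cat hl ?orbT.
Qed.

Lemma subst_Leaf t : subst Leaf t = t.
Proof. by elim: t => //= u -> v ->. Qed.

Lemma leaves_subst f t :
  leaves (subst f t) = flatten (map (leaves \o f) (leaves t)).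
Proof.
elim: t => /= [l|u -> v ->]; first by rewrite cats0.
by rewrite map_cat flatten_cat.
Qed.

Lemma leaves_relabel f t : leaves (relabel f t) = map f (leaves t).
Proof. by elim: t => //= u -> v ->; rewrite map_cat. Qed.

Lemma perm_flatten_map (T : eqType) (S : eqType) (f : T -> seq S) (s t : seq T) :
  perm_eq s t -> perm_eq (flatten (map f s)) (flatten (map f t)).
Proof.
move=> st; apply/seq.permP => a; rewrite !count_flatten -!map_comp.
exact/perm_sumn/perm_map.
Qed.

Lemma multilinear_relabel n (s : 'S_n) t :
  multilinear n t -> multilinear n (relabel (permn s) t).
Proof.
move=> Mt; rewrite /multilinear leaves_relabel.
rewrite (perm_trans (perm_map _ Mt)) //.
apply: uniq_perm; rewrite ?iota_uniq //.
  rewrite map_inj_in_uniq ?iota_uniq // => i j.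
  rewrite !mem_iota /= !add0n => hi hj.
  rewrite -[i]/(val (Ordinal hi)) -[j]/(val (Ordinal hj)) !permnE.
  by move=> /val_inj/perm_inj->.
move=> l; apply/mapP/idP => [[i]|].
  rewrite !mem_iota /= !add0n => hi ->.
  by rewrite -[i]/(val (Ordinal hi)) permnE.
rewrite mem_iota /= add0n => hl.
exists (val ((s^-1)%g (Ordinal hl))); first by rewrite mem_iota /= add0n.
by rewrite permnE permKV.
Qed.

Lemma multilinear_graft m n p (i : 'I_m) s t : (m + n = p.+1)%N ->
  multilinear m s -> multilinear n t -> multilinear p (graft i s t).
Proof.
move=> e Ms Mt; rewrite /multilinear /graft leaves_subst.
have st : size (leaves t) = n by rewrite (perm_size Mt) size_iota.
rewrite st; apply: perm_trans (perm_flatten_map _ Ms) _.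
have im := ltn_ord i.
have -> : iota 0 m = iota 0 i ++ nat_of_ord i :: iota i.+1 (m - i.+1).
  by rewrite -[in LHS](subnKC im) addSnnS iotaD.
rewrite map_cat flatten_cat /= eqxx leaves_relabel.
set f := leaves \o _.
have flat1 g r : {in r, forall l, f l = [:: g l]} -> flatten (map f r) = map g r.
  elim: r => //= l r IHr h; rewrite h ?mem_head // IHr // => l' hl'.
  by apply: h; rewrite inE hl' orbT.
rewrite (flat1 id) => [|l]; last first.
  by rewrite mem_iota /= add0n => li; rewrite /f /= ltn_eqF //= /shift li.
rewrite (flat1 (fun l => (l + n).-1)) => [|l]; last first.
  rewrite mem_iota => /andP[il _].
  by rewrite /f /= gtn_eqF //= /shift ltnNge ltnW.
rewrite map_id.
have -> : map (fun l => (l + n).-1) (iota i.+1 (m - i.+1))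
    = iota (i + n) (m - i.+1).
  rewrite -[(i + n)%N]addn0 iotaDl -[i.+1]addn0 iotaDl -map_comp.
  by apply: eq_map => l; rewrite /= addnAC.
have -> : p = (i + (n + (m - i.+1)))%N.
  by apply: succn_inj; rewrite -e -[m in LHS](subnKC im) !addSn -addnA (addnC n).
rewrite iotaD add0n perm_cat2l iotaD perm_cat2r.
by rewrite -[in iota _ n](addn0 i) iotaDl; apply: perm_map.
Qed.

Local Ltac shift_lia :=
  rewrite ?/shift;
  repeat match goal with |- context [if (?a < ?b)%N then _ else _] =>
    lazymatch a with
    | context [if _ then _ else _] => fail
    | _ => case: (ltnP a b) => ?
    end
  end; try congr Leaf; lia.

Lemma relabel_comp f g t : relabel f (relabel g t) = relabel (f \o g) t.
Proof. exact: subst_subst. Qed.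

Lemma eq_relabel f g t : {in leaves t, f =1 g} -> relabel f t = relabel g t.
Proof. by move=> h; apply: eq_subst => l hl /=; rewrite h. Qed.

Lemma permn1 n l : permn (1 : 'S_n)%g l = l.
Proof. by rewrite /permn; case: insubP => // j _ <-; rewrite perm1. Qed.

Lemma permnM n (s t : 'S_n) l : permn (s * t)%g l = permn t (permn s l).
Proof.
rewrite {1 3}/permn; case: insubP => [j _ _|nl]; first by rewrite permM permnE.
by rewrite /permn insubN.
Qed.

Lemma mem_multilinear n t l : multilinear n t -> (l \in leaves t) = (l < n)%N.
Proof. by move/perm_mem->; rewrite mem_iota. Qed.

Lemma size_multilinear n t : multilinear n t -> size (leaves t) = n.
Proof. by move/perm_size->; rewrite size_iota. Qed.

Lemma graft_onel t : graft 0 (Leaf 0) t = t.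
Proof. exact: subst_Leaf. Qed.

Lemma graft_oner i t : graft i t (Leaf 0) = t.
Proof.
rewrite -[RHS]subst_Leaf; apply: eq_subst => l _ /=.
rewrite /shift addn1 if_same; case: eqVneq => // ->.
by rewrite /relabel /= addn0.
Qed.

Lemma graft_seq m n q p' (e : (n + q = p'.+1)%N) (i : 'I_m) (j : 'I_n) s t u :
  multilinear n t -> multilinear q u ->
  graft (i + j) (graft i s t) u = graft i s (graft j t u).
Proof.
move=> Mt Mu; have Mtu := multilinear_graft j e Mt Mu.
rewrite /graft subst_subst; apply: eq_subst => l _ /=.
rewrite -/(graft j t u).
rewrite (size_multilinear Mt) (size_multilinear Mu) (size_multilinear Mtu).
have jn := ltn_ord j.
have q0 : (0 < q)%N by rewrite -(size_multilinear Mu) size_leaves_gt0.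
have [li|nli] := eqVneq l i.
  rewrite /graft /relabel !subst_subst; apply: eq_subst => x _ /=.
  rewrite (size_multilinear Mu) eqn_add2l.
  have [xj|nxj] := eqVneq x j.
    by rewrite subst_subst; apply: eq_subst => y _ /=; rewrite addnA.
  by rewrite /=; shift_lia.
have t0 : (0 < n)%N by apply: leq_trans jn.
rewrite /=; have -> : (shift i n l == i + j)%N = false by shift_lia.
by rewrite /=; shift_lia.
Qed.

Lemma graft_par m n q (i j : 'I_m) s t u : (i < j)%N ->
  multilinear n t -> multilinear q u ->
  graft (shift i n j) (graft i s t) u = graft i (graft j s u) t.
Proof.
move=> ij Mt Mu; rewrite /graft !subst_subst; apply: eq_subst => l _ /=.
rewrite (size_multilinear Mt) (size_multilinear Mu).
have n0 : (0 < n)%N by rewrite -(size_multilinear Mt) size_leaves_gt0.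
have q0 : (0 < q)%N by rewrite -(size_multilinear Mu) size_leaves_gt0.
have -> : shift i n j = (j + n).-1 by rewrite /shift ltnNge ltnW.
have [->|li] := eqVneq l i.
  rewrite ltn_eqF //= {2}/shift ij eqxx.
  rewrite /relabel subst_subst; apply: eq_subst => x xt /=.
  have xn : (x < n)%N by rewrite -(mem_multilinear x Mt).
  rewrite ltn_eqF; last by lia.
  by shift_lia.
have [->|lj] := eqVneq l j.
  rewrite /= {1}/shift ltnNge ltnW //= eqxx.
  rewrite /relabel subst_subst; apply: eq_subst => x xu /=.
  rewrite gtn_eqF; last by lia.
  by shift_lia.
rewrite /=.
have -> : (shift i n l == (j + n).-1) = false by shift_lia.
have -> : (shift j q l == i) = false by shift_lia.
by shift_lia.
Qed.

Lemma graft_act m n p (e : (m + n = p.+1)%N) (i : 'I_m)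
    (s : 'S_m) (t : 'S_n) (r : 'S_p) a b :
  (forall (l : 'I_m) (u : 'I_p), l != i -> u = shift i n l :> nat ->
    r u = shift (s i) n (s l) :> nat) ->
  (forall (l : 'I_n) (u : 'I_p), u = (i + l)%N :> nat ->
    r u = (s i + t l)%N :> nat) ->
  multilinear m a -> multilinear n b ->
  graft (s i) (relabel (permn s) a) (relabel (permn t) b)
  = relabel (permn r) (graft i a b).
Proof.
move=> h1 h2 Ma Mb; have Mb' := multilinear_relabel t Mb.
rewrite /graft (size_multilinear Mb) (size_multilinear Mb').
rewrite /relabel !subst_subst; apply: eq_subst => l.
rewrite (mem_multilinear l Ma) => lm /=.
have il := ltn_ord i.
have n0 : (0 < n)%N by rewrite -(size_multilinear Mb) size_leaves_gt0.
rewrite -[l]/(val (Ordinal lm)) permnE -[_ == val i]/(Ordinal lm == i).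
rewrite -[_ == _ :> nat]/(s (Ordinal lm) == s i) (inj_eq perm_inj).
case: eqVneq => [_|nli].
  rewrite !subst_subst; apply: eq_subst => x /=.
  rewrite (mem_multilinear x Mb) => xn.
  have xp : (i + x < p)%N by lia.
  rewrite -[(i + x)%N]/(val (Ordinal xp)) permnE.
  by rewrite -{1}[x]/(val (Ordinal xn)) permnE (h2 (Ordinal xn)).
have nli' : l != i by [].
have lp : (shift i n l < p)%N by shift_lia.
rewrite /= -[shift i n l]/(val (Ordinal lp)) permnE.
by rewrite (h1 (Ordinal lm)).
Qed.

Section FreeOperad.
Variable k : fieldType.

(* Component of arity n of the free operad on one binary operation with no
   symmetry (that is, generated by the regular representation of S_2), with
   basis the multilinear monomials. *)
Definition tvec (n : nat) : vectType k := {ffun monomial n -> k^o}.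

Definition mono (n : nat) (t : btree) : tvec n :=
  [ffun u : monomial n => (val u == t)%:R].

(* Linear extension of a map defined on monomials. *)
Definition lin_ext (n : nat) (V : lmodType k) (f : btree -> V) (c : tvec n) : V :=
  \sum_(u : monomial n) (c u : k) *: f (val u).

Lemma lin_ext_linear n (V : lmodType k) (f : btree -> V) :
  linear (@lin_ext n V f).
Proof.
move=> a x y; rewrite /lin_ext scaler_sumr -big_split; apply: eq_bigr => u _.
by rewrite !ffunE scalerDl scalerA.
Qed.

Lemma lin_ext_addZ n (V : lmodType k) (f g : btree -> V) (a : k) (c : tvec n) :
  lin_ext (fun t => a *: f t + g t) c = a *: lin_ext f c + lin_ext g c.
Proof.
rewrite /lin_ext scaler_sumr -big_split; apply: eq_bigr => u _.
by rewrite scalerDr !scalerA (mulrC a).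
Qed.

Lemma lin_ext_mono n (V : lmodType k) (f : btree -> V) t :
  multilinear n t -> lin_ext f (mono n t) = f t.
Proof.
move=> Mt; rewrite /lin_ext (bigD1 (Sub t Mt : monomial n)) //=.
rewrite ffunE SubK eqxx scale1r big1 ?addr0 // => u ut.
by rewrite ffunE -[t](SubK (monomial n) Mt) (inj_eq val_inj) (negPf ut) scale0r.
Qed.

Lemma lin_ext_id n (c : tvec n) : lin_ext (mono n) c = c.
Proof.
apply/ffunP => u; rewrite /lin_ext sum_ffunE (bigD1 u) //= !ffunE eqxx.
rewrite [_ *: _]mulr1 big1 ?addr0 // => v vu; rewrite !ffunE.
by rewrite (inj_eq val_inj) eq_sym (negPf vu) [_ *: _]mulr0.
Qed.

Lemma linear_sum_raw (V W : lmodType k) (f : V -> W) (I : finType)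
    (a : I -> k) (v : I -> V) :
  linear f -> f (\sum_i a i *: v i) = \sum_i a i *: f (v i).
Proof.
move=> lf; have f0 : f 0 = 0.
  by have := lf (-1) 0 0; rewrite scaler0 addr0 scaleN1r addNr.
apply: (big_ind2 (fun x y => f x = y)) => // [x y z t <- <-|i _].
  by have := lf 1 x z; rewrite !scale1r.
by have := lf (a i) (v i) 0; rewrite !addr0 f0 addr0.
Qed.

Lemma tvec_ext n (V : lmodType k) (f g : tvec n -> V) :
  linear f -> linear g ->
  (forall t, multilinear n t -> f (mono n t) = g (mono n t)) -> f =1 g.
Proof.
move=> lf lg fg c; rewrite -(lin_ext_id c) /lin_ext !linear_sum_raw //.
by apply: eq_bigr => u _; rewrite fg // (valP u).
Qed.

Definition free_act n (s : 'S_n) : tvec n -> tvec n :=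
  lin_ext (fun t => mono n (relabel (permn s) t)).

Definition free_comp m n p (_ : (m + n = p.+1)%N) (i : 'I_m)
    (x : tvec m) (y : tvec n) : tvec p :=
  lin_ext (fun s => lin_ext (fun t => mono p (graft i s t)) y) x.

Lemma free_act_mono n (s : 'S_n) t : multilinear n t ->
  free_act s (mono n t) = mono n (relabel (permn s) t).
Proof. by move=> Mt; rewrite /free_act lin_ext_mono. Qed.

Lemma free_comp_mono m n p (e : (m + n = p.+1)%N) (i : 'I_m) s t :
  multilinear m s -> multilinear n t ->
  free_comp e i (mono m s) (mono n t) = mono p (graft i s t).
Proof. by move=> Ms Mt; rewrite /free_comp !lin_ext_mono. Qed.

Fact free_act_linear n (s : 'S_n) : linear (@free_act n s).
Proof. exact: lin_ext_linear. Qed.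

Fact free_comp_linearl m n p (e : (m + n = p.+1)%N) (i : 'I_m) (y : tvec n) :
  linear ((free_comp e i)^~ y).
Proof. exact: lin_ext_linear. Qed.

Fact free_comp_linearr m n p (e : (m + n = p.+1)%N) (i : 'I_m) (x : tvec m) :
  linear (free_comp e i x).
Proof.
move=> a y z; rewrite /free_comp -lin_ext_addZ.
by apply: eq_bigr => u _; rewrite lin_ext_linear.
Qed.

Let linear_id (V : lmodType k) : linear (@idfun V). Proof. by []. Qed.

Let linear_comp (U V W : lmodType k) (f : V -> W) (g : U -> V) :
  linear f -> linear g -> linear (fun x => f (g x)).
Proof. by move=> lf lg a x y; rewrite lg lf. Qed.

Fact free_act1 n (x : tvec n) : free_act 1%g x = x.
Proof.
move: x; apply: tvec_ext => [||t Mt]; [exact: free_act_linear|by []|].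
rewrite free_act_mono //; congr mono; rewrite -[RHS]subst_Leaf.
by apply: eq_subst => l _ /=; rewrite permn1.
Qed.

Fact free_actM n (s t : 'S_n) (x : tvec n) :
  free_act (s * t)%g x = free_act t (free_act s x).
Proof.
move: x; apply: tvec_ext => [||u Mu]; first exact: free_act_linear.
  by apply: linear_comp; apply: free_act_linear.
rewrite !free_act_mono ?multilinear_relabel // relabel_comp; congr mono.
by apply: eq_relabel => l _ /=; rewrite permnM.
Qed.

Definition free_one : tvec 1 := mono 1 (Leaf 0).

Fact free_comp_onel n (e : (1 + n = n.+1)%N) (x : tvec n) :
  free_comp e ord0 free_one x = x.
Proof.
move: x; apply: tvec_ext => [||t Mt]; [exact: free_comp_linearr|by []|].
by rewrite free_comp_mono // graft_onel.
Qed.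

Fact free_comp_oner n (e : (n + 1 = n.+1)%N) (i : 'I_n) (x : tvec n) :
  free_comp e i x free_one = x.
Proof.
move: x; apply: tvec_ext => [||t Mt]; [exact: free_comp_linearl|by []|].
by rewrite free_comp_mono // graft_oner.
Qed.

Fact free_comp_seq m n q p p' r
    (e1 : (m + n = p.+1)%N) (e2 : (p + q = r.+1)%N)
    (e3 : (n + q = p'.+1)%N) (e4 : (m + p' = r.+1)%N)
    (i : 'I_m) (j : 'I_n) (l : 'I_p) (x : tvec m) (y : tvec n) (z : tvec q) :
  l = (i + j)%N :> nat ->
  free_comp e2 l (free_comp e1 i x y) z = free_comp e4 i x (free_comp e3 j y z).
Proof.
move=> h; move: x; apply: tvec_ext => [||s Ms].
- apply: (@linear_comp _ _ _ ((free_comp e2 l)^~ z) ((free_comp e1 i)^~ y));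
  exact: free_comp_linearl.
- exact: free_comp_linearl.
move: y; apply: tvec_ext => [||t Mt].
- apply: (@linear_comp _ _ _ ((free_comp e2 l)^~ z));
  [exact: free_comp_linearl | exact: free_comp_linearr].
- apply: linear_comp; [exact: free_comp_linearr | exact: free_comp_linearl].
move: z; apply: tvec_ext => [||u Mu].
- exact: free_comp_linearr.
- apply: linear_comp; exact: free_comp_linearr.
rewrite !free_comp_mono ?(multilinear_graft i e1) ?(multilinear_graft j e3) //.
by rewrite h (graft_seq e3).
Qed.

Fact free_comp_par m n q p p' r
    (e1 : (m + n = p.+1)%N) (e2 : (p + q = r.+1)%N)
    (e3 : (m + q = p'.+1)%N) (e4 : (p' + n = r.+1)%N)
    (i j : 'I_m) (i' : 'I_p') (j' : 'I_p)
    (x : tvec m) (y : tvec n) (z : tvec q) :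
  (i < j)%N -> i' = i :> nat -> j' = shift i n j :> nat ->
  free_comp e2 j' (free_comp e1 i x y) z =
  free_comp e4 i' (free_comp e3 j x z) y.
Proof.
move=> ij hi hj; move: x; apply: tvec_ext => [||s Ms].
- apply: (@linear_comp _ _ _ ((free_comp e2 j')^~ z) ((free_comp e1 i)^~ y));
  exact: free_comp_linearl.
- apply: (@linear_comp _ _ _ ((free_comp e4 i')^~ y) ((free_comp e3 j)^~ z));
  exact: free_comp_linearl.
move: y; apply: tvec_ext => [||t Mt].
- apply: (@linear_comp _ _ _ ((free_comp e2 j')^~ z));
  [exact: free_comp_linearl | exact: free_comp_linearr].
- exact: free_comp_linearr.
move: z; apply: tvec_ext => [||u Mu].
- exact: free_comp_linearr.
- apply: (@linear_comp _ _ _ ((free_comp e4 i')^~ (mono n t)));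
  [exact: free_comp_linearl | exact: free_comp_linearr].
rewrite !free_comp_mono ?(multilinear_graft i e1) ?(multilinear_graft j e3) //.
by rewrite hi hj (graft_par _ ij Mt Mu).
Qed.

Fact free_comp_act m n p (e : (m + n = p.+1)%N) (i : 'I_m)
    (s : 'S_m) (t : 'S_n) (r : 'S_p) (x : tvec m) (y : tvec n) :
  (forall (l : 'I_m) (u : 'I_p), l != i -> u = shift i n l :> nat ->
    r u = shift (s i) n (s l) :> nat) ->
  (forall (l : 'I_n) (u : 'I_p), u = (i + l)%N :> nat ->
    r u = (s i + t l)%N :> nat) ->
  free_comp e (s i) (free_act s x) (free_act t y) =
  free_act r (free_comp e i x y).
Proof.
move=> h1 h2; move: x; apply: tvec_ext => [||a Ma].
- apply: (@linear_comp _ _ _ ((free_comp e (s i))^~ (free_act t y)));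
  [exact: free_comp_linearl | exact: free_act_linear].
- apply: (@linear_comp _ _ _ (free_act r) ((free_comp e i)^~ y));
  [exact: free_act_linear | exact: free_comp_linearl].
move: y; apply: tvec_ext => [||b Mb].
- apply: linear_comp; [exact: free_comp_linearr | exact: free_act_linear].
- apply: linear_comp; [exact: free_act_linear | exact: free_comp_linearr].
rewrite !free_act_mono // !free_comp_mono ?multilinear_relabel //.
by rewrite free_act_mono ?(multilinear_graft i e) // (graft_act e h1 h2).
Qed.

Definition free_operad : operad k :=
  Operad free_act_linear free_act1 free_actM free_comp_linearl
    free_comp_linearr free_comp_onel free_comp_oner free_comp_seq
    free_comp_par free_comp_act.

End FreeOperad.

Section QuadraticOperads.
Variable k : fieldType.

(* T(X)/(R) for X = k[S_2] in degree 0 and R a space of quadratic relations. *)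
Definition quadratic_ideal (R : {vspace tvec k 3}) : ideal (free_operad k) :=
  @ideal_gen k (free_operad k) 3 R.

Definition quadratic_operad (R : {vspace tvec k 3}) : operad k :=
  quotient_operad (quadratic_ideal R).

Definition generator (R : {vspace tvec k 3}) : quadratic_operad R 2 :=
  morph (quotient_proj (quadratic_ideal R)) (mono k 2 (Node (Leaf 0) (Leaf 1))).

Definition orbit_span (r : tvec k 3) : {vspace tvec k 3} :=
  <<[seq free_act s r | s <- enum 'S_3]>>%VS.

Definition assoc_relator : tvec k 3 :=
  mono k 3 (Node (Node (Leaf 0) (Leaf 1)) (Leaf 2))
  - mono k 3 (Node (Leaf 0) (Node (Leaf 1) (Leaf 2))).

Definition prelie_relator : tvec k 3 :=
  (mono k 3 (Node (Node (Leaf 0) (Leaf 1)) (Leaf 2))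
   - mono k 3 (Node (Leaf 0) (Node (Leaf 1) (Leaf 2))))
  - (mono k 3 (Node (Node (Leaf 0) (Leaf 2)) (Leaf 1))
     - mono k 3 (Node (Leaf 0) (Node (Leaf 2) (Leaf 1)))).

Definition prelie_relations : {vspace tvec k 3} := orbit_span prelie_relator.
Definition assoc_relations : {vspace tvec k 3} := orbit_span assoc_relator.

Definition PreLie : operad k := quadratic_operad prelie_relations.
Definition Ass : operad k := quadratic_operad assoc_relations.

Lemma prelie_sub_assoc n :
  (quadratic_ideal prelie_relations n <= quadratic_ideal assoc_relations n)%VS.
Proof.
apply: ideal_gen_min; apply: subv_trans (ideal_gen_sub _).
have sub (x y : tvec k 3) s : free_act s (x - y) = free_act s x - free_act s y.
  by rewrite addrC -scaleN1r free_act_linear scaleN1r addrC.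
pose i1 : 'I_3 := Ordinal (isT : (1 < 3)%N).
pose i2 : 'I_3 := Ordinal (isT : (2 < 3)%N).
pose t : 'S_3 := tperm i1 i2.
have t0 : permn t 0 = 0%N.
  by rewrite (permnE t ord0) tpermD.
have t1 : permn t 1 = 2%N by rewrite (permnE t i1) tpermL.
have t2 : permn t 2 = 1%N by rewrite (permnE t i2) tpermR.
have -> : prelie_relations = orbit_span (assoc_relator - free_act t assoc_relator).
  congr orbit_span; rewrite /prelie_relator /assoc_relator; congr (_ - _).
  by rewrite sub !free_act_mono // /relabel /= t0 t1 t2.
apply/span_subvP => x /mapP[s _ ->].
have mem_orbit u : free_act u assoc_relator \in assoc_relations.
  by apply: memv_span; apply: map_f; rewrite mem_enum.
rewrite sub; apply: rpredB; first exact: mem_orbit.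
by rewrite -free_actM; apply: mem_orbit.
Qed.

Definition prelie_to_ass : operad_morphism PreLie Ass :=
  induced_morphism prelie_sub_assoc.

Lemma prelie_to_ass_generator :
  morph prelie_to_ass (generator prelie_relations) = generator assoc_relations.
Proof. exact: (inducedE prelie_sub_assoc). Qed.

End QuadraticOperads.

Section KoszulDual.
Variable k : fieldType.

(* The cofree cooperad T^c(sX) has the same underlying spaces tvec k n, now in
   degree n - 1: the monomial t stands for t with all its vertices decorated by
   sX and taken in prefix order (vertex, left subtree, right subtree). In these
   bases, in arity 3, the map s^2 is the identity of tvec k 3. Relabelling the
   leaves does not change the order of the vertices, so that the symmetric
   groups act by free_act, without signs. *)

Definition vertices (t : btree) : nat := (size (leaves t)).-1.

(* Number of vertices of t coming after the leaf l in prefix order. *)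
Fixpoint vertices_after (l : nat) (t : btree) : nat :=
  if t is Node u v then
    if l \in leaves u then (vertices_after l u + vertices v)%N
    else vertices_after l v
  else 0%N.

Definition coef (n : nat) (c : tvec k n) (t : btree) : k :=
  \sum_(u : monomial n | val u == t) c u.

Definition tens (a b : nat) : vectType k :=
  {ffun monomial a * monomial b -> k^o}.

Definition tensor a b (x : tvec k a) (y : tvec k b) : tens a b :=
  [ffun p => (x p.1 : k) * y p.2].

Definition tensv a b (U : {vspace tvec k a}) (V : {vspace tvec k b}) :
    {vspace tens a b} :=
  <<[seq tensor x y | x <- vbasis U, y <- vbasis V]>>%VS.

Lemma unshuffle_inj n (B : {set 'I_n}) :
  injective (fun i : 'I_n => nth i (enum B ++ enum (~: B)) i).
Proof.
have uniqB : uniq (enum B ++ enum (~: B)).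
  rewrite cat_uniq !enum_uniq andbT /=; apply/hasPn => x.
  by rewrite !mem_enum inE.
have sizeB : size (enum B ++ enum (~: B)) = n.
  by rewrite size_cat -!cardE cardsC card_ord.
move=> i j; rewrite (set_nth_default j) ?sizeB // => /eqP.
by rewrite nth_uniq ?sizeB // => /eqP/val_inj.
Qed.

(* The permutation sending 0, ..., #|B| - 1 to B and the remaining labels to
   the complement of B, increasingly on both. *)
Definition unshuffle n (B : {set 'I_n}) : 'S_n := perm (@unshuffle_inj n B).

(* The tree obtained by grafting t on the leaf 0 of s, with the inputs of t
   relabelled by B and the other inputs of s relabelled by its complement. *)
Definition two_level n (B : {set 'I_n}) (s t : btree) : btree :=
  relabel (permn (unshuffle B)) (graft 0 s t).

(* The component of the infinitesimal decomposition map in which the upper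
   vertex of the two-vertex tree has B as its set of inputs. The coefficient of
   s (x) t is, up to sign, that of the only monomial which decomposes into the
   root part s and the upper part t. The sign comes from moving the vertices
   of t past the vertices of s which follow them in prefix order. *)
Definition infdec n (B : {set 'I_n}) (c : tvec k n) :
    tens (n - #|B|).+1 #|B| :=
  [ffun p => (-1) ^+ (vertices_after 0 (val p.1) * vertices (val p.2))
             * coef c (two_level B (val p.1) (val p.2))].

Definition subcooperad (V : forall n, {vspace tvec k n}) : Prop :=
  (forall n (s : 'S_n) c, c \in V n -> free_act s c \in V n) /\
  (forall n (B : {set 'I_n}) c, c \in V n ->
    infdec B c \in tensv (V (n - #|B|).+1) (V #|B|)).

(* The quadratic cooperad cogenerated by sX with corelations s^2 R, that is,
   the largest subcooperad of T^c(sX) whose part with two vertices is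
   contained in s^2 R. *)
Definition koszul_dual (R : {vspace tvec k 3}) (n : nat) : {vspace tvec k n} :=
  vspan (fun c => exists V : forall n, {vspace tvec k n},
    [/\ subcooperad V, (V 3 <= R)%VS & c \in V n]).

Lemma coef_linear n (t : btree) : linear (fun c : tvec k n => coef c t : k^o).
Proof.
move=> a x y; rewrite /coef scaler_sumr -big_split.
by apply: eq_bigr => u _; rewrite !ffunE.
Qed.

Lemma infdec_linear n (B : {set 'I_n}) : linear (@infdec n B).
Proof.
move=> a x y; apply/ffunP => p; rewrite !ffunE (coef_linear _ a x y) mulrDr.
by congr (_ + _); rewrite mulrCA.
Qed.

Lemma tensvS a b (U U' : {vspace tvec k a}) (V V' : {vspace tvec k b}) :
  (U <= U')%VS -> (V <= V')%VS -> (tensv U V <= tensv U' V')%VS.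
Proof.
move=> UU' VV'; apply/span_subvP => _ /allpairsP[[x y] /= [xU yV ->]].
have xU' := subvP UU' _ (vbasis_mem xU); have yV' := subvP VV' _ (vbasis_mem yV).
rewrite (coord_vbasis xU') (coord_vbasis yV').
have -> : forall (I J : finType) (c : I -> k) (d : J -> k) u v,
    tensor (\sum_i c i *: u i) (\sum_j d j *: v j)
    = \sum_i \sum_j (c i * d j) *: tensor (u i : tvec k a) (v j : tvec k b).
  move=> I J c d u v; apply/ffunP => p; rewrite !ffunE !sum_ffunE mulr_suml.
  apply: eq_bigr => i _; rewrite mulr_sumr sum_ffunE; apply: eq_bigr => j _.
  by rewrite !ffunE; apply: mulrACA.
apply: rpred_sum => i _; apply: rpred_sum => j _; apply: rpredZ.
by apply: memv_span; apply: allpairs_f; apply: mem_nth; rewrite size_tuple.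
Qed.

Lemma koszul_dual_relations (R : {vspace tvec k 3}) : (koszul_dual R 3 <= R)%VS.
Proof. by apply/vspanP => c [V [_ VR]]; apply: (subvP VR). Qed.

Lemma koszul_dual_max (R : {vspace tvec k 3}) V :
  subcooperad V -> (V 3 <= R)%VS -> forall n, (V n <= koszul_dual R n)%VS.
Proof.
by move=> hV VR n; apply/subvP => c cV; apply: mem_vspan; exists V.
Qed.

Lemma koszul_dual_subcooperad (R : {vspace tvec k 3}) :
  subcooperad (koszul_dual R).
Proof.
have preim (V W : vectType k) (g : V -> W) (U : {vspace W}) (P : V -> Prop) :
    linear g -> (forall v, P v -> g v \in U) ->
    forall v, v \in vspan P -> g v \in U.
  move=> lg gP v; pose gL := GRing.isLinear.Build _ _ _ _ g lg.
  pose G : {linear V -> W} := HB.pack g gL.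
  have -> : g v = linfun G v by rewrite lfunE.
  rewrite memv_preim; apply: subvP; apply/vspanP => w Pw.
  by rewrite -memv_preim lfunE; apply: gP.
split=> [n s|n B]; apply: preim.
- exact: free_act_linear.
- move=> c [V [hV VR cV]]; apply: (subvP (koszul_dual_max hV VR n)).
  exact: (proj1 hV).
- exact: infdec_linear.
- move=> c [V [hV VR cV]]; apply: (subvP (tensvS _ _) _ (proj2 hV n B c cV));
  exact: koszul_dual_max.
Qed.

End KoszulDual.

Section DeformationComplex.
Variables (k : fieldType) (R : {vspace tvec k 3}) (Q : operad k).

Definition cochain := forall n, 'Hom(subvs_of (koszul_dual R n), Q n).

(* A linear extension of phi to the whole of T^c(sX)(n). *)
Definition extend (phi : cochain) n (c : tvec k n) : Q n :=
  phi n (vsproj (koszul_dual R n) c).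

(* Together with equivariance, this gives the elements of the product over
   n >= 1: the component of arity 0 is zero, because tvec k 0 is. *)
Definition equivariant (phi : cochain) : Prop :=
  forall n (s : 'S_n) c, c \in koszul_dual R n ->
    extend phi (free_act s c) = act s (extend phi c).

(* The cooperad is in degree n - 1 in arity n, and Q is in degree 0. *)
Definition homogeneous (d : int) (phi : cochain) : Prop :=
  forall n : nat, phi n != 0 -> d = 1 - n%:Z.

Lemma arity_eq n (B : {set 'I_n}) : ((n - #|B|).+1 + #|B| = n.+1)%N.
Proof. by rewrite addSn subnK // -[X in (_ <= X)%N](card_ord n) max_card. Qed.

(* phi (x) psi applied to an element of the tensor product, followed by the
   composition in Q. The sign is (-1)^(|psi||x|) for x in the left factor. As
   infdec B c is in the tensor product of the components of the Koszul dual,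
   the choice of the extensions of phi and psi does not matter. *)
Definition apply_tensor n (B : {set 'I_n}) (phi psi : cochain)
    (z : tens k (n - #|B|).+1 #|B|) : Q n :=
  \sum_p ((-1) ^+ ((n - #|B|) * #|B|.-1) * (z p : k)) *:
    comp (arity_eq B) ord0
      (extend phi (mono k _ (val p.1))) (extend psi (mono k _ (val p.2))).

Definition prelie_prod (phi psi : cochain) : cochain := fun n =>
  linfun (fun c : subvs_of (koszul_dual R n) =>
    \sum_(B : {set 'I_n})
      act (unshuffle B) (apply_tensor phi psi (infdec B (vsval c)))).

Lemma apply_tensor_linear n (B : {set 'I_n}) (phi psi : cochain) :
  linear (apply_tensor (B := B) phi psi).
Proof.
move=> a x y; rewrite /apply_tensor scaler_sumr -big_split.
apply: eq_bigr => p _; rewrite !ffunE mulrDr scalerDl; congr (_ + _).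
by rewrite scalerA mulrCA.
Qed.

Lemma prelie_prodE (phi psi : cochain) n (c : subvs_of (koszul_dual R n)) :
  prelie_prod phi psi n c =
  \sum_(B : {set 'I_n})
    act (unshuffle B) (apply_tensor phi psi (infdec B (vsval c))).
Proof.
rewrite /prelie_prod; set g := fun _ => _.
have lg : linear g.
  move=> a x y; rewrite /g scaler_sumr -big_split; apply: eq_bigr => B _.
  by rewrite linearP infdec_linear apply_tensor_linear act_linear.
pose gL := GRing.isLinear.Build _ _ _ _ g lg.
pose G : {linear subvs_of (koszul_dual R n) -> Q n} := HB.pack g gL.
by rewrite -[g]/(G : _ -> _) lfunE.
Qed.

Definition bracket (d e : int) (phi psi : cochain) : cochain := fun n =>
  prelie_prod phi psi n - (-1) ^ (d * e) *: prelie_prod psi phi n.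

Variable f : operad_morphism (quadratic_operad R) Q.

(* Monomials of arity 2 have one vertex, so desuspension is the identity. *)
Definition alpha : cochain := fun n =>
  linfun (fun c : subvs_of (koszul_dual R n) =>
    if n == 2 then morph f (morph (quotient_proj (quadratic_ideal R)) (vsval c))
    else 0).

Lemma alphaE n (c : subvs_of (koszul_dual R n)) :
  alpha n c =
  if n == 2 then morph f (morph (quotient_proj (quadratic_ideal R)) (vsval c))
  else 0.
Proof.
rewrite /alpha; set g := fun _ => _.
have lg : linear g.
  move=> a x y; rewrite /g; case: ifP => _; last by rewrite scaler0 addr0.
  by rewrite linearP !morph_linear.
pose gL := GRing.isLinear.Build _ _ _ _ g lg.
pose G : {linear subvs_of (koszul_dual R n) -> Q n} := HB.pack g gL.
by rewrite -[g]/(G : _ -> _) lfunE.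
Qed.

Definition def_element (d : int) (phi : cochain) : Prop :=
  equivariant phi /\ homogeneous d phi.

Lemma alpha_element : def_element (-1) alpha.
Proof.
split=> [n s c cK|n]; last first.
  have [->|n2] := eqVneq n 2; first by [].
  case/eqP; apply/lfunP => c; rewrite alphaE (negPf n2).
  by rewrite zero_lfunE.
have scK := proj1 (koszul_dual_subcooperad R) n s c cK.
rewrite /extend !alphaE !vsprojK //; case: ifP => _; first by rewrite !morph_act.
have act0 : act s (0 : Q n) = 0.
  by have := act_linear s (-1) 0 (0 : Q n); rewrite scaler0 addr0 scaleN1r addNr.
by rewrite act0.
Qed.

(* The differential on the elements of degree d. *)
Definition def_diff (d : int) (phi : cochain) : cochain :=
  bracket (-1) d alpha phi.

(* Vanishing of the homology of the deformation complex of f. *)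
Definition def_acyclic : Prop :=
  forall (d : int) (phi : cochain), def_element d phi ->
    (forall n, def_diff d phi n = 0) ->
    exists2 psi : cochain, def_element (d + 1) psi &
      forall n, phi n = def_diff (d + 1) psi n.

End DeformationComplex.

(* Main.v *)
(* The Koszul dual cooperad of PreLie is, up to suspension, the linear dual of
   Perm: its component of arity n is spanned by n vectors permuted by S_n up to
   sign, one for each choice of the leftmost leaf of a tree. As Ass(n) is the
   regular representation, an equivariant cochain of arity n amounts to n
   weights g_0, ..., g_{n-1}, where g_i is attached to the words having the
   distinguished letter in position i; in terms of substitutions it is
   a |-> sum_i +-g_i x^i a x^{n-1-i} with x odd. In these coordinates, with
   S = sum_i g_i, the differential is
     n odd:  (dg)_i = g_i (i odd, i < n),  (dg)_i = - g_{i-1} (i > 0 even),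
             (dg)_0 = S,  and (dg)_n = 0;
     n even: (dg)_i = g_i [i < n] + g_{i-1} (i > 0 even),  (dg)_i = 0 (i odd),
             (dg)_0 = g_0 - S,
   and the exactness of this complex is elementary. *)
Require Import Defs.
From mathcomp Require Import all_boot all_order all_fingroup all_algebra.
Import GRing.Theory.
Local Open Scope ring_scope.
From HB Require Import structures.
From mathcomp Require Import zify ring.
(* all_fingroup shadows [act] and [morph_act]. *)
Require Import Defs.

Set Implicit Arguments.
Unset Strict Implicit.
Unset Printing Implicit Defensive.

(** * Inversions and grafting *)

(** The Koszul dual is given only as the largest subcooperad with a constraint in arity three, so
    its vectors are known through their decompositions alone. Maximality shows that the explicit
    vectors belong to it. The converse rests on cutting trees: both factors of a nontrivial cut have
    smaller arity, where coefficients depend, up to sign, only on leftmost leaves, so either factor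
    may be rearranged with its leftmost leaf kept. From arity four on such moves connect any two
    trees with the same leftmost leaf; arity three is settled by the relations.

    The other obstacle is signs: odd vertices in prefix order, the sign representation, and the
    Koszul sign of the product. The exponent [parity] is built to be additive mod 2 under grafting
    up to a term depending on the arities alone, and the resulting sign cancels against the one in
    [apply_tensor]. What survives is [(-1)^(p(m-1))] for the insertion of [m] letters at position
    [p] of a word.

    The coefficient of a fixed word in a product only sees upper vertices whose inputs are
    consecutive letters of that word; this collapses the sum over subsets to one over positions. *)

Section Words.
Local Open Scope nat_scope.

Fixpoint pair_count (r : nat -> nat -> bool) (w : seq nat) : nat :=
  if w is x :: w' then (count (r x) w' + pair_count r w')%N else 0%N.

(** Doubling replaces the pairs in order of occurrence by all ordered pairs, a sum over the letters
    that is visibly independent of their order. *)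
Lemma pair_count_double r w :
  (forall x y, r x y = r y x) -> (forall x, r x x = false) ->
  ((pair_count r w).*2 = \sum_(x <- w) \sum_(y <- w) r x y)%N.
Proof.
move=> rC rI; elim: w => [|x w IHw]; first by rewrite big_nil.
rewrite /= doubleD IHw !big_cons rI add0n.
under [X in (_ = _ + X)%N]eq_bigr => y _ do rewrite big_cons.
rewrite big_split /= addnA; congr (_ + _)%N.
under [X in (_ = _ + X)%N]eq_bigr => y _ do rewrite rC.
rewrite addnn -[X in X.*2 = _](sumn_count (r x)) /sumn foldrE big_map.
by [].
Qed.

Lemma pair_count_perm r w w' :
  (forall x y, r x y = r y x) -> (forall x, r x x = false) ->
  perm_eq w w' -> pair_count r w = pair_count r w'.
Proof.
move=> rC rI ww'; apply: double_inj; rewrite !pair_count_double // (perm_big _ ww').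
by apply: eq_bigr => x _; rewrite (perm_big _ ww').
Qed.

Definition inversions : seq nat -> nat := pair_count (fun x y => y < x)%N.

Lemma inversions_cat s t :
  inversions (s ++ t) =
    inversions s + inversions t + \sum_(x <- s) count (fun y => y < x) t.
Proof.
elim: s => [|x s IHs]; first by rewrite big_nil addn0.
rewrite /= /inversions /= -/inversions -/(inversions _) IHs count_cat big_cons.
by rewrite -/(inversions s); lia.
Qed.

(** The pairs whose order [f] reverses. Unlike the relation behind [inversions], this one is
    symmetric, so its count depends only on the multiset of letters; hence a relabelling changes the
    sign of all words on the same letters alike. *)
Definition twisted (f : nat -> nat) (x y : nat) : bool :=
  [&& x != y, f x != f y & (f y < f x) (+) (y < x)].

Lemma odd_inversions_map f w : injective f -> uniq w ->
  odd (inversions (map f w)) = odd (pair_count (twisted f) w) (+) odd (inversions w).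
Proof.
move=> fI; elim: w => [|x w IHw] //= /andP[xw uw].
rewrite /inversions /= -/inversions -/(inversions _) -/(inversions w) !oddD.
rewrite IHw // count_map.
suff -> : odd (count (preim f (fun y => y < f x)) w)
  = odd (count (twisted f x) w) (+) odd (count (fun y => y < x) w).
  by rewrite !addbA; congr (_ (+) _); rewrite addbAC.
elim: w xw {IHw uw} => [|y w IHw] //=; rewrite inE negb_or => /andP[xy xw].
rewrite !oddD {}IHw // /twisted xy (inj_eq fI) xy /= !oddb.
by case: (f y < f x); case: (y < x); do 2!case: (odd _).
Qed.

Lemma permnK n (s : 'S_n) : cancel (permn s) (permn s^-1%g).
Proof. by move=> l; rewrite -permnM mulgV permn1. Qed.

Lemma permnKV n (s : 'S_n) : cancel (permn s^-1%g) (permn s).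
Proof. by move=> l; rewrite -permnM mulVg permn1. Qed.

Lemma permn_inj n (s : 'S_n) : injective (permn s).
Proof. exact: can_inj (permnK s). Qed.

Lemma permn_lt n (s : 'S_n) l : (permn s l < n)%N = (l < n)%N.
Proof.
rewrite /permn; case: insubP => [j ln _|]; first by rewrite ltn_ord ln.
by move/negPf.
Qed.

(** The usual parity of [s], read off its one-line word so as to compare directly with the
    inversions of leaf words. *)
Definition psign n (s : 'S_n) : bool := odd (inversions (map (permn s) (iota 0 n))).

Lemma inversions_iota m n : inversions (iota m n) = 0%N.
Proof.
elim: n m => //= n IHn m; rewrite /inversions /= -/inversions -/(inversions _) IHn addn0.
apply/eqP; rewrite -leqn0 leqNgt -has_count; apply/hasPn => y.
by rewrite mem_iota -leqNgt => /andP[/ltnW].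
Qed.

Lemma odd_inversions_permn n (s : 'S_n) w : perm_eq w (iota 0 n) ->
  odd (inversions (map (permn s) w)) = psign s (+) odd (inversions w).
Proof.
move=> Pw; have tC x y : twisted (permn s) x y = twisted (permn s) y x.
  rewrite /twisted eq_sym; case: ltngtP => //= _.
    by rewrite eq_sym; case: ltngtP.
  by rewrite eq_sym; case: ltngtP.
have tI x : twisted (permn s) x x = false by rewrite /twisted eqxx.
rewrite /psign !odd_inversions_map ?(perm_uniq Pw) ?iota_uniq //; try exact: permn_inj.
by rewrite (pair_count_perm tC tI Pw) inversions_iota addbF.
Qed.

Lemma perm_iota_permn n (s : 'S_n) w :
  perm_eq w (iota 0 n) -> perm_eq (map (permn s) w) (iota 0 n).
Proof.
move=> Pw; apply: perm_trans (perm_map _ Pw) _; apply: uniq_perm.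
- by rewrite map_inj_uniq ?iota_uniq //; apply: permn_inj.
- exact: iota_uniq.
move=> l; rewrite mem_iota /= add0n -(permn_lt s^-1%g) -{1}[l](permnKV s).
by rewrite (mem_map (@permn_inj _ s)) mem_iota.
Qed.

(* The word of a composite [s o_0 t] in terms of the words of [s] and [t]. *)
Definition wgraft (w w' : seq nat) : seq nat :=
  flatten [seq if l == 0%N then w' else [:: (l + size w').-1] | l <- w].

Lemma leaves_graft0 s t : leaves (graft 0 s t) = wgraft (leaves s) (leaves t).
Proof.
rewrite /graft leaves_subst /wgraft; congr flatten; apply: eq_map => l /=.
case: eqP => // _; rewrite leaves_relabel -[RHS]map_id.
by apply: eq_map => x; rewrite add0n.
Qed.

Lemma wgraft_cat w1 w2 w' : wgraft (w1 ++ w2) w' = wgraft w1 w' ++ wgraft w2 w'.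
Proof. by rewrite /wgraft map_cat flatten_cat. Qed.

Lemma wgraft_shift w w' : 0%N \notin w ->
  wgraft w w' = [seq (l + size w').-1 | l <- w].
Proof.
elim: w => //= l w IHw; rewrite inE negb_or eq_sym => /andP[/negPf l0 w0].
by rewrite /wgraft /= l0 -/(wgraft w w') IHw.
Qed.

Lemma wgraft_split w1 w3 w' : 0%N \notin w1 -> 0%N \notin w3 ->
  wgraft (w1 ++ 0%N :: w3) w'
  = [seq (l + size w').-1 | l <- w1] ++ w' ++ [seq (l + size w').-1 | l <- w3].
Proof.
move=> h1 h3; rewrite wgraft_cat wgraft_shift //.
by rewrite /wgraft /= -/(wgraft w3 w') wgraft_shift.
Qed.

Lemma split_uniq0 (w : seq nat) : uniq w -> 0%N \in w ->
  exists w1 w3, [/\ w = w1 ++ 0%N :: w3, size w1 = index 0%N w,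
    0%N \notin w1 & 0%N \notin w3].
Proof.
move=> uw w0; case/splitPr: w0 uw => w1 w3.
rewrite cat_uniq /= negb_or -!andbA => /and5P[_ h1 _ h3 _].
exists w1, w3; split=> //; by rewrite index_cat (negPf h1) /= addn0.
Qed.

Lemma inversions_map_mono f w : {in w &, forall x y, (f y < f x) = (y < x)} ->
  inversions (map f w) = inversions w.
Proof.
elim: w => //= x w IHw h.
rewrite /inversions /= -/inversions -/(inversions _) -/(inversions w) IHw.
  by rewrite count_map; congr (_ + _)%N; apply: eq_in_count => y yw /=;
    rewrite h ?inE ?eqxx ?yw ?orbT.
by move=> y z yw zw; rewrite h ?inE ?yw ?zw ?orbT.
Qed.

Lemma sum_const_seq (T : eqType) (s : seq T) (F : T -> nat) c :
  {in s, forall x, F x = c} -> \sum_(x <- s) F x = (size s * c)%N.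
Proof.
elim: s => [|x s IHs] h; first by rewrite big_nil.
rewrite big_cons h ?mem_head // IHs // => y ys.
by apply: h; rewrite inE ys orbT.
Qed.

(** A letter in front of 0 forms one inversion with it, but [m] with the block that replaces it, a
    gain of [m - 1]. A letter behind 0 exceeds the whole block after the shift and forms no
    inversion with it. *)
Lemma inversions_wgraft m w w' : perm_eq w' (iota 0 m) -> (0 < m)%N -> uniq w ->
  0%N \in w ->
  inversions (wgraft w w') = (inversions w + inversions w' + index 0%N w * m.-1)%N.
Proof.
move=> Pw' m0 uw w0; have sw' : size w' = m by rewrite (perm_size Pw') size_iota.
have [w1 [w3 [-> <- h1 h3]]] := split_uniq0 uw w0.
have lt0 (v : seq nat) x : 0%N \notin v -> x \in v -> (0 < x)%N.
  by move=> hv; case: x => // xv; rewrite xv in hv.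
rewrite wgraft_split // sw' !inversions_cat /inversions /= -/inversions.
rewrite -/(inversions w1) -/(inversions w3) -/(inversions w').
have mono v : inversions [seq (l + m).-1 | l <- v] = inversions v.
  by apply: inversions_map_mono => x y _ _; lia.
rewrite !mono.
have c0 v v' : 0%N \notin v -> {in v', forall x, x < m}%N ->
    \sum_(x <- v') count (ltn^~ x) [seq (l + m).-1 | l <- v] = 0%N.
  move=> hv hv'; rewrite (sum_const_seq (c := 0%N)) ?muln0 // => x xv'.
  apply/eqP; rewrite -leqn0 leqNgt -has_count; apply/hasPn => y /mapP[l lv ->].
  move: (hv' x xv') (lt0 v l hv lv) => /= xm l0; lia.
rewrite c0 //; last by move=> x; rewrite (perm_mem Pw') mem_iota.
have -> : count (ltn^~ 0%N) w3 = 0%N by elim: (w3).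
rewrite !big_map.
have -> : \sum_(j <- w1) count (ltn^~ (j + m).-1) (w' ++ [seq (l + m).-1 | l <- w3])
  = (\sum_(j <- w1) count (ltn^~ j) (0%N :: w3) + size w1 * m.-1)%N.
  rewrite -(sum_const_seq (s := w1) (F := fun=> m.-1) (c := m.-1)) // -big_split.
  rewrite [LHS]big_seq [RHS]big_seq; apply: eq_bigr => j jw1 /=.
  have j0 := lt0 _ _ h1 jw1.
  rewrite count_cat count_map j0.
  have -> : count (ltn^~ (j + m).-1) w' = m.
    apply/eqP; rewrite -{2}sw' -all_count; apply/allP => x.
    rewrite (perm_mem Pw') mem_iota /= => xm; move: j0 => /= j0; lia.
  have -> : count (preim (fun l => (l + m).-1) (ltn^~ (j + m).-1)) w3
      = count (ltn^~ j) w3 by apply: eq_count => l /=; apply/idP/idP; lia.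
  by rewrite add1n addSn -addnS prednK // addnC.
set S := (X in _ = _ + X + _ + _); rewrite -[\sum_(j <- w1) _]/S; lia.
Qed.

Lemma size_leaves t : size (leaves t) = (vertices t).+1.
Proof. by rewrite /vertices prednK // size_leaves_gt0. Qed.

Lemma vertices_node u v : vertices (Node u v) = (vertices u + vertices v).+1.
Proof. by rewrite /vertices /= size_cat !size_leaves /= addnS. Qed.

Lemma vertices_relabel f t : vertices (relabel f t) = vertices t.
Proof. by rewrite /vertices leaves_relabel size_map. Qed.

Lemma vertices_multilinear n t : multilinear n t -> vertices t = n.-1.
Proof. by move=> Mt; rewrite /vertices (size_multilinear Mt). Qed.

(** Rotating [Node u (Node v w)] to [Node (Node u v) w] raises this by [vertices u + 1]: one for the
    minus sign in the associator, and [vertices u] for moving the inner vertex past those of [u] in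
    prefix order. *)
Fixpoint left_weight (t : btree) : nat :=
  if t is Node u v then (left_weight u + left_weight v + vertices u)%N else 0%N.

Lemma left_weight_relabel f t : left_weight (relabel f t) = left_weight t.
Proof. by elim: t => //= u -> v ->; rewrite vertices_relabel. Qed.

Lemma graft_notin i s t : i \notin leaves s ->
  graft i s t = relabel (shift i (size (leaves t))) s.
Proof.
move=> is'; apply: eq_subst => l ls /=.
by case: eqP => // li; rewrite -li ls in is'.
Qed.

Lemma vertices_graft i s t : uniq (leaves s) -> i \in leaves s ->
  vertices (graft i s t) = (vertices s + vertices t)%N.
Proof.
elim: s => [l|u IHu v IHv] /=.
  by rewrite inE => _ /eqP->; rewrite /graft /= eqxx vertices_relabel.
rewrite cat_uniq => /and3P[uu /hasPn uv uv']; rewrite mem_cat /graft /=.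
rewrite -!/(graft _ _ _) !vertices_node.
case: (boolP (i \in leaves u)) => [iu _|iu /= iv].
  rewrite IHu // (graft_notin t (s := v)) ?vertices_relabel; first by lia.
  by apply/negP => /uv; rewrite iu.
by rewrite IHv // (graft_notin t iu) vertices_relabel; lia.
Qed.

(* The exponent of the last term counts, mod 2, the vertices at which the path
   from the root to the leaf [i] turns left. *)
Lemma left_weight_graft i s t : uniq (leaves s) -> i \in leaves s ->
  odd (left_weight (graft i s t)) = odd (left_weight s + left_weight t
    + (index i (leaves s) + vertices_after i s + vertices s) * vertices t).
Proof.
elim: s => [l|u IHu v IHv] /=.
  rewrite inE => _ /eqP->; rewrite /graft /= !eqxx left_weight_relabel.
  by rewrite /vertices /=; congr odd; lia.
rewrite cat_uniq => /and3P[uu /hasPn uv uv']; rewrite mem_cat /graft /=.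
rewrite -!/(graft _ _ _) !vertices_node index_cat.
case: (boolP (i \in leaves u)) => [iu _|iu /= iv].
  have iv : i \notin leaves v by apply/negP => /uv; rewrite iu.
  rewrite vertices_graft // (graft_notin t iv) left_weight_relabel.
  move: (IHu uu iu); rewrite /= !mulnDl mulSn => IH; lia.
rewrite (graft_notin t iu) left_weight_relabel vertices_relabel.
rewrite size_leaves; move: (IHv uv' iv); rewrite /= !mulnDl !mulSn => IH; lia.
Qed.

End Words.

(** * The Koszul dual cooperad of PreLie *)

Fixpoint head_leaf (t : btree) : nat :=
  match t with Leaf l => l | Node u _ => head_leaf u end.

(** The sign exponent of a monomial in a vector of the Koszul dual: the inversions produce the sign
    representation, the left weight the signs of rebracketing. *)
Definition parity (t : btree) : nat := (inversions (leaves t) + left_weight t)%N.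

Lemma nth0_leaves t : nth 0%N (leaves t) 0 = head_leaf t.
Proof. by elim: t => //= u <- v _; rewrite nth_cat size_leaves_gt0. Qed.

Lemma head_leaf_mem t : head_leaf t \in leaves t.
Proof. by rewrite -nth0_leaves mem_nth // size_leaves_gt0. Qed.

Lemma head_leaf_relabel f t : head_leaf (relabel f t) = f (head_leaf t).
Proof. by elim: t => //= u ->. Qed.

Lemma head_leaf_graft0 s t : head_leaf (graft 0 s t) =
  if head_leaf s == 0%N then head_leaf t
  else (head_leaf s + size (leaves t)).-1.
Proof.
elim: s => [l|u IHu v _] //.
rewrite /graft /=; case: eqP => //= _.
by rewrite head_leaf_relabel add0n.
Qed.

Lemma odd_parity_relabel n (s : 'S_n) t : multilinear n t ->
  odd (parity (relabel (permn s) t)) = psign s (+) odd (parity t).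
Proof.
move=> Mt; rewrite /parity left_weight_relabel leaves_relabel !oddD.
by rewrite odd_inversions_permn // addbA.
Qed.

Lemma multilinear_uniq n t : multilinear n t -> uniq (leaves t).
Proof. by move/perm_uniq->; apply: iota_uniq. Qed.

(** The position of the leaf 0 enters through both the inversions and the left weight, and
    [vertices_after 0 s] through both the left weight and the decomposition sign. Each cancels mod
    2, and only the arities remain. *)
Lemma odd_parity_graft p m s t : multilinear p.+1 s -> multilinear m t ->
  odd (parity (graft 0 s t) + vertices_after 0 s * vertices t) =
  odd (parity s + parity t + p * m.-1).
Proof.
move=> Ms Mt; have s0 : 0%N \in leaves s by rewrite (mem_multilinear _ Ms).
have us := multilinear_uniq Ms.
have m0 : (0 < m)%N by rewrite -(size_multilinear Mt) size_leaves_gt0.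
have := left_weight_graft t us s0.
rewrite /parity leaves_graft0 (inversions_wgraft Mt) // -(vertices_multilinear Mt).
by rewrite (vertices_multilinear Ms) /= !mulnDl => H; lia.
Qed.

Lemma unshuffle_mem n (B : {set 'I_n}) (j : 'I_n) :
  (unshuffle B j \in B) = (j < #|B|)%N.
Proof.
rewrite /unshuffle permE nth_cat -cardE; case: ltnP => jB.
  by rewrite -mem_enum mem_nth // -cardE.
have : nth j (enum (~: B)) (j - #|B|) \in enum (~: B).
  rewrite mem_nth // -cardE; have := cardsC B; rewrite card_ord.
  by move: jB (ltn_ord j); move: (#|B|) (#|~: B|) => b c; lia.
by rewrite mem_enum inE => /negPf.
Qed.

Section Kappa.
Variable k : fieldType.

Lemma coef_multilinear n (c : tvec k n) t (Mt : multilinear n t) :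
  coef c t = c (Sub t Mt : monomial n).
Proof.
rewrite /coef (bigD1 (Sub t Mt : monomial n)) /=; last exact: eqxx.
by rewrite big1 ?addr0 // => u /andP[/eqP ut /negP[]]; apply/eqP/val_inj.
Qed.

Lemma coef_monomial n (c : tvec k n) (u : monomial n) : coef c (val u) = c u.
Proof. by rewrite (coef_multilinear c (valP u)); congr (c _); apply: val_inj. Qed.

Lemma coef_mono n t t' : multilinear n t' -> coef (mono k n t) t' = (t' == t)%:R.
Proof. by move=> Mt; rewrite (coef_multilinear _ Mt) ffunE SubK. Qed.

(** For [f] the indicator of [i], this is the basis vector attached to the leftmost label [i].
    Taking [f] on [nat] avoids casts between the label sets of the factors of a decomposition. *)
Definition kappa n (f : nat -> k) : tvec k n :=
  [ffun u => f (head_leaf (val u)) * (-1) ^+ parity (val u)].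

Lemma coef_kappa n f t : multilinear n t ->
  coef (kappa n f) t = f (head_leaf t) * (-1) ^+ parity t.
Proof. by move=> Mt; rewrite (coef_multilinear _ Mt) ffunE SubK. Qed.

Lemma eq_kappa n f g : (forall l, (l < n)%N -> f l = g l) -> kappa n f = kappa n g.
Proof.
move=> fg; apply/ffunP => u; rewrite !ffunE fg //.
by rewrite -(mem_multilinear _ (valP u)) head_leaf_mem.
Qed.

Lemma coef_free_act n (s : 'S_n) (c : tvec k n) t : multilinear n t ->
  coef (free_act s c) (relabel (permn s) t) = coef c t.
Proof.
move=> Mt; have Mst := multilinear_relabel s Mt.
move: c; apply: (@tvec_ext k n k^o) => [a x y|a x y|u Mu].
- by rewrite free_act_linear (coef_linear _ a).
- exact: coef_linear.
rewrite free_act_mono // !coef_mono //; congr (_%:R); congr nat_of_bool.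
apply/eqP/eqP => [e|->//]; rewrite -[t]subst_Leaf -[u]subst_Leaf.
have relK v : relabel (permn s^-1%g) (relabel (permn s) v) = v.
  rewrite relabel_comp -[RHS]subst_Leaf; apply: eq_subst => l _ /=.
  by rewrite permnK.
by rewrite !subst_Leaf -(relK t) e relK.
Qed.

Lemma tvec_coefP n (c c' : tvec k n) :
  (forall t, multilinear n t -> coef c t = coef c' t) -> c = c'.
Proof.
by move=> h; apply/ffunP => u; rewrite -!coef_monomial; apply: h; apply: (valP u).
Qed.

Lemma relabel_permnKV n (s : 'S_n) t :
  relabel (permn s) (relabel (permn s^-1%g) t) = t.
Proof.
rewrite relabel_comp -[RHS]subst_Leaf; apply: eq_subst => l _ /=.
by rewrite permnKV.
Qed.

Lemma act_kappa n (s : 'S_n) f : free_act s (kappa n f)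
  = (-1) ^+ psign s *: kappa n (f \o permn s^-1%g).
Proof.
apply: tvec_coefP => t Mt; rewrite -(relabel_permnKV s t).
have Mt' := multilinear_relabel s^-1%g Mt; move: (relabel _ t) Mt' => {Mt}t Mt.
rewrite coef_free_act // coef_kappa //.
rewrite (coef_multilinear _ (multilinear_relabel s Mt)) !ffunE.
rewrite SubK head_leaf_relabel /= permnK [RHS]mulrCA; congr (_ * _).
rewrite -(signr_odd _ (parity (relabel _ t))) odd_parity_relabel //.
rewrite -(signr_odd _ (parity t)).
by rewrite -signr_addb addbA addbb.
Qed.
End Kappa.

(** * Two-level decompositions of the vectors [kappa] *)

Lemma map_unshuffle_lt n (B : {set 'I_n}) :
  map (permn (unshuffle B)) (iota 0 #|B|) = map val (enum B).
Proof.
have Bn : (#|B| <= n)%N by rewrite -[X in (_ <= X)%N](card_ord n) max_card.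
apply: (@eq_from_nth _ 0%N); first by rewrite !size_map size_iota -cardE.
move=> i; rewrite size_map size_iota => iB; have iN := leq_trans iB Bn.
rewrite (nth_map 0%N) ?size_iota // nth_iota // add0n.
rewrite -[i]/(val (Ordinal iN)) permnE /unshuffle permE nth_cat -cardE iB.
by rewrite (nth_map (Ordinal iN)) // -cardE.
Qed.

Lemma multilinear_two_level n (B : {set 'I_n}) s t :
  multilinear (n - #|B|).+1 s -> multilinear #|B| t ->
  multilinear n (two_level B s t).
Proof.
move=> Ms Mt; apply: multilinear_relabel.
exact: (@multilinear_graft _ _ _ ord0 _ _ (arity_eq B)).
Qed.

Lemma head_leaf_two_level n (B : {set 'I_n}) s t : multilinear #|B| t ->
  head_leaf (two_level B s t) = permn (unshuffle B)
    (if head_leaf s == 0%N then head_leaf t else (head_leaf s + #|B|).-1).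
Proof.
by move=> Mt; rewrite head_leaf_relabel head_leaf_graft0 (size_multilinear Mt).
Qed.

Section KoszulDual.
Variable k : fieldType.

Lemma sign_two_level n (B : {set 'I_n}) s t :
  multilinear (n - #|B|).+1 s -> multilinear #|B| t ->
  (-1) ^+ (vertices_after 0 s * vertices t) * (-1) ^+ parity (two_level B s t)
  = (-1) ^+ psign (unshuffle B) * (-1) ^+ ((n - #|B|) * #|B|.-1)
    * ((-1) ^+ parity s * (-1) ^+ parity t) :> k.
Proof.
move=> Ms Mt; have M := @multilinear_graft _ _ _ ord0 _ _ (arity_eq B) Ms Mt.
rewrite -(signr_odd _ (parity (two_level _ _ _))) odd_parity_relabel // signr_addb.
rewrite signr_odd mulrCA -mulrA; congr (_ * _); rewrite -!exprD -[LHS]signr_odd addnC.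
by rewrite (odd_parity_graft Ms Mt) signr_odd addnC.
Qed.

Definition root_weight n (B : {set 'I_n}) (f : nat -> k) (j : nat) : k :=
  if j == 0%N then 0 else f (permn (unshuffle B) (j + #|B|).-1).

Definition upper_weight n (B : {set 'I_n}) (f : nat -> k) (j : nat) : k :=
  f (permn (unshuffle B) j).

(** The leftmost leaf of a composite lies in the root part, or in the upper part when the grafting
    leaf 0 is itself leftmost. The two tensors are these two cases; they are dual to the composition
    of Perm. *)
Lemma infdec_kappa n (B : {set 'I_n}) (f : nat -> k) :
  infdec B (kappa n f) =
  ((-1) ^+ psign (unshuffle B) * (-1) ^+ ((n - #|B|) * #|B|.-1)) *:
    (tensor (kappa _ (root_weight B f)) (kappa _ (fun=> 1))
     + tensor (kappa _ (fun j => (j == 0%N)%:R)) (kappa _ (upper_weight B f))).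
Proof.
apply/ffunP => -[s t]; rewrite !ffunE /=.
have Ms := valP s; have Mt := valP t.
rewrite coef_kappa ?multilinear_two_level // mulrCA sign_two_level //.
rewrite head_leaf_two_level // [LHS]mulrCA; congr (_ * _).
rewrite /root_weight /upper_weight; case: eqP => _; rewrite ?mulr1n ?mulr0n; ring.
Qed.

Lemma linear0_raw (V W : lmodType k) (g : V -> W) : linear g -> g 0 = 0.
Proof.
by move=> lg; have := lg (-1) 0 0; rewrite scaler0 addr0 scaleN1r addNr.
Qed.

Lemma linearZ_raw (V W : lmodType k) (g : V -> W) a x :
  linear g -> g (a *: x) = a *: g x.
Proof.
by move=> lg; have := lg a x 0; rewrite (linear0_raw lg) !addr0.
Qed.

Lemma linearD_raw (V W : lmodType k) (g : V -> W) x y :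
  linear g -> g (x + y) = g x + g y.
Proof. by move=> lg; have := lg 1 x y; rewrite !scale1r. Qed.

Lemma linfun_raw (V W : vectType k) (g : V -> W) : linear g ->
  {h : 'Hom(V, W) | h =1 g}.
Proof.
move=> lg; pose gL := GRing.isLinear.Build _ _ _ _ g lg.
by pose G : {linear V -> W} := HB.pack g gL; exists (linfun G) => v; rewrite lfunE.
Qed.

Lemma span_preim (V W : vectType k) (g : V -> W) (X : seq V) (U : {vspace W}) :
  linear g -> {in X, forall v, g v \in U} -> {in <<X>>%VS, forall v, g v \in U}.
Proof.
move=> lg gX v; have [h hg] := linfun_raw lg; rewrite -hg memv_preim.
by apply: subvP; apply/span_subvP => w wX; rewrite -memv_preim hg gX.
Qed.

Lemma tensor_linearl a b (y : tvec k b) :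
  linear (fun x : tvec k a => tensor x y).
Proof.
by move=> c x x'; apply/ffunP => p; rewrite !ffunE mulrDl -mulrA.
Qed.

Lemma tensor_linearr a b (x : tvec k a) :
  linear (fun y : tvec k b => tensor x y).
Proof.
by move=> c y y'; apply/ffunP => p; rewrite !ffunE mulrDr; congr (_ + _); apply: mulrCA.
Qed.

Lemma mem_tensv a b (U : {vspace tvec k a}) (V : {vspace tvec k b}) x y :
  x \in U -> y \in V -> tensor x y \in tensv U V.
Proof.
rewrite -{1}(span_basis (vbasisP U)) -{1}(span_basis (vbasisP V)) => xU yV.
apply: (span_preim (@tensor_linearr a b x)) yV => y' y'V /=.
apply: (span_preim (tensor_linearl y')) xU => x' x'U.
by apply: memv_span; apply: allpairs_f.
Qed.

(** Contraction of the second factor with a coordinate functional. This is how membership of a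
    decomposition in a tensor product is turned into conditions on single coefficients. *)
Lemma tensv_slicel a b (U : {vspace tvec k a}) (V : {vspace tvec k b}) z t :
  z \in tensv U V -> [ffun s => z (s, t)] \in U.
Proof.
apply: (@span_preim _ (tvec k a) (fun z : tens k a b => [ffun s => z (s, t)])).
  by move=> c x y; apply/ffunP => s; rewrite !ffunE.
move=> _ /allpairsP[[x y] /= [xU _ ->]].
have -> : [ffun s => tensor x y (s, t)] = (y t : k) *: x.
  by apply/ffunP => s; rewrite !ffunE mulrC.
by apply/rpredZ/vbasis_mem.
Qed.

Lemma tensv_slicer a b (U : {vspace tvec k a}) (V : {vspace tvec k b}) z s :
  z \in tensv U V -> [ffun t => z (s, t)] \in V.
Proof.
apply: (@span_preim _ (tvec k b) (fun z : tens k a b => [ffun t => z (s, t)])).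
  by move=> c x y; apply/ffunP => t; rewrite !ffunE.
move=> _ /allpairsP[[x y] /= [_ yV ->]].
have -> : [ffun t => tensor x y (s, t)] = (x s : k) *: y.
  by apply/ffunP => t; rewrite !ffunE.
by apply/rpredZ/vbasis_mem.
Qed.

Definition kappa_ffun n (f : {ffun 'I_n -> k^o}) : tvec k n :=
  kappa n (fun l => oapp f 0 (insub l)).

Lemma kappa_ffun_linear n : linear (@kappa_ffun n).
Proof.
move=> a f g; apply/ffunP => u; rewrite !ffunE.
case: insubP => [i _ _|_] /=.
  by rewrite !ffunE mulrDl; congr (_ + _); apply: (esym (mulrA _ _ _)).
by rewrite !mul0r [_ *: _]mulr0 addr0.
Qed.

Definition kappa_space n : {vspace tvec k n} :=
  limg (sval (linfun_raw (@kappa_ffun_linear n))).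

Lemma kappa_spaceP n c : c \in kappa_space n <-> exists f, c = kappa n f.
Proof.
rewrite /kappa_space; case: linfun_raw => h /= hE; split=> [/memv_imgP[f _ ->]|[f ->]].
  by rewrite hE; eexists; reflexivity.
have -> : kappa n f = h [ffun i : 'I_n => f i].
  rewrite hE; apply: eq_kappa => l ln.
  by rewrite (insubT (fun i => i < n)%N ln) /= ffunE.
by rewrite memv_img ?memvf.
Qed.

Lemma mem_kappa_space n f : kappa n f \in kappa_space n.
Proof. by apply/kappa_spaceP; exists f. Qed.

Lemma kappa_space_subcooperad : subcooperad kappa_space.
Proof.
split=> [n s c /kappa_spaceP[f ->]|n B c /kappa_spaceP[f ->]].
  by rewrite act_kappa rpredZ ?mem_kappa_space.
by rewrite infdec_kappa rpredZ // rpredD // mem_tensv ?mem_kappa_space.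
Qed.

Lemma multilinear3_head0 t : multilinear 3 t -> head_leaf t = 0%N ->
  t \in [:: Node (Node (Leaf 0) (Leaf 1)) (Leaf 2);
            Node (Leaf 0) (Node (Leaf 1) (Leaf 2));
            Node (Node (Leaf 0) (Leaf 2)) (Leaf 1);
            Node (Leaf 0) (Node (Leaf 2) (Leaf 1))].
Proof.
move=> Mt t0; set l := (X in _ \in X).
have : t \in bounded_trees 3 3.
  apply: mem_bounded_trees; first by rewrite (size_multilinear Mt).
  by apply/allP => i; rewrite (mem_multilinear _ Mt).
have : all (fun u => multilinear 3 u && (head_leaf u == 0%N) ==> (u \in l))
    (bounded_trees 3 3) by vm_compute.
by move=> /allP h /h; rewrite Mt t0 /=.
Qed.

(** The relator involves exactly the four monomials with leaf 0 leftmost, and its signs are opposite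
    to those of [parity]. *)
Lemma prelie_relator_kappa :
  prelie_relator k = - kappa 3 (fun l => (l == 0%N)%:R).
Proof.
apply/ffunP => u; rewrite !ffunE; have Mu := valP u.
have [u0|u0] := eqVneq (head_leaf (val u)) 0%N; last first.
  have F c : head_leaf c = 0%N -> (val u == c) = false.
    by move=> c0; apply/negP => /eqP uc; rewrite uc c0 in u0.
  by rewrite !F // mul0r !subrr ?oppr0.
move: (multilinear3_head0 Mu u0); rewrite mul1r !inE.
case/or4P => /eqP->; rewrite /= -signr_odd ?(expr0, expr1) ?opprK
  ?(subr0, sub0r, opprK).
all: rewrite ?(subr0, sub0r, opprK) //.
Qed.

End KoszulDual.

(** * Lower bound for the Koszul dual, and comparison of coefficients by cutting trees *)

Definition comb (x : nat) (w : seq nat) : btree :=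
  foldl (fun t l => Node t (Leaf l)) (Leaf x) w.

Lemma comb_rcons x w l : comb x (rcons w l) = Node (comb x w) (Leaf l).
Proof. by rewrite /comb foldl_rcons. Qed.

Lemma leaves_comb x w : leaves (comb x w) = x :: w.
Proof.
elim/last_ind: w => // w l IHw.
by rewrite comb_rcons /= IHw /= cats1.
Qed.

Lemma head_leaf_comb x w : head_leaf (comb x w) = x.
Proof. by rewrite -nth0_leaves leaves_comb. Qed.

Section KoszulDualSpace.
Variable k : fieldType.

Lemma kappa_delta n (f : nat -> k) :
  kappa n f = \sum_(i < n) f i *: kappa n (fun l => (l == i)%:R).
Proof.
apply/ffunP => u; rewrite sum_ffunE ffunE.
have hn : (head_leaf (val u) < n)%N.
  by rewrite -(mem_multilinear _ (valP u)) head_leaf_mem.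
rewrite (bigD1 (Ordinal hn)) //= big1 ?addr0 => [|i hi].
  by rewrite !ffunE eqxx mul1r.
rewrite !ffunE; case: eqP => [e|_]; last by rewrite mul0r [_ *: _]mulr0.
by case/eqP: hi; apply: val_inj; rewrite /= e.
Qed.

Lemma kappa_sub_relations : (kappa_space k 3 <= prelie_relations k)%VS.
Proof.
apply/subvP => c /kappa_spaceP[f ->]; rewrite kappa_delta.
apply: rpred_sum => i _; apply: rpredZ.
(* The transposition of 0 and [i] carries the basis vector of leftmost label 0, which is minus the
   relator, to that of label [i], up to sign. *)
have -> : kappa 3 (fun l => (l == i)%:R)
    = (-1) ^+ (psign (tperm ord0 i)).+1 *: free_act (tperm ord0 i) (prelie_relator k).
  rewrite prelie_relator_kappa -scaleN1r (linearZ_raw _ _ (free_act_linear _)).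
  rewrite act_kappa !scalerA exprS mulN1r mulrN1 opprK -signr_addb addbb scale1r.
  apply: eq_kappa => l l3 /=.
  congr (_%:R); congr nat_of_bool.
  rewrite -[RHS](inj_eq (@permn_inj _ (tperm ord0 i))) permnKV.
  by rewrite (permnE _ (@ord0 2)) tpermL.
by apply: rpredZ; apply: memv_span; apply: map_f; rewrite mem_enum.
Qed.

Lemma relations_sub_kappa : (prelie_relations k <= kappa_space k 3)%VS.
Proof.
apply/span_subvP => _ /mapP[s _ ->].
apply: (proj1 (kappa_space_subcooperad k)).
by rewrite prelie_relator_kappa rpredN mem_kappa_space.
Qed.

Lemma kappa_sub_koszul_dual n :
  (kappa_space k n <= koszul_dual (prelie_relations k) n)%VS.
Proof.
exact: (koszul_dual_max (kappa_space_subcooperad k) kappa_sub_relations).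
Qed.

(* The coefficient of [t] divided by its sign: [c] is in [kappa_space] if and
   only if this depends only on the leftmost leaf of [t]. *)
Definition ncoef n (c : tvec k n) (t : btree) : k := coef c t * (-1) ^+ parity t.

Lemma ncoef_kappa n f t : multilinear n t ->
  ncoef (kappa n f) t = f (head_leaf t).
Proof.
by move=> Mt; rewrite /ncoef coef_kappa // -mulrA -signr_odd -expr2 sqrr_sign mulr1.
Qed.

Lemma mem_kappa_ncoef n (c : tvec k n) :
  (forall t t', multilinear n t -> multilinear n t' ->
    head_leaf t = head_leaf t' -> ncoef c t = ncoef c t') ->
  c \in kappa_space k n.
Proof.
(* By [h] any tree with leftmost leaf [a] may serve as representative; the left comb with the other
   labels in increasing order is chosen. *)
move=> h; apply/kappa_spaceP; exists (fun a => ncoef c (comb a (rem a (iota 0 n)))).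
apply: tvec_coefP => t Mt; rewrite coef_kappa // (h _ t) //.
- by rewrite /ncoef -mulrA -signr_odd -expr2 sqrr_sign mulr1.
- rewrite /multilinear leaves_comb perm_sym; apply: perm_to_rem.
  by rewrite -(perm_mem Mt) head_leaf_mem.
- by rewrite head_leaf_comb.
Qed.

(** Grafting without renumbering: the hole has a label foreign to the final tree ([n] in the
    applications), so the shifts of [graft] and the unshuffle of [two_level] disappear. *)
Definition plug (h : nat) (X t : btree) : btree :=
  subst (fun l => if l == h then t else Leaf l) X.

(** Cutting out a subtree is a two-level decomposition once labels are standardised: [g] sends the
    hole to 0 and the labels outside [B] increasingly to 1, 2, and so on. *)
Lemma two_level_plug n (B : {set 'I_n}) X t :
  perm_eq (leaves X) (n :: map (permn (unshuffle B)) (iota #|B| (n - #|B|))) ->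
  perm_eq (leaves t) (map (permn (unshuffle B)) (iota 0 #|B|)) ->
  let g l := if l == n then 0%N else
    ((permn (unshuffle B)^-1%g l).+1 - #|B|)%N in
  let s := relabel g X in
  let t0 := relabel (permn (unshuffle B)^-1%g) t in
  [/\ multilinear (n - #|B|).+1 s, multilinear #|B| t0
    & two_level B s t0 = plug n X t].
Proof.
set u := unshuffle B; move=> PX Pt g s t0.
have Mt0 : multilinear #|B| t0.
  rewrite /multilinear leaves_relabel (perm_trans (perm_map _ Pt)) // -map_comp.
  by rewrite (eq_map (permnK u)) map_id.
have lt_u l : l \in iota #|B| (n - #|B|) -> (permn u l < n)%N.
  by rewrite permn_lt mem_iota => /andP[? ?]; lia.
split=> //.
  rewrite /multilinear leaves_relabel (perm_trans (perm_map _ PX)) //=.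
  rewrite /g eqxx -map_comp /= perm_cons.
  have -> : [seq (g \o permn u) l | l <- iota #|B| (n - #|B|)]
      = [seq l.+1 - #|B| | l <- iota #|B| (n - #|B|)]%N.
    apply/eq_in_map => l lB /=.
    by rewrite /g ltn_eqF ?lt_u // permnK.
  have -> : iota #|B| (n - #|B|) = map (addn #|B|) (iota 0 (n - #|B|)).
    by rewrite -iotaDl addn0.
  rewrite -map_comp.
  rewrite (eq_map (g := fun l => 1 + l)%N) => [|l /=]; last by lia.
  by rewrite -iotaDl.
rewrite /two_level /graft /s /relabel !subst_subst; apply: eq_subst => l.
rewrite (perm_mem PX) inE => /orP[/eqP->|/mapP[j jB ->]].
  rewrite /= /g eqxx /= !subst_subst -[RHS]subst_Leaf; apply: eq_subst => i _ /=.
  by rewrite add0n permnKV.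
have uj : (permn u j == n) = false by rewrite ltn_eqF ?lt_u.
rewrite /= /g uj /= permnK (size_multilinear Mt0).
move: jB; rewrite mem_iota => /andP[Bj jn].
have -> : (j.+1 - #|B| == 0)%N = false by lia.
by rewrite /= /shift ltn0 subnK ?leqW.
Qed.

Lemma unshuffle_split n (t r : seq nat) : perm_eq (t ++ r) (iota 0 n) ->
  let B := [set i : 'I_n | val i \in t] in
  [/\ #|B| = size t, perm_eq t (map (permn (unshuffle B)) (iota 0 #|B|))
    & perm_eq r (map (permn (unshuffle B)) (iota #|B| (n - #|B|)))].
Proof.
move=> Ptr B; have ut : uniq t.
  by have := iota_uniq 0 n; rewrite -(perm_uniq Ptr) cat_uniq => /and3P[].
have PB : perm_eq t (map (permn (unshuffle B)) (iota 0 #|B|)).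
  rewrite map_unshuffle_lt; apply: uniq_perm => //.
    by rewrite map_inj_uniq ?enum_uniq //; apply: val_inj.
  move=> l; apply/idP/mapP => [lt|[i]]; last by rewrite mem_enum inE => ? ->.
  have ln : (l < n)%N by have := perm_mem Ptr l; rewrite mem_cat lt mem_iota.
  by exists (Ordinal ln) => //; rewrite mem_enum inE.
have cB : #|B| = size t by rewrite (perm_size PB) size_map size_iota.
have st : (size t + size r)%N = n by rewrite -size_cat (perm_size Ptr) size_iota.
have Bn : (#|B| <= n)%N by rewrite cB -st leq_addr.
split=> //; rewrite -(perm_cat2l t) (perm_trans Ptr) // perm_sym.
rewrite (perm_trans (perm_cat PB (perm_refl _))) // -map_cat -iotaD subnKC //.
exact: perm_iota_permn.
Qed.

(* The slices of [infdec B c] lie in components of smaller arity, where the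
   coefficients are already known to depend only on the leftmost leaves. *)
Lemma ncoef_plug n (c : tvec k n) X X' t t' r :
  c \in koszul_dual (prelie_relations k) n ->
  (forall m, (m < n)%N ->
    (koszul_dual (prelie_relations k) m <= kappa_space k m)%VS) ->
  perm_eq (leaves X) (n :: r) -> perm_eq (leaves X') (n :: r) ->
  perm_eq (leaves t ++ r) (iota 0 n) -> perm_eq (leaves t') (leaves t) ->
  head_leaf X = head_leaf X' -> head_leaf t = head_leaf t' ->
  (1 < size (leaves t))%N -> (0 < size r)%N ->
  ncoef c (plug n X t) = ncoef c (plug n X' t').
Proof.
move=> cK IH PX PX' Ptr Ptt' hX ht t1 r0.
pose B := [set i : 'I_n | val i \in leaves t].
have [cB PB Pr] := unshuffle_split Ptr; rewrite -/B in cB PB Pr.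
have st : (size (leaves t) + size r)%N = n.
  by rewrite -size_cat (perm_size Ptr) size_iota.
have PBX : perm_eq (leaves X) (n :: map (permn (unshuffle B)) (iota #|B| (n - #|B|))).
  by rewrite (perm_trans PX) // perm_cons.
have PBX' : perm_eq (leaves X') (n :: map (permn (unshuffle B)) (iota #|B| (n - #|B|))).
  by rewrite (perm_trans PX') // perm_cons.
have PB' := perm_trans Ptt' PB.
have /= := two_level_plug PBX PB; have /= := two_level_plug PBX' PB'.
set g := fun l : nat => _.
have hs : head_leaf (relabel g X) = head_leaf (relabel g X').
  by rewrite !head_leaf_relabel hX.
have ht0 v : head_leaf (relabel v t) = head_leaf (relabel v t').
  by rewrite !head_leaf_relabel ht.
move: (relabel g X) (relabel g X') hs => s s' hs.
have := ht0 (permn (unshuffle B)^-1%g).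
move: (relabel _ t) (relabel _ t') => t0 t0' {}ht0 [Ms' Mt' <-] [Ms Mt <-].
have D := proj2 (koszul_dual_subcooperad (prelie_relations k)) n B c cK.
(* Two leaves in [t] make the root factor smaller than [n], and one leaf outside [t] makes the upper
   factor smaller, so [IH] applies to both slices. *)
have [lt1 lt2] : ((n - #|B|).+1 < n)%N /\ (#|B| < n)%N.
  by move: st t1 r0; rewrite -cB; move: #|B| (size r) => b b'; clear; lia.
pose C : k := (-1) ^+ psign (unshuffle B) * (-1) ^+ ((n - #|B|) * #|B|.-1).
have E a b (Ma : multilinear (n - #|B|).+1 a) (Mb : multilinear #|B| b) :
    ncoef c (two_level B a b) = C * ((infdec B c) (Sub a Ma, Sub b Mb)
      * ((-1) ^+ parity a * (-1) ^+ parity b)).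
  rewrite mulrCA -/C -(sign_two_level k Ma Mb) ffunE /= mulrACA -expr2.
  by rewrite -(signr_odd _ (_ * _)) sqrr_sign mul1r.
have [f /ffunP Hf] := (iffLR (kappa_spaceP _))
  (subvP (IH _ lt1) _ (tensv_slicel (Sub t0 Mt) D)).
have [f' /ffunP Hf'] := (iffLR (kappa_spaceP _))
  (subvP (IH _ lt2) _ (tensv_slicer (Sub s' Ms') D)).
(* The factors are changed one at a time: a slice fixes the other factor, and the slice being a
   [kappa] makes its coefficient depend only on the leftmost leaf. *)
transitivity (ncoef c (two_level B s' t0)).
  rewrite !(E _ _ _ Mt); congr (_ * _).
  have := Hf (Sub s Ms); have := Hf (Sub s' Ms'); rewrite !ffunE /= => -> ->.
  rewrite hs; rewrite !mulrA -!(mulrA (f _)) -!expr2.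
  by rewrite -(signr_odd _ (parity s)) -(signr_odd _ (parity s')) !sqrr_sign.
rewrite !(E _ _ Ms'); congr (_ * _).
have := Hf' (Sub t0 Mt); have := Hf' (Sub t0' Mt'); rewrite !ffunE /= => -> ->.
rewrite ht0 [LHS]mulrACA [RHS]mulrACA -!expr2.
by rewrite -(signr_odd _ (parity t0)) -(signr_odd _ (parity t0')) !sqrr_sign.
Qed.
End KoszulDualSpace.

(** * Upper bound for the Koszul dual *)

Lemma plug_id h X t : h \notin leaves X -> plug h X t = X.
Proof.
move=> hX; rewrite -[RHS]subst_Leaf; apply: eq_subst => l lX.
by case: eqP => // lh; rewrite lh (negPf hX) in lX.
Qed.

Lemma plug_node h X Y t : plug h (Node X Y) t = Node (plug h X t) (plug h Y t).
Proof. by []. Qed.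

Lemma plug_hole h t : plug h (Leaf h) t = t.
Proof. by rewrite /plug /= eqxx. Qed.

Lemma plug_leaf h l t : (l == h) = false -> plug h (Leaf l) t = Leaf l.
Proof. by rewrite /plug /= => ->. Qed.

Lemma head_leaf_plug h X t :
  head_leaf (plug h X t) = if head_leaf X == h then head_leaf t else head_leaf X.
Proof. by rewrite /plug; elim: X => [l|u IHu v _] //=; case: eqP. Qed.

Lemma leaves_plug h X t r : perm_eq (leaves X) (h :: r) -> h \notin r ->
  perm_eq (leaves (plug h X t)) (leaves t ++ r).
Proof.
move=> PX hr; rewrite /plug leaves_subst.
rewrite (perm_trans (perm_flatten_map _ PX)) //= eqxx perm_cat2l.
have -> : map (leaves \o (fun l => if l == h then t else Leaf l)) r
    = map (fun l => [:: l]) r.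
  by apply/eq_in_map => l lr /=; case: eqP => // lh; rewrite -lh lr in hr.
by rewrite flatten_map1 map_id.
Qed.

Lemma multilinear_head_inj n t t' : (n <= 2)%N ->
  multilinear n t -> multilinear n t' -> head_leaf t = head_leaf t' -> t = t'.
Proof.
move=> n2 Mt Mt' /eqP tt'; apply/eqP.
have Hb u : multilinear n u -> u \in bounded_trees n n.
  move=> Mu; apply: mem_bounded_trees; first by rewrite (size_multilinear Mu).
  by apply/allP => i; rewrite (mem_multilinear _ Mu).
have : all (fun u => all (fun u' => [&& multilinear n u, multilinear n u'
    & head_leaf u == head_leaf u'] ==> (u == u')) (bounded_trees n n))
    (bounded_trees n n).
  by case: n n2 {Mt Mt' Hb} => [|[|[|//]]] _; vm_compute.
by move=> /allP/(_ t (Hb t Mt))/allP/(_ t' (Hb t' Mt')); rewrite Mt Mt' tt'.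
Qed.

Section KoszulDualUpper.
Variable k : fieldType.

Section Step.
Variables (n : nat) (c : tvec k n).
Hypotheses (n4 : (4 <= n)%N) (cK : c \in koszul_dual (prelie_relations k) n).
Hypothesis IH : forall m, (m < n)%N ->
  (koszul_dual (prelie_relations k) m <= kappa_space k m)%VS.

Let leaf_notin t T : multilinear n T -> {subset leaves t <= leaves T} ->
  n \notin leaves t.
Proof.
by move=> MT tT; apply/negP => /tT; rewrite (mem_multilinear _ MT) ltnn.
Qed.

(** A normal form reached by admissible cuts: the right child of the root becomes a leaf. If the
    left child has two leaves it can be cut out and the rest rearranged at once. If it is a leaf,
    the right child has at least three leaves, because [n >= 4], and needs two moves. *)
Lemma ncoef_last_leaf T : multilinear n T ->
  exists u z, [/\ multilinear n (Node u (Leaf z)), head_leaf u = head_leaf T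
    & ncoef c T = ncoef c (Node u (Leaf z))].
Proof.
move=> MT; have sT := size_multilinear MT; case: T MT sT => [l|u v] MT sT.
  by have := n4; rewrite -[X in (_ < X)%N]sT.
have nu : n \notin leaves u by apply: leaf_notin MT _ => l /=; rewrite mem_cat => ->.
have nv : n \notin leaves v.
  by apply: leaf_notin MT _ => l /=; rewrite mem_cat orbC => ->.
rewrite /multilinear /= in MT; rewrite /= size_cat in sT.
have leafP t : (exists z, t = Leaf z) \/ (1 < size (leaves t))%N.
  case: t => [z|t1 t2]; [by left; exists z|right].
  by rewrite /= size_cat !size_leaves addSn addnS.
have [[z vz]|v2'] := leafP v; first by exists u, z; split; rewrite // -vz.
have [[a ua]|u2] := leafP u; last first.
  case/lastP E : (leaves v) => [|w z]; first by rewrite E in v2'.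
  have zn : (z == n) = false.
    by apply/negP => /eqP zn; rewrite E mem_rcons inE -zn eqxx in nv.
  have PX' : perm_eq (leaves (Node (comb n w) (Leaf z))) (n :: rcons w z).
    by rewrite /= leaves_comb /= cats1.
  exists (plug n (comb n w) u), z; split.
  - rewrite -(plug_leaf u zn) -plug_node.
    by rewrite /multilinear (perm_trans (leaves_plug _ PX' _)) -?E.
  - by rewrite head_leaf_plug head_leaf_comb eqxx.
  rewrite -(plug_leaf u zn) -plug_node -{1}(plug_id u nv) -{1}(plug_hole n u).
  rewrite -plug_node; apply: (ncoef_plug (r := leaves v) cK IH) => //.
  - by rewrite E.
  - by rewrite /= head_leaf_comb.
  by apply: leq_trans v2'.
rewrite {}ua in nu MT sT *.
have an : (a == n) = false by rewrite inE eq_sym in nu; apply: negPf.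
case E : (leaves v) v2' sT => [|x w0] //; case/lastP: w0 E => [|w z] //= E _ sT.
have zn : (z == n) = false.
  by apply/negP => /eqP zn; rewrite E inE mem_rcons inE -zn eqxx orbT in nv.
have hv : head_leaf v = x by rewrite -nth0_leaves E.
have P1 : perm_eq (x :: rcons w z ++ [:: a]) (iota 0 n).
  by rewrite -cat_cons -E (perm_trans _ MT) // perm_catC.
exists (Node (Leaf a) (comb x w)), z; split=> //.
  rewrite /multilinear /= leaves_comb (perm_trans _ P1) //.
  by rewrite -cats1; apply/seq.permP => Q; rewrite /= !count_cat /=; lia.
(* The right child is first put in the form of a comb. Its part [comb x w] still has at least two
   leaves, so it can be cut out next to rotate the remaining three-leaf tree. *)
transitivity (ncoef c (Node (Leaf a) (Node (comb x w) (Leaf z)))).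
  have plugR t : Node (Leaf a) t = plug n (Node (Leaf a) (Leaf n)) t.
    by rewrite plug_node plug_hole plug_leaf.
  rewrite (plugR v) (plugR (Node _ _)).
  apply: (ncoef_plug (r := [:: a]) cK IH) => //.
  - by apply/seq.permP => Q /=; lia.
  - by apply/seq.permP => Q /=; lia.
  - by rewrite E.
  - by rewrite E /= leaves_comb /= cats1.
  - by rewrite hv /= head_leaf_comb.
  by rewrite E /= size_rcons.
have -> : Node (Leaf a) (Node (comb x w) (Leaf z))
    = plug n (Node (Leaf a) (Node (Leaf n) (Leaf z))) (comb x w).
  by rewrite !plug_node plug_hole !plug_leaf.
have -> : Node (Node (Leaf a) (comb x w)) (Leaf z)
    = plug n (Node (Node (Leaf a) (Leaf n)) (Leaf z)) (comb x w).
  by rewrite !plug_node plug_hole !plug_leaf.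
apply: (ncoef_plug (r := [:: a; z]) cK IH) => //.
- by apply/seq.permP => Q /=; lia.
- by apply/seq.permP => Q /=; lia.
- rewrite leaves_comb (perm_trans _ P1) // -cats1.
  by apply/seq.permP => Q; rewrite /= !count_cat /=; lia.
by rewrite leaves_comb /=; move: sT n4; rewrite /= size_rcons; clear; lia.
Qed.

(** Distinct last leaves [z] and [z'] are both brought next to the root. The rest has [n - 2 >= 2]
    leaves and can be cut out, and the two three-leaf root parts, which differ by exchanging [z] and
    [z'], have the hole as leftmost leaf. *)
Lemma ncoef_last_leaf_eq u z u' z' :
  multilinear n (Node u (Leaf z)) -> multilinear n (Node u' (Leaf z')) ->
  head_leaf u = head_leaf u' ->
  ncoef c (Node u (Leaf z)) = ncoef c (Node u' (Leaf z')).
Proof.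
move=> Mu Mu' uu'.
have zn : (z == n) = false.
  by rewrite ltn_eqF // -(mem_multilinear _ Mu) /= mem_cat mem_head orbT.
have zn' : (z' == n) = false.
  by rewrite ltn_eqF // -(mem_multilinear _ Mu') /= mem_cat mem_head orbT.
have su : size (leaves u) = n.-1.
  by rewrite -(size_multilinear Mu) /= size_cat addn1.
have su' : size (leaves u') = n.-1.
  by rewrite -(size_multilinear Mu') /= size_cat addn1.
have n2 : (1 < n.-1)%N by move: n4; clear; lia.
have same y v v' : (y == n) = false -> perm_eq (leaves v ++ [:: y]) (iota 0 n) ->
    perm_eq (leaves v') (leaves v) -> head_leaf v = head_leaf v' ->
    size (leaves v) = n.-1 ->
    ncoef c (Node v (Leaf y)) = ncoef c (Node v' (Leaf y)).
  move=> yn Pv Pv' hv sv.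
  have plugL t : Node t (Leaf y) = plug n (Node (Leaf n) (Leaf y)) t.
    by rewrite plug_node plug_hole plug_leaf.
  rewrite (plugL v) (plugL v').
  by apply: (ncoef_plug (r := [:: y]) cK IH); rewrite ?sv.
have [zz|zz] := eqVneq z z'.
  rewrite -zz; apply: same => //.
  by rewrite perm_sym -(perm_cat2r [:: z]) (perm_trans Mu) // perm_sym zz.
case E : (leaves u) => [|a w]; first by rewrite E in su; rewrite -su in n2.
have ha : head_leaf u = a by rewrite -nth0_leaves E.
(* [z'] is not the leftmost leaf of [u]: that is also a leaf of [u'], whereas [z'] lies outside
   [u']. *)
have z'w : z' \in w.
  have : z' \in leaves (Node u (Leaf z)).
    by rewrite (perm_mem Mu) -(perm_mem Mu') /= mem_cat mem_head orbT.
  rewrite /= mem_cat E !inE (eq_sym z' z) (negPf zz) orbF => /orP[/eqP z'a|//].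
  have := multilinear_uniq Mu'; rewrite /= cat_uniq => /and3P[_ /hasPn/(_ z')].
  by rewrite mem_head => /(_ isT); rewrite z'a -ha uu' head_leaf_mem.
have Pw := perm_to_rem z'w; set w' := rem z' w in Pw.
have P1 : perm_eq (a :: w' ++ [:: z'; z]) (iota 0 n).
  rewrite (perm_trans _ Mu) //= E; apply/seq.permP => Q.
  by have := (seq.permP Pw) Q; rewrite /= !count_cat /=; lia.
have sw : ((size w').+1).+2 = n.
  by have := perm_size P1; rewrite /= size_cat size_iota addn2.
transitivity (ncoef c (Node (Node (comb a w') (Leaf z')) (Leaf z))).
  apply: same => //; last by rewrite /= head_leaf_comb.
  rewrite /= leaves_comb E; apply/seq.permP => Q.
  by have := (seq.permP Pw) Q; rewrite /= !count_cat /=; lia.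
transitivity (ncoef c (Node (Node (comb a w') (Leaf z)) (Leaf z'))).
  have -> : Node (Node (comb a w') (Leaf z')) (Leaf z)
      = plug n (Node (Node (Leaf n) (Leaf z')) (Leaf z)) (comb a w').
    by rewrite !plug_node plug_hole !plug_leaf.
  have -> : Node (Node (comb a w') (Leaf z)) (Leaf z')
      = plug n (Node (Node (Leaf n) (Leaf z)) (Leaf z')) (comb a w').
    by rewrite !plug_node plug_hole !plug_leaf.
  apply: (ncoef_plug (r := [:: z'; z]) cK IH) => //.
  - by apply/seq.permP => Q /=; lia.
  - by rewrite leaves_comb.
  by rewrite leaves_comb /=; move: sw n4; move: (size w') => m; clear; lia.
apply: same => //.
- rewrite /= leaves_comb (perm_trans _ P1) //; apply/seq.permP => Q.
  by rewrite /= !count_cat /=; lia.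
- rewrite -(perm_cat2r [:: z']) (perm_trans Mu') // perm_sym (perm_trans _ P1) //.
  by rewrite /= leaves_comb; apply/seq.permP => Q; rewrite /= !count_cat /=; lia.
- by rewrite /= head_leaf_comb -ha.
by rewrite /= leaves_comb size_cat /=; move: sw; move: (size w') => m; clear; lia.
Qed.

End Step.

Lemma koszul_dual_sub_kappa n :
  (koszul_dual (prelie_relations k) n <= kappa_space k n)%VS.
Proof.
elim/ltn_ind: n => n IH; have [n4|] := ltnP 3 n; last first.
  rewrite leq_eqVlt => /orP[/eqP->|n3].
    exact: subv_trans (koszul_dual_relations _) (relations_sub_kappa k).
  apply/subvP => c _; apply: mem_kappa_ncoef => t t' Mt Mt' tt'.
  by rewrite (multilinear_head_inj n3 Mt Mt' tt').
apply/subvP => c cK; apply: mem_kappa_ncoef => t t' Mt Mt' tt'.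
have [u [z [Mu hu ->]]] := ncoef_last_leaf n4 cK IH Mt.
have [u' [z' [Mu' hu' ->]]] := ncoef_last_leaf n4 cK IH Mt'.
by apply: (ncoef_last_leaf_eq n4 cK IH) => //; rewrite hu hu'.
Qed.

Lemma mem_koszul_dual n c :
  c \in koszul_dual (prelie_relations k) n <-> exists f, c = kappa n f.
Proof.
rewrite -kappa_spaceP; split; apply: subvP; first exact: koszul_dual_sub_kappa.
exact: kappa_sub_koszul_dual.
Qed.

End KoszulDualUpper.

(** * The components of Ass *)

Definition wcomb (w : seq nat) : btree := comb (nth 0%N w 0) (behead w).

Lemma leaves_wcomb w : w != [::] -> leaves (wcomb w) = w.
Proof. by case: w => // x w _; rewrite leaves_comb. Qed.

Lemma leaves_neq0 t : leaves t != [::].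
Proof. by rewrite -size_eq0 -lt0n size_leaves_gt0. Qed.

Lemma leaves_wcomb_leaves t : leaves (wcomb (leaves t)) = leaves t.
Proof. exact: leaves_wcomb (leaves_neq0 t). Qed.

Lemma multilinear_wcomb n t : multilinear n t -> multilinear n (wcomb (leaves t)).
Proof. by rewrite /multilinear leaves_wcomb_leaves. Qed.

Lemma relabel_wcomb f w : w != [::] -> relabel f (wcomb w) = wcomb (map f w).
Proof.
case: w => // x w _; rewrite /wcomb /=; elim/last_ind: w => // w l IHw.
by rewrite map_rcons !comb_rcons -IHw.
Qed.

Lemma leaves_graft i s t : leaves (graft i s t) =
  flatten [seq if l == i then map (addn i) (leaves t)
           else [:: shift i (size (leaves t)) l] | l <- leaves s].
Proof.
rewrite /graft leaves_subst; congr flatten; apply: eq_map => l /=.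
by case: eqP => // _; rewrite leaves_relabel.
Qed.

Lemma perm_iotaE n W : perm_eq W (iota 0 n) ->
  exists s : 'S_n, W = map (permn s) (iota 0 n).
Proof.
have -> : iota 0 n = tval [tuple val i | i < n] by rewrite /= -val_enum_ord.
case/tuple_permP=> s ->; exists s; rewrite /= -map_comp; apply: eq_map => i /=.
by rewrite tnth_mktuple permnE.
Qed.

(** The letters below [m] of the composite spell the upper word, and the place where they begin is
    the position of 0 in the root word. *)
Lemma wgraft_inj p m w1 w2 w1' w2' : (0 < m)%N ->
  perm_eq w1 (iota 0 p.+1) -> perm_eq w2 (iota 0 p.+1) ->
  perm_eq w1' (iota 0 m) -> perm_eq w2' (iota 0 m) ->
  wgraft w1 w1' = wgraft w2 w2' -> w1 = w2 /\ w1' = w2'.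
Proof.
move=> m0 P1 P2 P1' P2'; have s1 : size w1' = m by rewrite (perm_size P1') size_iota.
have s2 : size w2' = m by rewrite (perm_size P2') size_iota.
have [u1 u2] : uniq w1 /\ uniq w2 by rewrite (perm_uniq P1) (perm_uniq P2) iota_uniq.
have [a1 [c1 [E1 _ a10 c10]]] : exists w3 w4, [/\ w1 = w3 ++ 0%N :: w4,
    size w3 = index 0%N w1, 0%N \notin w3 & 0%N \notin w4].
  by apply: split_uniq0; rewrite // (perm_mem P1) mem_iota.
have [a2 [c2 [E2 _ a20 c20]]] : exists w3 w4, [/\ w2 = w3 ++ 0%N :: w4,
    size w3 = index 0%N w2, 0%N \notin w3 & 0%N \notin w4].
  by apply: split_uniq0; rewrite // (perm_mem P2) mem_iota.
rewrite E1 E2 !wgraft_split // s1 s2 => E.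
have big0 (v : seq nat) : 0%N \notin v -> all (fun l => m <= l)%N [seq (l + m).-1 | l <- v].
  move=> v0; apply/allP => _ /mapP[l lv ->]; case: l lv v0 => [->//|l _ _]; lia.
have ltm w' l : perm_eq w' (iota 0 m) -> l \in w' -> (l < m)%N.
  by move=> P; rewrite (perm_mem P) mem_iota.
have F v w' v' : 0%N \notin v -> 0%N \notin v' -> perm_eq w' (iota 0 m) ->
    filter (fun l => l < m)%N ([seq (l + m).-1 | l <- v] ++ w' ++ [seq (l + m).-1 | l <- v'])
    = w'.
  move=> v0 v'0 P; rewrite !filter_cat.
  have N x : 0%N \notin x -> [seq l <- [seq (l + m).-1 | l <- x] | (l < m)%N] = [::].
    move=> x0; apply/eqP; rewrite -[_ == _]negbK -has_filter -all_predC.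
    by apply: sub_all (big0 _ x0) => l /=; rewrite -leqNgt.
  rewrite !N // cats0 /=; apply/all_filterP/allP => l; exact: ltm.
have e' : w1' = w2' by rewrite -(F _ _ _ a10 c10 P1') E F.
split=> //; rewrite -e' in E.
have f v v' : 0%N \notin v -> find (fun l => l < m)%N
    ([seq (l + m).-1 | l <- v] ++ w1' ++ [seq (l + m).-1 | l <- v']) = size v.
  move=> v0; rewrite find_cat size_map ifN; last first.
    by rewrite -all_predC; apply: sub_all (big0 _ v0) => l /=; rewrite -leqNgt.
  case: w1' P1' s1 {e' E} => [|x w] P s1; first by rewrite -s1 in m0.
  by rewrite /= (ltm _ _ P (mem_head _ _)) addn0.
have sa : size a1 = size a2 by rewrite -(f a1 c1) // E f.
have injm : injective (fun l => (l + m).-1) by move=> x y /=; lia.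
move/eqP: E; rewrite eqseq_cat ?size_map // eqseq_cat // eqxx /=.
by rewrite !(inj_eq (inj_map injm)) => /andP[/eqP-> /eqP->].
Qed.

Section Associative.
Variable k : fieldType.

(** Forgets the bracketing, with the left comb as representative of a word. Its kernel is an ideal
    containing the associator, so distinct words stay independent in [Ass]; that words span is the
    content of [to_ass_word]. *)
Definition word_form n : tvec k n -> tvec k n :=
  lin_ext (fun t => mono k n (wcomb (leaves t))).

Lemma word_form_linear n : linear (@word_form n).
Proof. exact: lin_ext_linear. Qed.

Lemma word_form_mono n t : multilinear n t ->
  word_form (mono k n t) = mono k n (wcomb (leaves t)).
Proof. by move=> Mt; rewrite /word_form lin_ext_mono. Qed.

Lemma linear_comp_raw (U V W : lmodType k) (f : V -> W) (g : U -> V) :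
  linear f -> linear g -> linear (fun x => f (g x)).
Proof. by move=> lf lg a x y; rewrite lg lf. Qed.

Lemma word_form_act n (s : 'S_n) c :
  word_form (free_act s c) = free_act s (word_form c).
Proof.
move: c; apply: tvec_ext => [||t Mt].
- exact: linear_comp_raw (@word_form_linear n) (free_act_linear s).
- exact: linear_comp_raw (free_act_linear s) (@word_form_linear n).
rewrite free_act_mono // !word_form_mono ?multilinear_relabel //.
rewrite free_act_mono ?multilinear_wcomb // leaves_relabel.
by rewrite relabel_wcomb // leaves_neq0.
Qed.

Lemma word_form_comp m n p (e : (m + n = p.+1)%N) (i : 'I_m)
    (x : tvec k m) (y : tvec k n) :
  word_form (free_comp e i x y)
  = word_form (free_comp e i (word_form x) (word_form y)).
Proof.
move: x; apply: tvec_ext => [||s Ms].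
- exact: (linear_comp_raw (@word_form_linear p) (free_comp_linearl e i y)).
- apply: (linear_comp_raw (@word_form_linear p)).
  exact: (linear_comp_raw (free_comp_linearl e i (word_form y)) (@word_form_linear m)).
move: y; apply: tvec_ext => [||t Mt].
- exact: (linear_comp_raw (@word_form_linear p) (free_comp_linearr e i _)).
- apply: (linear_comp_raw (@word_form_linear p)).
  exact: (linear_comp_raw (free_comp_linearr e i _) (@word_form_linear n)).
rewrite !word_form_mono // !free_comp_mono ?multilinear_wcomb //.
rewrite !word_form_mono ?(multilinear_graft i e) ?multilinear_wcomb //.
by rewrite !leaves_graft !leaves_wcomb_leaves.
Qed.

Definition word_kernel_space n : {vspace tvec k n} :=
  lker (sval (linfun_raw (@word_form_linear n))).

Lemma mem_word_kernel n x : (x \in word_kernel_space n) = (word_form x == 0).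
Proof.
by rewrite /word_kernel_space; case: linfun_raw => h /= hE; rewrite memv_ker hE.
Qed.

Fact word_kernel_act n (s : 'S_n) x :
  x \in word_kernel_space n -> free_act s x \in word_kernel_space n.
Proof.
rewrite !mem_word_kernel word_form_act => /eqP->.
by rewrite (linear0_raw (free_act_linear s)).
Qed.

Fact word_kernel_compl m n p (e : (m + n = p.+1)%N) (i : 'I_m) x y :
  x \in word_kernel_space m -> free_comp e i x y \in word_kernel_space p.
Proof.
rewrite !mem_word_kernel word_form_comp => /eqP->.
rewrite (linear0_raw (free_comp_linearl e i (word_form y))).
by rewrite (linear0_raw (@word_form_linear p)).
Qed.

Fact word_kernel_compr m n p (e : (m + n = p.+1)%N) (i : 'I_m) x y :
  y \in word_kernel_space n -> free_comp e i x y \in word_kernel_space p.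
Proof.
rewrite !mem_word_kernel word_form_comp => /eqP->.
rewrite (linear0_raw (free_comp_linearr e i (word_form x))).
by rewrite (linear0_raw (@word_form_linear p)).
Qed.

Definition word_kernel : ideal (free_operad k) :=
  @Ideal k (free_operad k) word_kernel_space word_kernel_act word_kernel_compl
    word_kernel_compr.

Lemma assoc_ideal_sub_word_kernel n :
  (quadratic_ideal (assoc_relations k) n <= word_kernel n)%VS.
Proof.
apply: (@ideal_gen_min k (free_operad k) 3 (assoc_relations k) word_kernel).
apply/span_subvP => _ /mapP[s _ ->]; apply: word_kernel_act.
rewrite mem_word_kernel /assoc_relator -scaleN1r addrC word_form_linear.
by rewrite !word_form_mono // scaleN1r addNr.
Qed.

Definition to_ass n (c : tvec k n) : Ass k n :=
  morph (quotient_proj (quadratic_ideal (assoc_relations k))) c.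

Lemma to_ass_linear n : linear (@to_ass n).
Proof. by move=> a x y; rewrite /to_ass morph_linear. Qed.

Lemma to_ass_act n (s : 'S_n) c : to_ass (free_act s c) = act s (to_ass c).
Proof. exact: (morph_act (quotient_proj (quadratic_ideal (assoc_relations k))) s c). Qed.

Lemma to_ass_comp m n p (e : (m + n = p.+1)%N) (i : 'I_m) x y :
  to_ass (free_comp e i x y) = comp e i (to_ass x) (to_ass y).
Proof. exact: (morph_comp (quotient_proj (quadratic_ideal (assoc_relations k))) e i x y). Qed.

Lemma to_assK n (x : Ass k n) : to_ass (vsval x) = x.
Proof. exact: projqK. Qed.

Lemma to_ass_assoc : to_ass (mono k 3 (Node (Node (Leaf 0) (Leaf 1)) (Leaf 2)))
  = to_ass (mono k 3 (Node (Leaf 0) (Node (Leaf 1) (Leaf 2)))).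
Proof.
apply/projqP; apply: (subvP (ideal_gen_sub _)).
rewrite -/(assoc_relator k) -[assoc_relator k]free_act1.
by apply: memv_span; apply: map_f; rewrite mem_enum.
Qed.

End Associative.

Lemma relabel_iota t p q : leaves t = iota p q ->
  exists2 t0, t = relabel (addn p) t0 & leaves t0 = iota 0 q.
Proof.
move=> E; exists (relabel (subn^~ p) t); last first.
  have -> : iota 0 q = map (subn^~ p) (map (addn p) (iota 0 q)).
    by rewrite -map_comp -[LHS]map_id; apply: eq_map => l /=; rewrite addKn.
  by rewrite leaves_relabel E -iotaDl addn0.
rewrite relabel_comp -[LHS]subst_Leaf; apply: eq_subst => l.
by rewrite E mem_iota => /andP[pl _] /=; rewrite subnKC.
Qed.

Lemma graft_pair u v0 :
  graft 0 (graft 1 (Node (Leaf 0) (Leaf 1)) v0) u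
  = Node u (relabel (addn (size (leaves u))) v0).
Proof.
rewrite /graft /= /relabel subst_subst; congr Node.
  by rewrite -[RHS]subst_Leaf; apply: eq_subst.
apply: eq_subst => l _ /=; rewrite /shift /=; congr Leaf.
by rewrite addnC.
Qed.

Lemma graft_triple X u v0 w0 : all (fun l => l < 3)%N (leaves X) ->
  graft 0 (graft 1 (graft 2 X w0) v0) u
  = subst (fun l => nth (Leaf 0)
      [:: u; relabel (addn (size (leaves u))) v0;
          relabel (addn (size (leaves u) + size (leaves v0))) w0] l) X.
Proof.
move=> X3; rewrite /graft !subst_subst; apply: eq_subst => l lX.
have : (l < 3)%N by apply: (allP X3).
case: l {lX} => [|[|[|//]]] _ /=.
- by rewrite -[RHS]subst_Leaf; apply: eq_subst.
- rewrite /relabel !subst_subst; apply: eq_subst => i _ /=.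
  by rewrite /shift /=; congr Leaf; lia.
rewrite /relabel !subst_subst; apply: eq_subst => i _ /=.
by rewrite /shift /=; congr Leaf; lia.
Qed.

Lemma multilinear_iota n t : leaves t = iota 0 n -> multilinear n t.
Proof. by rewrite /multilinear => ->. Qed.

Lemma wcomb_iotaS n : wcomb (iota 0 n.+2) = Node (wcomb (iota 0 n.+1)) (Leaf n.+1).
Proof.
have -> : iota 0 n.+2 = rcons (iota 0 n.+1) n.+1 by rewrite -cats1 -[n.+2]addn1 iotaD.
by rewrite /wcomb /= comb_rcons.
Qed.

Section AssociativeWords.
Variable k : fieldType.

(** [Node] is a composite of the generator with both subtrees, hence respects equality in [Ass].
    Leaves in increasing order avoid permutations; [vv'] ranges over trees on [iota 0 q] because the
    right subtree is renumbered before composing. *)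
Lemma to_ass_node p q u u' v v' :
  leaves u = iota 0 p -> leaves v = iota p q -> leaves u' = iota 0 p ->
  leaves v' = iota p q ->
  to_ass (mono k p u) = to_ass (mono k p u') ->
  (forall v0 v0', leaves v0 = iota 0 q -> leaves v0' = iota 0 q ->
     to_ass (mono k q v0) = to_ass (mono k q v0')) ->
  to_ass (mono k (p + q) (Node u v)) = to_ass (mono k (p + q) (Node u' v')).
Proof.
move=> Eu Ev Eu' Ev' uu' vv'.
have e1 : (2 + q = q.+1.+1)%N by [].
have e0 : (q.+1 + p = (p + q).+1)%N by rewrite addSn addnC.
pose i1 : 'I_2 := Ordinal (isT : (1 < 2)%N).
have su : size (leaves u) = p by rewrite Eu size_iota.
have su' : size (leaves u') = p by rewrite Eu' size_iota.
have [v0 -> Ev0] := relabel_iota Ev; have [v0' -> Ev0'] := relabel_iota Ev'.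
have F a b : leaves a = iota 0 p -> leaves b = iota 0 q ->
    to_ass (mono k (p + q) (Node a (relabel (addn p) b)))
    = comp e0 ord0 (comp e1 i1 (to_ass (mono k 2 (Node (Leaf 0) (Leaf 1))))
        (to_ass (mono k q b))) (to_ass (mono k p a)).
  move=> Ea Eb; rewrite -!to_ass_comp; congr to_ass.
  have Ma := multilinear_iota Ea; have Mb := multilinear_iota Eb.
  have M2 : multilinear 2 (Node (Leaf 0) (Leaf 1)) by [].
  have M3 := multilinear_graft i1 e1 M2 Mb.
  by rewrite free_comp_mono // free_comp_mono // graft_pair Ea size_iota.
by rewrite !F // uu' (vv' _ _ Ev0 Ev0').
Qed.

Lemma to_ass_rotate p q r u v w :
  leaves u = iota 0 p -> leaves v = iota p q -> leaves w = iota (p + q) r ->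
  to_ass (mono k (p + q + r) (Node u (Node v w)))
  = to_ass (mono k (p + q + r) (Node (Node u v) w)).
Proof.
move=> Eu Ev Ew.
have [v0 -> Ev0] := relabel_iota Ev; have [w0 -> Ew0] := relabel_iota Ew.
have Mu := multilinear_iota Eu; have Mv := multilinear_iota Ev0.
have Mw := multilinear_iota Ew0.
have e1 : (3 + r = r.+2.+1)%N by [].
have e2 : (r.+2 + q = (q + r).+1.+1)%N by rewrite !addSn addnC.
have e3 : ((q + r).+1 + p = (p + q + r).+1)%N by rewrite addSn addnC addnA.
pose i1 : 'I_r.+2 := Ordinal (isT : (1 < r.+2)%N).
pose i2 : 'I_3 := Ordinal (isT : (2 < 3)%N).
have F X : multilinear 3 X ->
    to_ass (mono k (p + q + r) (subst (fun l => nth (Leaf 0)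
      [:: u; relabel (addn p) v0; relabel (addn (p + q)) w0] l) X))
    = comp e3 ord0 (comp e2 i1 (comp e1 i2 (to_ass (mono k 3 X))
        (to_ass (mono k r w0))) (to_ass (mono k q v0))) (to_ass (mono k p u)).
  move=> MX; rewrite -!to_ass_comp; congr to_ass.
  have M1 := multilinear_graft i2 e1 MX Mw.
  have M2 := multilinear_graft i1 e2 M1 Mv.
  rewrite free_comp_mono // free_comp_mono // free_comp_mono // graft_triple.
    by rewrite Eu Ev0 !size_iota.
  by apply/allP => l; rewrite (mem_multilinear _ MX).
have := F (Node (Leaf 0) (Node (Leaf 1) (Leaf 2))) isT; rewrite /= => ->.
have := F (Node (Node (Leaf 0) (Leaf 1)) (Leaf 2)) isT; rewrite /= => ->.
by rewrite to_ass_assoc.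
Qed.

(** By induction the right subtree becomes a comb, its last leaf is split off by one application of
    associativity, and what remains on the left is a smaller tree. *)
Lemma to_ass_iota n t : leaves t = iota 0 n ->
  to_ass (mono k n t) = to_ass (mono k n (wcomb (iota 0 n))).
Proof.
elim/ltn_ind: n t => n IH [l|u v] /= E.
  by case: n IH E => [|[|n]] //= _ [->].
set p := size (leaves u); set q := size (leaves v).
have p0 : (0 < p)%N := size_leaves_gt0 u; have q0 : (0 < q)%N := size_leaves_gt0 v.
have np : n = (p + q)%N by rewrite -size_cat E size_iota.
rewrite np iotaD in E; move/eqP: E; rewrite eqseq_cat ?size_iota //.
move=> /andP[/eqP Eu /eqP Ev].
rewrite {}np in IH *.
have IHp t t' : leaves t = iota 0 p -> leaves t' = iota 0 p ->
    to_ass (mono k p t) = to_ass (mono k p t').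
  by move=> Et Et'; rewrite !IH ?Et ?Et' //; lia.
have IHq t t' : leaves t = iota 0 q -> leaves t' = iota 0 q ->
    to_ass (mono k q t) = to_ass (mono k q t').
  by move=> Et Et'; rewrite !IH ?Et ?Et' //; lia.
have lw m : (0 < m)%N -> leaves (wcomb (iota 0 m)) = iota 0 m.
  by move=> m0; rewrite leaves_wcomb //; case: m m0.
have lws a m : (0 < m)%N -> leaves (wcomb (iota a m)) = iota a m.
  by move=> m0; rewrite leaves_wcomb //; case: m m0.
case: q q0 IH Ev IHq => [//|[|q]] _ IH Ev IHq.
  have Ev' : leaves (Leaf p) = iota p 1 by [].
  rewrite (to_ass_node Eu Ev (lw _ p0) Ev' (IHp _ _ Eu (lw _ p0)) IHq).
  by rewrite addn1; case: p p0 {Eu Ev IH IHp IHq Ev'} => // p _; rewrite wcomb_iotaS.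
have Er : iota p q.+2 = iota p q.+1 ++ [:: (p + q.+1)%N] by rewrite -[q.+2]addn1 iotaD.
have Ev' : leaves (Node (wcomb (iota p q.+1)) (Leaf (p + q.+1)%N)) = iota p q.+2.
  by rewrite Er -[in RHS](lws p q.+1).
rewrite (to_ass_node Eu Ev (lw _ p0) Ev' (IHp _ _ Eu (lw _ p0)) IHq).
rewrite -[q.+2]addn1 addnA (to_ass_rotate (r := 1)) ?lw ?lws //.
have pq0 : (0 < p + q.+1)%N by rewrite addnS.
have Eu2 : leaves (Node (wcomb (iota 0 p)) (wcomb (iota p q.+1))) = iota 0 (p + q.+1).
  by rewrite iotaD -[in RHS](lw p) // -[in RHS](lws _ q.+1).
have Ev2 : leaves (Leaf (p + q.+1)%N) = iota (p + q.+1) 1 by [].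
have pq : (p + q.+1 < p + q.+2)%N by rewrite ltn_add2l.
have q1 : (1 < p + q.+2)%N by rewrite !addnS.
rewrite (to_ass_node Eu2 Ev2 (lw _ pq0) Ev2).
- by rewrite addn1 addnS wcomb_iotaS.
- by rewrite (IH _ pq _ Eu2).
by move=> v0 v0' E1 E2; rewrite (IH _ q1 _ E1) (IH _ q1 _ E2).
Qed.

Lemma to_ass_word n t : multilinear n t ->
  to_ass (mono k n t) = to_ass (mono k n (wcomb (leaves t))).
Proof.
move=> Mt; have [s Es] := perm_iotaE Mt.
have n0 : (0 < n)%N by rewrite -(size_multilinear Mt) size_leaves_gt0.
have i0 : iota 0 n != [::] by case: n n0 {Mt s Es}.
pose t0 := relabel (permn s^-1%g) t.
have E0 : leaves t0 = iota 0 n.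
  by rewrite leaves_relabel Es -map_comp (eq_map (permnK s)) map_id.
have -> : mono k n t = free_act s (mono k n t0).
  by rewrite free_act_mono ?multilinear_iota // relabel_permnKV.
rewrite to_ass_act (to_ass_iota E0) -to_ass_act free_act_mono.
  by rewrite relabel_wcomb // Es.
by apply: multilinear_iota; rewrite leaves_wcomb.
Qed.

Lemma to_ass_word_form n (c : tvec k n) : to_ass (word_form c) = to_ass c.
Proof.
move: c; apply: tvec_ext => [||t Mt].
- exact: linear_comp_raw (@to_ass_linear k n) (@word_form_linear k n).
- exact: to_ass_linear.
by rewrite word_form_mono // -to_ass_word.
Qed.

(* The coefficient of the word [W] in an element of [Ass n], the latter being
   identified with the regular representation. *)
Definition acoef n (x : Ass k n) (W : seq nat) : k :=
  coef (word_form (vsval x)) (wcomb W).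

(** Independence of the representative: two of them differ by an element of the ideal, which
    [word_form] kills. *)
Lemma acoef_to_ass n (c : tvec k n) W :
  acoef (to_ass c) W = coef (word_form c) (wcomb W).
Proof.
congr (coef _ _); apply/eqP; rewrite -subr_eq0 -[- _]scaleN1r.
have := subvP (assoc_ideal_sub_word_kernel k n) _
  (projq_repr (quadratic_ideal (assoc_relations k) n) c).
rewrite mem_word_kernel addrC -[- c]scaleN1r word_form_linear addrC.
by [].
Qed.

Lemma acoef_linear n W : linear (fun x : Ass k n => acoef x W : k^o).
Proof.
move=> a x y; rewrite -(to_assK x) -(to_assK y) -to_ass_linear !acoef_to_ass.
by rewrite word_form_linear coef_linear.
Qed.

Lemma coef_word_form_mono n t W : multilinear n t -> W != [::] ->
  perm_eq W (iota 0 n) ->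
  coef (word_form (mono k n t)) (wcomb W) = (W == leaves t)%:R.
Proof.
move=> Mt W0 PW; rewrite word_form_mono // coef_mono; last first.
  by rewrite /multilinear leaves_wcomb.
congr (_%:R); congr nat_of_bool; apply/eqP/eqP => [E|->//].
by rewrite -(leaves_wcomb W0) E leaves_wcomb_leaves.
Qed.

Lemma word_form_coef0 n (c : tvec k n) t : multilinear n t ->
  t != wcomb (leaves t) -> coef (word_form c) t = 0.
Proof.
move=> Mt nt; move: c; apply: (@tvec_ext k n k^o) => [a x y|a x y|u Mu].
- by rewrite word_form_linear (coef_linear _ a).
- by rewrite scaler0 addr0.
rewrite word_form_mono // coef_mono //; case: eqP => // E.
by rewrite E leaves_wcomb_leaves eqxx in nt.
Qed.

Lemma eq_acoef n (x y : Ass k n) :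
  (forall W, perm_eq W (iota 0 n) -> acoef x W = acoef y W) -> x = y.
Proof.
move=> xy; rewrite -(to_assK x) -(to_assK y) -to_ass_word_form -[RHS]to_ass_word_form.
congr to_ass; apply: tvec_coefP => t Mt.
have [->|nt] := eqVneq t (wcomb (leaves t)); last by rewrite !word_form_coef0.
exact: xy.
Qed.

Lemma acoef_act n (s : 'S_n) (x : Ass k n) W : perm_eq W (iota 0 n) -> W != [::] ->
  acoef (act s x) (map (permn s) W) = acoef x W.
Proof.
move=> PW W0; rewrite -(to_assK x) -to_ass_act !acoef_to_ass word_form_act.
by rewrite -relabel_wcomb // coef_free_act // /multilinear leaves_wcomb.
Qed.

Lemma perm_iota_neq0 n W : (0 < n)%N -> perm_eq W (iota 0 n) -> W != [::].
Proof. by move=> n0 /perm_size; rewrite size_iota -size_eq0 => ->; rewrite -lt0n. Qed.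

Lemma perm_wgraft p m w w' : perm_eq w (iota 0 p.+1) -> perm_eq w' (iota 0 m) ->
  (0 < m)%N -> perm_eq (wgraft w w') (iota 0 (p + m)).
Proof.
move=> Pw Pw' m0.
have lw m' v : (0 < m')%N -> perm_eq v (iota 0 m') -> leaves (wcomb v) = v.
  by move=> h /(perm_iota_neq0 h); apply: leaves_wcomb.
rewrite -(lw _ _ (ltn0Sn p) Pw) -(lw _ _ m0 Pw') -leaves_graft0.
apply: (multilinear_graft (ord0 : 'I_p.+1) (addSn p m)).
  by rewrite /multilinear (lw _ _ _ Pw).
by rewrite /multilinear (lw _ _ m0 Pw').
Qed.

(** One bilinear reduction to monomials for two situations: with [z] true, [W] is the composite of
    [w] and [w'] only; with [z] false, [W] is no composite and these words are placeholders. *)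
Lemma acoef_comp_expand p m N (e : (p.+1 + m = N.+1)%N) (c : tvec k p.+1)
    (d : tvec k m) W w w' (z : bool) :
  perm_eq W (iota 0 N) -> perm_eq w (iota 0 p.+1) -> perm_eq w' (iota 0 m) ->
  (0 < m)%N ->
  (forall v v', perm_eq v (iota 0 p.+1) -> perm_eq v' (iota 0 m) ->
    (W == wgraft v v') = [&& z, w == v & w' == v']) ->
  acoef (comp e ord0 (to_ass c) (to_ass d)) W
  = z%:R * (acoef (to_ass c) w * acoef (to_ass d) w').
Proof.
move=> PW Pw Pw' m0 H; rewrite -to_ass_comp !acoef_to_ass.
have lW n v : linear (fun x : tvec k n => coef (word_form x) v : k^o).
  by move=> a x y; rewrite word_form_linear coef_linear.
move: c; apply: (@tvec_ext k p.+1 k^o) => [||s Ms].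
- apply: (linear_comp_raw (lW N (wcomb W))).
  exact: (free_comp_linearl e ord0 d).
- move=> a x y; rewrite lW mulrDl mulrDr; congr (_ + _).
  have key (A B C D : k) : A * (B * C * D) = B * (A * (C * D)) by ring.
  exact: key.
move: d; apply: (@tvec_ext k m k^o) => [||t Mt].
- apply: (linear_comp_raw (lW N (wcomb W))).
  exact: (free_comp_linearr e ord0 _).
- move=> a x y; rewrite lW !mulrDr; congr (_ + _).
  have key (A B C D : k) : A * (C * (B * D)) = B * (A * (C * D)) by ring.
  exact: key.
have N0 : (0 < N)%N by move: e m0; clear; lia.
rewrite free_comp_mono // !coef_word_form_mono ?(perm_iota_neq0 _ PW)
  ?(perm_iota_neq0 _ Pw) ?(perm_iota_neq0 _ Pw') //; last first.
  exact: (multilinear_graft ord0 e Ms Mt).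
rewrite leaves_graft0 H //.
by case: z {H} => /=; case: eqP; case: eqP; rewrite ?mulr1 ?mul0r ?mulr0.
Qed.

Lemma acoef_comp p m N (e : (p.+1 + m = N.+1)%N) (x : Ass k p.+1) (y : Ass k m)
    w w' :
  perm_eq w (iota 0 p.+1) -> perm_eq w' (iota 0 m) -> (0 < m)%N ->
  acoef (comp e ord0 x y) (wgraft w w') = acoef x w * acoef y w'.
Proof.
move=> Pw Pw' m0; rewrite -(to_assK x) -(to_assK y).
have NE : N = (p + m)%N by move: e; clear; lia.
rewrite (acoef_comp_expand e _ _ (w := w) (w' := w') (z := true)) ?mul1r //.
  by rewrite NE; apply: perm_wgraft.
move=> v v' Pv Pv' /=; apply/eqP/andP => [|[/eqP-> /eqP->] //].
by case/(wgraft_inj m0 Pw Pv Pw' Pv') => -> ->.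
Qed.

Lemma acoef_comp0 p m N (e : (p.+1 + m = N.+1)%N) (x : Ass k p.+1) (y : Ass k m) W :
  perm_eq W (iota 0 N) -> (0 < m)%N ->
  (forall v v', perm_eq v (iota 0 p.+1) -> perm_eq v' (iota 0 m) ->
    W != wgraft v v') ->
  acoef (comp e ord0 x y) W = 0.
Proof.
move=> PW m0 H; rewrite -(to_assK x) -(to_assK y).
rewrite (acoef_comp_expand e _ _ (w := iota 0 p.+1) (w' := iota 0 m)
  (z := false)) ?mul0r //.
by move=> v v' Pv Pv' /=; apply/negbTE/H.
Qed.
End AssociativeWords.

(** * Cochains and weights *)

Section Cochains.
Variable k : fieldType.
Local Notation R := (prelie_relations k).
Local Notation cochain := (cochain R (Ass k)).

Lemma extend_linear (phi : cochain) n : linear (@extend k R (Ass k) phi n).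
Proof. by move=> a x y; rewrite /extend !linearP. Qed.

Lemma kappa_koszul n f : kappa n f \in koszul_dual R n.
Proof. by apply/mem_koszul_dual; exists f. Qed.

Lemma extend_val (phi : cochain) n (c : subvs_of (koszul_dual R n)) :
  extend phi (vsval c) = phi n c.
Proof. by rewrite /extend vsvalK. Qed.

Lemma extend0 (phi : cochain) n (c : tvec k n) : phi n = 0 -> extend phi c = 0.
Proof. by rewrite /extend => ->; rewrite zero_lfunE. Qed.

Lemma cochain_eq (phi psi : cochain) n :
  (forall f, extend phi (kappa n f) = extend psi (kappa n f)) -> phi n = psi n.
Proof.
move=> H; apply/lfunP => c; rewrite -!extend_val.
by have [f ->] := (iffLR (mem_koszul_dual _)) (subvsP c).
Qed.

Lemma comp_suml m n p (e : (m + n = p.+1)%N) (i : 'I_m) (I : finType)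
    (a : I -> k) (x : I -> Ass k m) (y : Ass k n) :
  comp e i (\sum_j a j *: x j) y = \sum_j a j *: comp e i (x j) y.
Proof. exact: (linear_sum_raw _ _ (comp_linearl e i y)). Qed.

Lemma apply_tensor_tensor n (B : {set 'I_n}) (phi psi : cochain)
    (x : tvec k (n - #|B|).+1) (y : tvec k #|B|) :
  apply_tensor phi psi (tensor x y) =
  (-1) ^+ ((n - #|B|) * #|B|.-1) *:
    comp (arity_eq B) ord0 (extend phi x) (extend psi y).
Proof.
transitivity (\sum_(s : monomial (n - #|B|).+1) \sum_(t : monomial #|B|)
    ((-1) ^+ ((n - #|B|) * #|B|.-1) * ((x s : k) * y t)) *:
      comp (arity_eq B) ord0 (extend phi (mono k _ (val s)))
        (extend psi (mono k _ (val t)))).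
  by rewrite pair_bigA; apply: eq_bigr => p _; rewrite ffunE.
rewrite -[in RHS](lin_ext_id x) -[in RHS](lin_ext_id y) /lin_ext.
rewrite (linear_sum_raw _ _ (@extend_linear phi _)).
rewrite (linear_sum_raw _ _ (@extend_linear psi _)) comp_suml scaler_sumr.
apply: eq_bigr => s _; rewrite (linear_sum_raw _ _ (comp_linearr _ _ _)).
rewrite !scaler_sumr; apply: eq_bigr => t _; rewrite !scalerA.
by rewrite mulrA.
Qed.

Definition two_level_term n (B : {set 'I_n}) (phi psi : cochain) f : Ass k n :=
  comp (arity_eq B) ord0 (extend phi (kappa _ (root_weight B f)))
    (extend psi (kappa _ (fun=> 1)))
  + comp (arity_eq B) ord0 (extend phi (kappa _ (fun j => (j == 0%N)%:R)))
    (extend psi (kappa _ (upper_weight B f))).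

(** The sign from decomposing [kappa] and the Koszul sign in [apply_tensor] have the same exponent
    [(n - #|B|)(#|B| - 1)], so they cancel and the sign of the unshuffle is left. *)
Lemma prelie_prod_kappa (phi psi : cochain) n f :
  extend (prelie_prod phi psi) (kappa n f) =
  \sum_(B : {set 'I_n}) (-1) ^+ psign (unshuffle B) *:
    act (unshuffle B) (two_level_term B phi psi f).
Proof.
rewrite {1}/extend prelie_prodE vsprojK ?kappa_koszul //; apply: eq_bigr => B _.
rewrite infdec_kappa (linearZ_raw _ _ (@apply_tensor_linear k R (Ass k) n B phi psi)).
rewrite (linearD_raw _ _ (@apply_tensor_linear k R (Ass k) n B phi psi)).
rewrite !apply_tensor_tensor -scalerDr scalerA -mulrA.
rewrite -(signr_odd _ ((n - #|B|) * _)) -expr2 sqrr_sign mulr1.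
by rewrite (linearZ_raw _ _ (act_linear _)).
Qed.

Lemma two_level_term0 n (B : {set 'I_n}) (phi psi : cochain) f :
  phi (n - #|B|).+1 = 0 \/ psi #|B| = 0 -> two_level_term B phi psi f = 0.
Proof.
rewrite /two_level_term => -[z|z]; rewrite !(extend0 _ z).
  by rewrite !(linear0_raw (comp_linearl (arity_eq B) ord0 _)) addr0.
by rewrite !(linear0_raw (comp_linearr (arity_eq B) ord0 _)) addr0.
Qed.

(* [phi] is given in arity [n] by the weights [g]: as an element of
   [Perm(n)* (x) Ass(n)], the invariants are spanned by one signed sum for each
   position of the distinguished letter in the word. *)
Definition weighted (phi : cochain) n (g : nat -> k) : Prop :=
  forall f W, perm_eq W (iota 0 n) ->
    acoef (extend phi (kappa n f)) W
    = (-1) ^+ inversions W * \sum_(0 <= i < n) g i * f (nth 0%N W i).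

Lemma weighted_inj (phi psi : cochain) n g h :
  weighted phi n g -> weighted psi n h -> (forall i, (i < n)%N -> g i = h i) ->
  phi n = psi n.
Proof.
move=> Hphi Hpsi gh; apply: cochain_eq => f; apply: eq_acoef => W PW.
rewrite Hphi // Hpsi //; congr (_ * _); apply: eq_big_nat => i /andP[_ ni].
by rewrite gh.
Qed.

Lemma weighted0 (phi : cochain) n : phi n = 0 -> weighted phi n (fun=> 0).
Proof.
move=> phi0 f W PW; rewrite extend0 // big1 ?mulr0 => [|i _]; last by rewrite mul0r.
exact: (linear0_raw (@acoef_linear k n W)).
Qed.

Lemma acoef_scale n (a : k) (x : Ass k n) W : acoef (a *: x) W = a * acoef x W.
Proof. exact: (linearZ_raw _ _ (@acoef_linear k n W)). Qed.

Lemma acoefD n (x y : Ass k n) W : acoef (x + y) W = acoef x W + acoef y W.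
Proof. exact: (linearD_raw _ _ (@acoef_linear k n W)). Qed.

Lemma acoef_arity0 n (x : Ass k n) W : n = 0%N -> acoef x W = 0.
Proof.
move=> n0; rewrite /acoef /coef big1 // => u; move: (size_leaves_gt0 (val u)).
by rewrite (size_multilinear (valP u)) [X in (_ < X)%N]n0.
Qed.

Lemma weighted_equivariant (phi : cochain) n g : weighted phi n g ->
  forall (s : 'S_n) c, c \in koszul_dual R n ->
    extend phi (free_act s c) = act s (extend phi c).
Proof.
move=> Hphi s _ /mem_koszul_dual[f ->].
rewrite act_kappa (linearZ_raw _ _ (@extend_linear phi n)).
apply: eq_acoef => W PW; have [n0|n0] := posnP n.
  by rewrite !acoef_arity0.
pose W1 := map (permn s^-1%g) W.
have PW1 : perm_eq W1 (iota 0 n) by apply: perm_iota_permn.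
have WE : W = map (permn s) W1.
  by rewrite -map_comp (eq_map (permnKV s)) map_id.
rewrite acoef_scale Hphi // {3}WE acoef_act ?(perm_iota_neq0 n0) // Hphi //.
rewrite mulrA; congr (_ * _).
  rewrite WE -(signr_odd _ (inversions _)) odd_inversions_permn // signr_addb mulrA.
  by rewrite -expr2 sqrr_sign mul1r signr_odd.
apply: eq_big_nat => i /andP[_ ni]; congr (_ * f _) => /=.
by rewrite (nth_map 0%N) // (perm_size PW) size_iota.
Qed.

Lemma equivariant_weighted (phi : cochain) n : equivariant phi ->
  exists g, weighted phi n g.
Proof.
(* Equivariance moves any word to the identity word, so the weights are read off there, on the basis
   vector of label [i]. *)
move=> Hphi; exists (fun i => acoef (extend phi (kappa n (fun l => (l == i)%:R))) (iota 0 n)).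
move=> f W PW; have [s Es] := perm_iotaE PW.
have [n0|n0] := posnP n.
  by rewrite acoef_arity0 // big_geq ?n0 // mulr0.
have E : kappa n f = (-1) ^+ psign s *: free_act s (kappa n (f \o permn s)).
  rewrite act_kappa scalerA -expr2 sqrr_sign scale1r; apply: eq_kappa => l _ /=.
  by rewrite permnKV.
rewrite {1}E (linearZ_raw _ _ (@extend_linear phi n)) acoef_scale Hphi ?kappa_koszul //.
rewrite Es acoef_act ?(perm_iota_neq0 n0) // -[in RHS]signr_odd -/(psign s).
congr (_ * _); rewrite kappa_delta (linear_sum_raw _ _ (@extend_linear phi n)).
rewrite (linear_sum_raw _ _ (@acoef_linear k n _)) big_mkord.
apply: eq_bigr => i _; rewrite (nth_map 0%N) ?size_iota // nth_iota // add0n mulrC.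
by [].
Qed.

(** A retraction of [kappa] that is linear on all of [tvec k n]; it allows a cochain to be defined
    without choosing [f]. *)
Definition head_coef n (c : tvec k n) (a : nat) : k :=
  ncoef c (comb a (rem a (iota 0 n))).

Lemma head_coef_kappa n f a : (a < n)%N -> head_coef (kappa n f) a = f a.
Proof.
move=> an; rewrite /head_coef ncoef_kappa ?head_leaf_comb //.
by rewrite /multilinear leaves_comb perm_sym perm_to_rem // mem_iota.
Qed.

Lemma acoef_comb_supported n (c : tvec k n) W :
  (forall u : monomial n, val u != wcomb (leaves (val u)) -> c u = 0) ->
  (0 < n)%N -> perm_eq W (iota 0 n) -> acoef (to_ass c) W = coef c (wcomb W).
Proof.
move=> Hc n0 PW; have W0 := perm_iota_neq0 n0 PW.
rewrite acoef_to_ass; congr (coef _ _); rewrite -[RHS]lin_ext_id.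
apply: eq_bigr => u _; have [uE|/Hc->] := eqVneq (val u) (wcomb (leaves (val u))).
  by rewrite -uE.
by rewrite !scale0r.
Qed.

Lemma exists_weighted n g : (0 < n)%N -> exists psi : cochain,
  [/\ equivariant psi, forall m, m != n -> psi m = 0 & weighted psi n g].
Proof.
move=> n0.
(* The prescribed coefficient of each word is placed on its comb, and [head_coef] stands for the
   unknown [f]. *)
pose G m (c : subvs_of (koszul_dual R m)) : Ass k m := if m == n then
  to_ass [ffun u : monomial m => (val u == wcomb (leaves (val u)))%:R
    * ((-1) ^+ inversions (leaves (val u))
       * \sum_(0 <= i < m) g i * head_coef (vsval c) (nth 0%N (leaves (val u)) i))]
  else 0.
have lG m : linear (G m).
  move=> a x y; rewrite /G; case: ifP => _; last by rewrite scaler0 addr0.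
  rewrite -to_ass_linear; congr to_ass; apply/ffunP => u; rewrite !ffunE.
  have key (A B C D X : k) : B = X * C + D -> A * B = X * (A * C) + A * D.
    by move=> ->; ring.
  apply: (key); apply: (key).
  rewrite mulr_sumr -big_split; apply: eq_bigr => i _ /=.
  apply: (key); rewrite /head_coef /ncoef coef_linear.
  by rewrite mulrDl; congr (_ + _); apply: (esym (mulrA _ _ _)).
pose psi : cochain := fun m => sval (linfun_raw (lG m)).
have psiE m c : psi m c = G m c by rewrite /psi; case: linfun_raw.
have psi0 m : m != n -> psi m = 0.
  by move=> mn; apply/lfunP => c; rewrite psiE /G (negPf mn) zero_lfunE.
have Wpsi : weighted psi n g.
  move=> f W PW; rewrite /extend psiE /G eqxx vsprojK ?kappa_koszul //.
  have W0 := perm_iota_neq0 n0 PW.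
  have MW : multilinear n (wcomb W) by rewrite /multilinear leaves_wcomb.
  rewrite acoef_comb_supported //; last first.
    by move=> u /negPf uE; rewrite ffunE uE mul0r.
  rewrite (coef_multilinear _ MW) ffunE SubK leaves_wcomb // eqxx mul1r; congr (_ * _).
  apply: eq_big_nat => i /andP[_ ni]; rewrite head_coef_kappa //.
  have := mem_nth 0%N (_ : i < size W)%N; rewrite (perm_mem PW) mem_iota.
  by rewrite (perm_size PW) size_iota => /(_ ni).
exists psi; split=> // m s c cK; have [mn|mn] := eqVneq m n.
  case: _ / (esym mn) in s c cK *; exact: (weighted_equivariant Wpsi).
by rewrite !extend0 ?psi0 // (linear0_raw (act_linear s)).
Qed.
End Cochains.

(** * Blocks of consecutive letters and the pre-Lie product *)

Lemma wgraft_decomposition q m w w' : perm_eq w (iota 0 q.+1) -> size w' = m ->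
  exists w1 w3, [/\ w = w1 ++ 0%N :: w3, size w1 = index 0%N w,
    0%N \notin w1, 0%N \notin w3
    & wgraft w w' = [seq (l + m).-1 | l <- w1] ++ w' ++ [seq (l + m).-1 | l <- w3]].
Proof.
move=> Pw sw'; have uw : uniq w by rewrite (perm_uniq Pw) iota_uniq.
have w0 : 0%N \in w by rewrite (perm_mem Pw) mem_iota.
have [w1 [w3 [E s1 h1 h3]]] := split_uniq0 uw w0.
by exists w1, w3; split=> //; rewrite {1}E wgraft_split // sw'.
Qed.

Lemma nth_wgraft_upper q m w w' j : perm_eq w (iota 0 q.+1) -> size w' = m ->
  (j < m)%N -> nth 0%N (wgraft w w') (index 0%N w + j) = nth 0%N w' j.
Proof.
move=> Pw sw' jm; have [w1 [w3 [_ s1 _ _ ->]]] := wgraft_decomposition Pw sw'.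
rewrite nth_cat size_map -s1 ltnNge leq_addr /= addKn nth_cat sw' jm.
by [].
Qed.

Lemma nth_wgraft_root q m w w' i : perm_eq w (iota 0 q.+1) -> size w' = m ->
  (0 < m)%N -> (i < q.+1)%N -> i != index 0%N w ->
  nth 0%N (wgraft w w') (if (i < index 0 w)%N then i else (i + m.-1)%N)
  = (nth 0%N w i + m).-1.
Proof.
move=> Pw sw' m0 iq ip; have sw : size w = q.+1 by rewrite (perm_size Pw) size_iota.
have [w1 [w3 [E s1 _ _ ->]]] := wgraft_decomposition Pw sw'.
have sw3 : (size w1 + (size w3).+1 = q.+1)%N by rewrite -sw E size_cat.
rewrite -s1 in ip *; case: ltnP => ip'.
  by rewrite nth_cat size_map ip' (nth_map 0%N) // E nth_cat ip'.
have {ip ip'} ip : (size w1 < i)%N by rewrite ltn_neqAle eq_sym ip.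
have [r ir] : exists r, i = (size w1 + r.+1)%N.
  by exists (i - (size w1).+1)%N; move: ip; clear; lia.
rewrite {}ir in iq *; have rw : (r < size w3)%N by move: iq sw3; clear; lia.
rewrite nth_cat size_map -addnA ltnNge leq_addr /= addKn.
have -> : (r.+1 + m.-1 = m + r)%N by move: m0; clear; lia.
rewrite nth_cat sw' ltnNge leq_addr /= addKn (nth_map 0%N) //.
by rewrite E nth_cat ltnNge leq_addr /= addKn.
Qed.

Definition block n (W : seq nat) (p m : nat) : {set 'I_n} :=
  [set x : 'I_n | val x \in take m (drop p W)].

(** A word is a composite along [B] when the letters of [B] are consecutive in it: contracting them
    to one letter gives the root word, where the contracted letter 0 stands at position [p].
    [block_unique] is the converse. *)
Lemma block_decomposition n W p m :
  perm_eq W (iota 0 n) -> (p + m <= n)%N ->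
  #|block n W p m| = m /\ exists w w', [/\ perm_eq w (iota 0 (n - m).+1),
    perm_eq w' (iota 0 m), index 0%N w = p
    & map (permn (unshuffle (block n W p m))) (wgraft w w') = W].
Proof.
move=> PW pm; have sW : size W = n by rewrite (perm_size PW) size_iota.
set W1 := take p W; set W2 := take m (drop p W); set W3 := drop m (drop p W).
have WE : W = W1 ++ W2 ++ W3 by rewrite !cat_take_drop.
have s1 : size W1 = p by rewrite size_take_min sW; apply/minn_idPl; lia.
have s2 : size W2 = m.
  by rewrite size_take_min size_drop sW; apply/minn_idPl; lia.
have Ptr : perm_eq (W2 ++ (W1 ++ W3)) (iota 0 n).
  by rewrite perm_catCA -WE.
have /= := unshuffle_split Ptr; rewrite -/(block n W p m) s2.
set B := block n W p m => -[cB]; rewrite cB => P2 P13; split=> //.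
set u := unshuffle B in P2 P13 *.
pose v := permn u^-1%g.
have vK : cancel v (permn u) := permnKV u.
have Kv : cancel (permn u) v := permnK u.
have Pv13 : perm_eq (map v (W1 ++ W3)) (iota m (n - m)).
  by rewrite (perm_trans (perm_map _ P13)) // -map_comp (eq_map Kv) map_id.
have Pv2 : perm_eq (map v W2) (iota 0 m).
  by rewrite (perm_trans (perm_map _ P2)) // -map_comp (eq_map Kv) map_id.
have ge_m l : l \in W1 ++ W3 -> (m <= v l)%N.
  by move=> /(map_f v); rewrite (perm_mem Pv13) mem_iota => /andP[].
pose a l := ((v l).+1 - m)%N.
have a0 X : {subset X <= W1 ++ W3} -> 0%N \notin map a X.
  by move=> XW; apply/mapP => -[l /XW/ge_m]; rewrite /a; clear; lia.
have i1 : {subset W1 <= W1 ++ W3} by move=> l; rewrite mem_cat => ->.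
have i3 : {subset W3 <= W1 ++ W3} by move=> l; rewrite mem_cat orbC => ->.
have sv2 : size (map v W2) = m by rewrite size_map.
exists (map a W1 ++ 0%N :: map a W3), (map v W2); split=> //.
- rewrite perm_catC /= perm_cons -map_cat (perm_trans (y := map a (W1 ++ W3))) //.
    by apply: perm_map; rewrite perm_catC.
  have -> : map a (W1 ++ W3) = map (fun l => l.+1 - m)%N (map v (W1 ++ W3)).
    by rewrite -map_comp.
  rewrite (perm_trans (perm_map _ Pv13)) //.
  have -> : iota m (n - m) = map (addn m) (iota 0 (n - m)) by rewrite -iotaDl addn0.
  rewrite -map_comp (eq_map (g := fun l => 1 + l)%N) => [|l /=]; last by lia.
  by rewrite -iotaDl.
- by rewrite index_cat (negPf (a0 _ i1)) size_map s1 /= addn0.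
rewrite wgraft_split ?a0 // sv2.
have b X : {subset X <= W1 ++ W3} ->
    map (permn u) [seq (l + m).-1 | l <- map a X] = X.
  move=> XW; rewrite -!map_comp -[RHS]map_id; apply/eq_in_map => l /XW/ge_m ml /=.
  by rewrite /a subnK ?leqW // vK.
by rewrite !map_cat !b // [RHS]WE -map_comp (eq_map vK) map_id.
Qed.

Lemma block_unique n (B : {set 'I_n}) W w w' :
  perm_eq w (iota 0 (n - #|B|).+1) -> perm_eq w' (iota 0 #|B|) ->
  map (permn (unshuffle B)) (wgraft w w') = W ->
  B = block n W (index 0%N w) #|B|.
Proof.
move=> Pw Pw' <-; have sw' : size w' = #|B| by rewrite (perm_size Pw') size_iota.
have [w1 [w3 [E s1 _ _ ->]]] := wgraft_decomposition Pw sw'.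
apply/setP => x; rewrite inE -map_drop -map_take drop_size_cat ?size_map //.
rewrite take_size_cat //.
have := unshuffle_mem B ((unshuffle B)^-1%g x); rewrite permKV => ->.
have -> : val x = permn (unshuffle B) ((unshuffle B)^-1%g x).
  by rewrite permnE permKV.
rewrite (mem_map (@permn_inj _ _)) (perm_mem Pw') mem_iota.
by [].
Qed.

Section Products.
Variable k : fieldType.
Local Notation R := (prelie_relations k).
Local Notation cochain := (cochain R (Ass k)).

(* The contribution to a product of the two-vertex trees whose upper vertex has
   as inputs the [m] consecutive letters of the word from position [p] on; the
   functional [F |-> sum_i g_i F_i] stands for the weights [g]. *)
Definition insertion_term (g h : nat -> k) (q m p : nat) (F : nat -> k) : k :=
  (\sum_(0 <= j < m) h j) * (\sum_(0 <= i < q) g i *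
      (if i == p then 0 else F (if (i < p)%N then i else (i + m.-1)%N)))
  + g p * (\sum_(0 <= j < m) h j * F (p + j)%N).

(** By [inversions_wgraft] the signs of the unshuffle and of the two words combine to that of [W],
    except for the sign of moving a cochain of degree [1 - #|B|] past the odd letters in front of
    the insertion. *)
Lemma acoef_two_level_term n (B : {set 'I_n}) (phi psi : cochain) g h f W w w' :
  (0 < #|B|)%N -> weighted phi (n - #|B|).+1 g -> weighted psi #|B| h ->
  perm_eq w (iota 0 (n - #|B|).+1) -> perm_eq w' (iota 0 #|B|) ->
  map (permn (unshuffle B)) (wgraft w w') = W ->
  (-1) ^+ psign (unshuffle B) *
    acoef (act (unshuffle B) (two_level_term B phi psi f)) W
  = (-1) ^+ inversions W * ((-1) ^+ (index 0%N w * #|B|.-1) *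
     insertion_term g h (n - #|B|).+1 #|B| (index 0%N w) (fun i => f (nth 0%N W i))).
Proof.
move=> B0 Hphi Hpsi Pw Pw' WE.
have Bn : (#|B| <= n)%N by rewrite -[X in (_ <= X)%N](card_ord n) max_card.
have Pww : perm_eq (wgraft w w') (iota 0 n).
  by rewrite -[n in iota 0 n](subnK Bn); apply: perm_wgraft.
have n0 : (0 < n)%N := leq_trans B0 Bn.
have sw' : size w' = #|B| by rewrite (perm_size Pw') size_iota.
have sww : size (wgraft w w') = n by rewrite (perm_size Pww) size_iota.
rewrite -{1}WE acoef_act ?(perm_iota_neq0 n0) // acoefD !acoef_comp //.
rewrite !Hphi // !Hpsi //.
have -> : (-1) ^+ inversions W = (-1) ^+ psign (unshuffle B) *
    (-1) ^+ (index 0%N w * #|B|.-1) * ((-1) ^+ inversions w * (-1) ^+ inversions w') :> k.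
  have uw : uniq w by rewrite (perm_uniq Pw) iota_uniq.
  have w0 : 0%N \in w by rewrite (perm_mem Pw) mem_iota.
  rewrite -signr_odd -WE odd_inversions_permn // signr_addb -mulrA; congr (_ * _).
  by rewrite signr_odd (inversions_wgraft Pw' B0 uw w0) !exprD mulrC.
have iw : (index 0%N w < (n - #|B|).+1)%N.
  have -> : (n - #|B|).+1 = size w by rewrite (perm_size Pw) size_iota.
  by rewrite index_mem (perm_mem Pw) mem_iota.
have S1 : \sum_(0 <= i < (n - #|B|).+1) g i * root_weight B f (nth 0%N w i)
    = \sum_(0 <= i < (n - #|B|).+1) g i *
      (if i == index 0%N w then 0 else
       f (nth 0%N W (if (i < index 0 w)%N then i else (i + #|B|.-1)%N))).
  apply: eq_big_nat => i /andP[_ ni]; congr (_ * _); rewrite /root_weight.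
  have [->|ip] := eqVneq i (index 0%N w).
    by rewrite nth_index // (perm_mem Pw) mem_iota.
  have -> : (nth 0%N w i == 0%N) = false.
    apply/negP => /eqP wi; case/eqP: ip.
    have uw : uniq w by rewrite (perm_uniq Pw) iota_uniq.
    by rewrite -wi index_uniq // (perm_size Pw) size_iota.
  congr f; rewrite -WE (nth_map 0%N); first by rewrite (nth_wgraft_root Pw sw').
  by rewrite sww; case: ifP => _; move: ni Bn B0 iw; clear; lia.
have S2 : \sum_(0 <= i < (n - #|B|).+1) g i * (nth 0%N w i == 0%N)%:R
    = g (index 0%N w).
  rewrite (bigD1_seq (index 0%N w)) ?mem_index_iota ?iota_uniq //=.
  rewrite nth_index ?(perm_mem Pw) ?mem_iota // eqxx mulr1 big_seq_cond big1 ?addr0 //.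
  move=> i /andP[]; rewrite mem_index_iota => /andP[_ ni] ip.
  case: eqP => [wi|_]; last by rewrite mulr0.
  have uw : uniq w by rewrite (perm_uniq Pw) iota_uniq.
  by case/eqP: ip; rewrite -wi index_uniq // (perm_size Pw) size_iota.
have S3 : \sum_(0 <= j < #|B|) h j * upper_weight B f (nth 0%N w' j)
    = \sum_(0 <= j < #|B|) h j * f (nth 0%N W (index 0%N w + j)).
  apply: eq_big_nat => j /andP[_ jB]; rewrite /upper_weight -WE (nth_map 0%N).
    by rewrite (nth_wgraft_upper Pw sw').
  by rewrite sww; move: iw jB Bn; clear; lia.
have S4 : \sum_(0 <= j < #|B|) h j * 1 = \sum_(0 <= j < #|B|) h j.
  by apply: eq_bigr => j _; rewrite mulr1.
rewrite /insertion_term S1 S2 S3 S4; set a := (-1) ^+ psign _.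
set b := (-1) ^+ (_ * _)%N; have bb : b * b = 1 by rewrite -expr2 /b -signr_odd sqrr_sign.
set x := (-1) ^+ _; set y := (-1) ^+ _; set s1 := \sum_(0 <= i < _) _ * _.
set s3 := \sum_(0 <= i < _) _ * _; set s4 := \sum_(_ <= _ < _) _.
transitivity (a * (b * b) * (x * y) * (s4 * s1 + g (index 0%N w) * s3)).
  by rewrite bb; ring.
by ring.
Qed.

Lemma prelie_prod_weighted n m (phi psi : cochain) g h f W :
  perm_eq W (iota 0 n) -> (0 < m <= n)%N ->
  weighted phi (n - m).+1 g -> weighted psi m h ->
  (forall B : {set 'I_n}, #|B| != m -> phi (n - #|B|).+1 = 0 \/ psi #|B| = 0) ->
  acoef (extend (prelie_prod phi psi) (kappa n f)) W
  = (-1) ^+ inversions W * \sum_(0 <= p < (n - m).+1) (-1) ^+ (p * m.-1) *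
      insertion_term g h (n - m).+1 m p (fun i => f (nth 0%N W i)).
Proof.
move=> PW /andP[m0 mn] Hphi Hpsi Hz; rewrite prelie_prod_kappa.
rewrite (linear_sum_raw _ _ (@acoef_linear k n W)).
pose T (B : {set 'I_n}) : k := (-1) ^+ psign (unshuffle B) *
  acoef (act (unshuffle B) (two_level_term B phi psi f)) W.
pose hb (p : 'I_(n - m).+1) := block n W p m.
have pm (p : 'I_(n - m).+1) : (p + m <= n)%N.
  by have := ltn_ord p; move: mn; clear; lia.
have hb_inj : injective hb.
  move=> p p' E; apply: val_inj => /=.
  have [cB [w [w' [Pw Pw' wp WE]]]] := block_decomposition PW (pm p).
  have [cB' [v [v' [Pv Pv' vp VE]]]] := block_decomposition PW (pm p').
  rewrite -/(hb p) in WE; rewrite -/(hb p') -E in VE; rewrite -wp -vp.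
  have := permn_inj (s := unshuffle (hb p)) => /inj_map inj.
  by have [-> _] := wgraft_inj m0 Pw Pv Pw' Pv' (inj _ _ (etrans WE (esym VE))).
(* Sets of another size vanish by [Hz]; for a set of size [m] that is not a block, [W] is not a
   composite along it. *)
transitivity (\sum_(B in hb @: setT) T B).
  rewrite [RHS]big_mkcond; apply: eq_bigr => B _; case: ifP => [//|nB].
  suff : acoef (act (unshuffle B) (two_level_term B phi psi f)) W = 0.
    by move=> ->; rewrite [_ *: _]mulr0.
  have [cB|cB] := eqVneq #|B| m; last first.
    rewrite (two_level_term0 _ (Hz B cB)) (linear0_raw (act_linear _)).
    exact: (linear0_raw (@acoef_linear k n W)).
  have n0 : (0 < n)%N := leq_trans m0 mn.
  have W0 := perm_iota_neq0 n0 PW.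
  pose W1 := map (permn (unshuffle B)^-1%g) W.
  have PW1 : perm_eq W1 (iota 0 n) by apply: perm_iota_permn.
  have WE : W = map (permn (unshuffle B)) W1.
    by rewrite -map_comp (eq_map (permnKV _)) map_id.
  rewrite WE acoef_act ?(perm_iota_neq0 n0) // acoefD.
  have H v v' : perm_eq v (iota 0 (n - #|B|).+1) -> perm_eq v' (iota 0 #|B|) ->
      W1 != wgraft v v'.
    move=> Pv Pv'; apply/negP => /eqP E; case/negP: nB.
    have iv : (index 0%N v < (n - m).+1)%N.
      have -> : (n - m).+1 = size v by rewrite (perm_size Pv) size_iota cB.
      by rewrite index_mem (perm_mem Pv) mem_iota.
    apply/imsetP; exists (Ordinal iv) => //; rewrite /hb /= -cB.
    by apply: (block_unique Pv Pv'); rewrite -E.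
  by rewrite !acoef_comp0 ?addr0 // cB.
rewrite big_imset /=; last by move=> p p' _ _; apply: hb_inj.
rewrite mulr_sumr big_mkord (eq_bigl (fun=> true)) => [|p]; last by rewrite inE.
apply: eq_bigr => p _; rewrite /T.
have [cB [w [w' [Pw Pw' wp WE]]]] := block_decomposition PW (pm p).
rewrite -/(hb p) in cB WE.
rewrite -cB in Hphi Hpsi Pw Pw' m0.
by rewrite (acoef_two_level_term f m0 Hphi Hpsi Pw Pw' WE) wp cB.
Qed.

End Products.

(** * The complex of weights and its exactness *)

Section WeightComplex.
Variable k : fieldType.
Implicit Types g h F : nat -> k.

(** The differential paired with an arbitrary [F] rather than given by components, which avoids
    separate cases at the first and last positions; components are recovered on indicators. *)
Definition weight_diff n g F : k :=
  if odd n then (\sum_(0 <= i < n) g i) * F 0%N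
    + \sum_(0 <= i < n) g i * ((odd i)%:R * (F i - F i.+1))
  else \sum_(0 <= i < n) g i * F (i + odd i)%N - (\sum_(0 <= i < n) g i) * F 0%N.

Lemma sum_delta n G j : (j < n)%N ->
  \sum_(0 <= i < n) G i * (i == j)%:R = G j :> k.
Proof.
move=> jn; rewrite (bigD1_seq j) ?mem_index_iota ?iota_uniq //= eqxx mulr1.
by rewrite big1 ?addr0 // => i /negPf->; rewrite mulr0.
Qed.

Lemma weight_diff_ker_odd n g : odd n -> (forall F, weight_diff n g F = 0) ->
  \sum_(0 <= i < n) g i = 0 /\ forall j, (j < n)%N -> odd j -> g j = 0.
Proof.
move=> on H; split=> [|j jn oj].
  have := H (fun i => (i == 0%N)%:R); rewrite /weight_diff on mulr1.
  rewrite [X in _ + X]big1 ?addr0 // => -[|i] _; first by rewrite mul0r mulr0.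
  by rewrite subr0 !mulr0.
rewrite -(sum_delta g jn) -[RHS](H (fun i => (i == j)%:R)) /weight_diff on.
have -> : (0%N == j) = false by case: j oj {jn}.
rewrite mulr0 add0r; apply: eq_bigr => i _; congr (_ * _).
have [->|ij] := eqVneq i j.
  by rewrite oj -[X in (_ == X)%N]addn0 -addn1 eqn_add2l subr0 mulr1.
have [oi|] := boolP (odd i); last by rewrite mul0r.
have -> : (i.+1 == j) = false by apply/negP => /eqP ji; move: oj; rewrite -ji /= oi.
by rewrite subr0 mulr0.
Qed.

Lemma weight_diff_ker_even n g : ~~ odd n ->
  (forall F, weight_diff n.+2 g F = 0) ->
  g n.+1 = 0 /\ forall j, (j < n)%N -> odd j -> g j.+1 = - g j.
Proof.
(* An indicator of a positive position kills the [F 0] term. For [j] odd the value [j.+1] is hit by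
   [i = j] and, within range, [i = j.+1]; at the top, [j = n.+1], only the former remains. *)
move=> en H; have H0 j : \sum_(0 <= i < n.+2) g i * ((i + odd i)%N == j.+1)%:R = 0.
  have := H (fun i => (i == j.+1)%:R).
  by rewrite /weight_diff /= negbK (negPf en) mulr0 subr0.
split=> [|j jn oj].
  rewrite -(sum_delta g (ltnSn n.+1)) -[RHS](H0 n.+1); apply: eq_big_nat => i /andP[_ ni].
  congr (_ * _%:R); congr nat_of_bool; case: (boolP (odd i)) => oi.
    by rewrite addn1 eqSS.
  rewrite addn0 [RHS]ltn_eqF // ltn_eqF // ltn_neqAle -ltnS ni andbT.
  by apply/negP => /eqP ie; rewrite ie /= en in oi.
apply/eqP; rewrite -subr_eq0 opprK.
have jn1 : (j.+1 < n.+2)%N by move: jn; clear; lia.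
have jn2 : (j < n.+2)%N by move: jn; clear; lia.
rewrite -(sum_delta g jn1) -(sum_delta g jn2) -big_split -[X in _ == X](H0 j).
apply/eqP/eq_bigr => i _ /=; rewrite -mulrDr; congr (_ * _).
case: (boolP (odd i)) => oi.
  have -> : (i == j.+1) = false by apply/negP => /eqP ij; rewrite ij /= oj in oi.
  by rewrite addn1 eqSS add0r.
have -> : (i == j) = false by apply/negP => /eqP ij; rewrite ij oj in oi.
by rewrite addn0 addr0.
Qed.

Lemma weight_diff_exact n g : (forall F, weight_diff n.+2 g F = 0) ->
  exists h, forall F, weight_diff n.+1 h F = \sum_(0 <= i < n.+2) g i * F i.
Proof.
move=> H; have [on|en] := boolP (odd n).
  have [S0 g0] := weight_diff_ker_odd (n := n.+2) (g := g) (etrans (negbK _) on) H.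
  (* In the even arity [n.+1] an odd position [i] feeds position [i.+1], which gives the even
     positive entries of [g]; its odd entries vanish. The entry at 0 is then right because the total
     of [g] is zero. *)
  exists (fun i => (odd i)%:R * g i.+1) => F; rewrite /weight_diff /= on /=.
  have E : \sum_(0 <= i < n.+1) (odd i)%:R * g i.+1 = \sum_(0 <= i < n.+1) g i.+1.
    apply: eq_big_nat => i /andP[_ ni]; have [oi|ei] := boolP (odd i).
      by rewrite mul1r.
    by rewrite mul0r g0.
  have {}E : \sum_(0 <= i < n.+1) (odd i)%:R * g i.+1 = - g 0%N.
    by apply/eqP; rewrite -addr_eq0 E addrC -big_nat_recl // S0.
  rewrite E mulNr opprK [RHS]big_nat_recl // [LHS]addrC; congr (_ + _).
  apply: eq_big_nat => i /andP[_ ni]; have [oi|ei] := boolP (odd i).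
    by rewrite mul1r addn1.
  by rewrite mul0r g0 // !mul0r.
have [gn gj] := weight_diff_ker_even en H.
pose T := \sum_(0 <= i < n.+1) (odd i)%:R * g i.
(* In the odd arity [n.+1] the odd entries are copied, and the relation [gj] yields the even ones.
   Subtracting [T] at position 0 adjusts the total of the preimage to [g 0], as required at position
   0. *)
exists (fun i => (odd i)%:R * g i + (g 0%N - T) * (i == 0%N)%:R) => F.
rewrite /weight_diff /= en big_split /= (sum_delta (fun=> g 0%N - T)) // -/T.
rewrite [T + _]addrC subrK [RHS]big_nat_recl //=; congr (_ + _).
transitivity (\sum_(0 <= i < n.+1) (odd i)%:R * g i * F i
              + \sum_(0 <= i < n.+1) (odd i)%:R * g i.+1 * F i.+1).
  rewrite -big_split; apply: eq_big_nat => i /andP[_ ni] /=.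
  have [oi|ei] := boolP (odd i); last by rewrite !mul0r mulr0 addr0.
  have -> : (i == 0%N) = false by case: i oi {ni}.
  rewrite gj //; last first.
    rewrite ltn_neqAle -ltnS ni andbT; apply/negP => /eqP ie; by rewrite -ie oi in en.
  by rewrite mulr0 !addr0 !mul1r mulrBr mulNr.
(* A shift of the index by one: the term at 0 vanishes since 0 is even, and the term at [n.+1] by
   [gn]. *)
have -> : \sum_(0 <= i < n.+1) (odd i)%:R * g i * F i
    = \sum_(0 <= i < n.+1) (~~ odd i)%:R * g i.+1 * F i.+1.
  transitivity (\sum_(0 <= i < n.+2) (odd i)%:R * g i * F i).
    by rewrite [RHS]big_nat_recr //= gn mulr0 mul0r addr0.
  by rewrite [LHS]big_nat_recl //= !mul0r add0r.
rewrite -big_split /=; apply: eq_bigr => i _ /=.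
by case: odd; rewrite !(mul0r, mul1r, add0r, addr0).
Qed.

Lemma alternating_sum n : \sum_(0 <= p < n) (-1) ^+ p = (odd n)%:R :> k.
Proof.
elim: n => [|n IHn]; first by rewrite big_nil.
rewrite big_nat_recr //= IHn -signr_odd; case: odd; rewrite ?expr0 ?expr1 ?add0r //.
by rewrite subrr.
Qed.

Lemma big_nat2 (G : nat -> k) : \sum_(0 <= i < 2) G i = G 0%N + G 1%N.
Proof. by rewrite big_nat_recl // big_nat1. Qed.

Lemma insertion_term_root n g F p : (p < 2)%N -> (0 < n)%N ->
  insertion_term (fun i => (i == 0%N)%:R) g 2 n p F
  = if p == 0%N then \sum_(0 <= i < n) g i * F i
    else (\sum_(0 <= i < n) g i) * F 0%N.
Proof.
rewrite /insertion_term big_nat2; case: p => [|[|//]] _ n0 /=.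
  by rewrite mul0r mulr0 addr0 mulr0 add0r mul1r; apply: eq_bigr.
by rewrite mul1r !mul0r !addr0.
Qed.

Lemma insertion_term_upper n g F p : (p < n)%N ->
  insertion_term g (fun i => (i == 0%N)%:R) n 2 p F
  = \sum_(0 <= i < n) g i * F (if (i <= p)%N then i else i.+1).
Proof.
move=> pn; rewrite /insertion_term !big_nat2 /= mul1r mul0r !addr0 mul1r addn0.
rewrite -(sum_delta (fun i => g i * F i) pn) -big_split; apply: eq_bigr => i _ /=.
have [->|ip] := eqVneq i p; first by rewrite leqnn mulr0 add0r mulr1.
rewrite mulr0 addr0 [(i <= p)%N]leq_eqVlt (negPf ip) /=.
by case: ifP => // _; rewrite addn1.
Qed.

(** Inserting [alpha] at [p] keeps the distinguished position [i] if [i <= p] and moves it to [i.+1]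
    otherwise. The alternating signs over these two ranges of [p] sum to [odd n - odd i] and
    [odd i], which is how parities enter the differential. *)
Lemma weight_diffE n g F : (0 < n)%N ->
  \sum_(0 <= p < 2) (-1) ^+ (p * n.-1) *
     insertion_term (fun i => (i == 0%N)%:R) g 2 n p F
  - (-1) ^+ n.-1 * \sum_(0 <= p < n) (-1) ^+ (p * 1) *
     insertion_term g (fun i => (i == 0%N)%:R) n 2 p F
  = weight_diff n g F.
Proof.
move=> n0; rewrite big_nat2 !insertion_term_root // mul0n mul1n expr0 mul1r /=.
have -> : \sum_(0 <= p < n) (-1) ^+ (p * 1) *
     insertion_term g (fun i => (i == 0%N)%:R) n 2 p F
   = \sum_(0 <= i < n) g i * (((odd n)%:R - (odd i)%:R) * F i + (odd i)%:R * F i.+1).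
  transitivity (\sum_(0 <= p < n) \sum_(0 <= i < n)
      g i * ((-1) ^+ p * F (if (i <= p)%N then i else i.+1))).
    apply: eq_big_nat => p /andP[_ pn]; rewrite insertion_term_upper // muln1 mulr_sumr.
    by apply: eq_bigr => i _; rewrite mulrCA.
  rewrite exchange_big_nat; apply: eq_big_nat => i /andP[_ ni].
  rewrite -mulr_sumr; congr (_ * _).
  rewrite (big_cat_nat (n := i)) //=; last exact: ltnW.
  rewrite addrC; congr (_ + _).
    rewrite -!alternating_sum (big_cat_nat (leq0n i) (ltnW ni)) /=.
    rewrite [X in _ = X * _]addrC addKr mulr_suml; apply: eq_big_nat => p /andP[ip _].
    by rewrite ip.
  rewrite -alternating_sum mulr_suml; apply: eq_big_nat => p /andP[_ pi].
  by rewrite leqNgt pi.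
rewrite /weight_diff; set S := \sum_(0 <= i < n) g i.
have -> : (-1) ^+ n.-1 = (if odd n then 1 else -1) :> k.
  by rewrite -signr_odd; case: n n0 {S} => //= n _; case: odd; rewrite ?expr0 ?expr1.
case: odd.
  rewrite !mul1r addrAC addrC -sumrB; congr (_ + _); apply: eq_bigr => i _.
  by case: odd => /=; ring.
rewrite !mulN1r opprK addrAC; congr (_ - _); rewrite -big_split.
apply: eq_bigr => i _ /=; case: odd => /=; rewrite ?addn1 ?addn0 /=; ring.
Qed.

End WeightComplex.

(** * The differential in terms of weights, and acyclicity *)

Section Differential.
Variable k : fieldType.
Local Notation R := (prelie_relations k).
Local Notation cochain := (cochain R (Ass k)).
Local Notation alpha := (alpha (prelie_to_ass k)).

Lemma alpha_arity n : n != 2 -> alpha n = 0.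
Proof. by move=> n2; apply/lfunP => c; rewrite alphaE (negPf n2) zero_lfunE. Qed.

Lemma alpha_weighted : weighted alpha 2 (fun i => (i == 0%N)%:R).
Proof.
move=> f W PW; have W0 := perm_iota_neq0 (isT : (0 < 2)%N) PW.
have MW : multilinear 2 (wcomb W) by rewrite /multilinear leaves_wcomb.
rewrite /extend alphaE vsprojK ?kappa_koszul //=.
rewrite (inducedE (@prelie_sub_assoc k)) -/(to_ass (kappa 2 f)).
(* In arity two every monomial is a comb, being determined by its leftmost leaf. *)
rewrite acoef_comb_supported // => [|u /eqP[]]; last first.
  apply: multilinear_head_inj (valP u) (multilinear_wcomb (valP u)) _ => //.
  by rewrite -!nth0_leaves leaves_wcomb_leaves.
rewrite coef_kappa // big_nat2 mul1r mul0r addr0 -nth0_leaves /parity.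
rewrite leaves_wcomb // mulrC; congr ((-1) ^+ _ * _).
have : size W = 2 by rewrite (perm_size PW).
by case: W {PW W0 MW} => [|x [|y [|]]] //= _; rewrite /wcomb /vertices /= !addn0.
Qed.

Lemma extend_def_diff (phi : cochain) d n c :
  extend (def_diff (prelie_to_ass k) d phi) (c : tvec k n)
  = extend (prelie_prod alpha phi) c
    - (-1) ^ (-1 * d) *: extend (prelie_prod phi alpha) c.
Proof. by rewrite /extend /def_diff /bracket add_lfunE opp_lfunE scale_lfunE. Qed.

Lemma def_diff_weighted n (phi : cochain) g : weighted phi n.+1 g ->
  (forall m, m != n.+1 -> phi m = 0) ->
  forall f W, perm_eq W (iota 0 n.+2) ->
  acoef (extend (def_diff (prelie_to_ass k) (1 - n.+1%:Z) phi) (kappa n.+2 f)) W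
  = (-1) ^+ inversions W * weight_diff n.+1 g (fun i => f (nth 0%N W i)).
Proof.
move=> Hphi phi0 f W PW; rewrite extend_def_diff.
have -> : (-1) ^ (-1 * (1 - n.+1%:Z)) = (-1) ^+ n :> k.
  by have -> : -1 * (1 - n.+1%:Z) = n%:Z by lia.
rewrite -scaleNr acoefD acoef_scale.
have e1 : (n.+2 - n.+1).+1 = 2 by rewrite subSn // subnn.
have e2 : (n.+2 - 2).+1 = n.+1 by rewrite subn2.
have Ha : weighted alpha (n.+2 - n.+1).+1 (fun i => (i == 0%N)%:R).
  by rewrite e1; apply: alpha_weighted.
have Hphi2 : weighted phi (n.+2 - 2).+1 g by rewrite e2.
have n1 : (0 < n.+1 <= n.+2)%N by rewrite leqnSn.
have n2 : (0 < 2 <= n.+2)%N by [].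
have Z1 (B : {set 'I_n.+2}) : #|B| != n.+1 -> alpha (n.+2 - #|B|).+1 = 0 \/ phi #|B| = 0.
  by move=> Bn; right; apply: phi0.
have Z2 (B : {set 'I_n.+2}) : #|B| != 2 -> phi (n.+2 - #|B|).+1 = 0 \/ alpha #|B| = 0.
  by move=> Bn; right; apply: alpha_arity.
have E1 := prelie_prod_weighted f PW n1 Ha Hphi Z1.
have E2 := prelie_prod_weighted f PW n2 Hphi2 alpha_weighted Z2.
rewrite [X in _ + _ * X]E2 [X in X + _]E1.
by rewrite e1 e2 -weight_diffE // mulNr mulrCA -mulrBr.
Qed.

Lemma acoef0 n W : acoef (0 : Ass k n) W = 0.
Proof. exact: (linear0_raw (@acoef_linear k n W)). Qed.

Lemma eq_weight_diff n (g F F' : nat -> k) :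
  (forall i, (i <= n)%N -> F i = F' i) -> weight_diff n g F = weight_diff n g F'.
Proof.
move=> FF'; rewrite /weight_diff !FF' //; case: odd; congr (_ + _).
  by apply: eq_big_nat => i /andP[_ ni]; rewrite !FF' // ltnW.
by apply: eq_big_nat => i /andP[_ ni]; rewrite FF' //; case: odd; lia.
Qed.

Lemma prelie_prod0 (phi psi : cochain) n :
  (forall B : {set 'I_n}, phi (n - #|B|).+1 = 0 \/ psi #|B| = 0) ->
  prelie_prod phi psi n = 0.
Proof.
move=> H; apply: (@cochain_eq k _ (fun=> 0)) => f; rewrite [RHS]extend0 //.
rewrite prelie_prod_kappa big1 // => B _.
by rewrite two_level_term0 // (linear0_raw (act_linear _)) scaler0.
Qed.

Lemma def_diff_arity n (phi : cochain) d : (forall m, m != n -> phi m = 0) ->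
  forall m, m != n.+1 -> def_diff (prelie_to_ass k) d phi m = 0.
Proof.
move=> phi0 m mn; rewrite /def_diff /bracket !prelie_prod0 ?scaler0 ?subrr // => B.
  have [Bn|Bn] := eqVneq #|B| 2; last by right; apply: alpha_arity.
  left; apply: phi0; apply: contra mn => /eqP <-.
  have Bm : (#|B| <= m)%N by rewrite -[X in (_ <= X)%N](card_ord m) max_card.
  by apply/eqP; move: Bm; rewrite Bn; clear; lia.
have [Bn|Bn] := eqVneq #|B| n; last by right; apply: phi0.
left; apply: alpha_arity; apply: contra mn => /eqP.
have Bm : (#|B| <= m)%N by rewrite -[X in (_ <= X)%N](card_ord m) max_card.
by rewrite Bn in Bm *; move=> e; apply/eqP; move: e Bm; clear; lia.
Qed.

Lemma def_exact_zero d (phi : cochain) : (forall n, phi n = 0) ->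
  exists2 psi : cochain, def_element (d + 1) psi
    & forall n, phi n = def_diff (prelie_to_ass k) (d + 1) psi n.
Proof.
move=> phi0; exists (fun=> 0); first split=> [n s c _|n /eqP //].
  by rewrite !extend0 // (linear0_raw (act_linear s)).
move=> n; rewrite phi0 /def_diff /bracket !prelie_prod0 ?scaler0 ?subrr // => B.
  by left.
by right.
Qed.

End Differential.

Theorem theorem3p5 (k : fieldType) (char0 : [pchar k] =i pred0) :
  def_acyclic (prelie_to_ass k).
Proof.
(* A homogeneous cochain lives in the single arity [1 - d]. For [d > 1] the absolute value is a junk
   arity, but then [phi] vanishes everywhere and the case [zero] below applies. *)
move=> d phi [phi_eq phi_hom] dphi; pose n := absz (1 - d)%R.
have phi0 m : m != n -> phi m = 0.
  move=> mn; apply/eqP/negP => /negP/phi_hom dm; case/eqP: mn.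
  by rewrite /n dm; lia.
have [g Hg] := equivariant_weighted n phi_eq.
have [zero|nz] := eqVneq (phi n) 0.
  apply: def_exact_zero => m; have [->//|] := eqVneq m n; exact: phi0.
have dn : d = 1 - n%:Z by apply: phi_hom.
have n0 : (0 < n)%N.
  rewrite lt0n; apply/eqP => n0; case/eqP: nz.
  by apply: (@cochain_eq k _ (fun=> 0)) => f; apply: eq_acoef => W _; rewrite !acoef_arity0.
case: n n0 dn Hg phi0 {nz} => [//|n] _ dn Hg phi0.
(* Evaluation on the identity word, which has no inversions and where position and letter agree,
   makes [F] itself the test function. *)
have closed F : weight_diff n.+1 g F = 0.
  have := def_diff_weighted Hg phi0 F (perm_refl (iota 0 n.+2)).
  rewrite -dn inversions_iota expr0 mul1r extend0 ?dphi // acoef0 => e.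
  rewrite [RHS]e; apply: eq_weight_diff => i ni; by rewrite nth_iota.
case: n dn Hg phi0 closed => [|n] dn Hg phi0 closed.
  (* Arity one has no positive arity below it to supply a primitive; there the differential is
     injective, as the constant test function shows. *)
  have g0 : g 0%N = 0.
    have := closed (fun=> 1); rewrite /weight_diff !big_nat1 /= !mulr1.
    by rewrite mul0r mulr0 addr0.
  apply: def_exact_zero => m; have [->|] := eqVneq m 1%N; last exact: phi0.
  apply: (weighted_inj Hg (@weighted0 k (fun=> 0) 1 (erefl _))) => i.
  by rewrite ltnS leqn0 => /eqP->.
have [h Hh] := weight_diff_exact closed.
have [psi [psi_eq psi0 Hpsi]] := exists_weighted h (ltn0Sn n).
have dn1 : d + 1 = 1 - n.+1%:Z by rewrite dn; lia.
exists psi.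
  split=> // m; have [-> _|/psi0->] := eqVneq m n.+1; first exact: dn1.
  by rewrite eqxx.
move=> m; have [->|mn] := eqVneq m n.+2; last first.
  exact: etrans (phi0 m mn) (esym (def_diff_arity _ psi0 mn)).
apply: cochain_eq => f; apply: eq_acoef => W PW.
by rewrite Hg // dn1 (def_diff_weighted Hpsi psi0 f PW) Hh.
Qed.
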